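(* There exist two positive absolute constants $C_1, C_2$ such that the following holds. Let $q_0\in L^2(\mathbb{R})$ and let $q=q(\xi,t)$ be the $L^2$-solution of the defocusing NLS equation $i\,\partial_t q=-\partial_\xi^2 q+2|q|^2q$ on $\mathbb{R}$ with initial datum $q|_{t=0}=q_0$. Then for every $t\in\mathbb{R}$ and every $s\in[-1,0]$, $$C_1\bigl(1+\|q_0\|_{L^2(\mathbb{R})}\bigr)^{2s}\,\|q_0\|_{H^s(\mathbb{R})}\le \|q(\cdot,t)\|_{H^s(\mathbb{R})}\le C_2\bigl(1+\|q_0\|_{L^2(\mathbb{R})}\bigr)^{-2s}\,\|q_0\|_{H^s(\mathbb{R})}.$$
   Context: Fourier transform: $(\mathcal{F}f)(\eta)=\frac{1}{\sqrt{2\pi}}\int_{\mathbb{R}}f(x)e^{-i\eta x}\,dx$. Sobolev norm: $\|f\|_{H^s(\mathbb{R})}=\left(\int_{\mathbb{R}}(1+|\eta|^2)^s|(\mathcal{F}f)(\eta)|^2\,d\eta\right)^{1/2}$. Functions are complex-valued. $L^2$-solution: for $q_0$ in the Schwartz class $\mathcal{S}(\mathbb{R})$ the NLS equation has a unique global classical solution, with $q(\cdot,t)\in\mathcal{S}(\mathbb{R})$ for all $t\in\mathbb{R}$. For $q_0\in L^2(\mathbb{R})$, take any $q_{0,n}\in\mathcal{S}(\mathbb{R})$ converging to $q_0$ in $L^2(\mathbb{R})$, and let $q_n$ be the classical solution with datum $q_{0,n}$. It is known that there is a function $q(\xi,t)$, independent of the choice of the sequence, such that $\lim_{n\to\infty}\|q_n(\cdot,t)-q(\cdot,t)\|_{L^2(\mathbb{R})}=0$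 for every $t\in\mathbb{R}$; this $q$ is called the $L^2$-solution corresponding to $q_0$. *)

(* Defs.v *)
From HB Require Import structures.
From mathcomp Require Import all_boot all_order all_algebra.
From mathcomp Require Import complex.
From mathcomp Require Import all_classical all_reals all_analysis.

Set Implicit Arguments.
Unset Strict Implicit.
Unset Printing Implicit Defensive.

Import Order.TTheory GRing.Theory Num.Theory.
Import numFieldNormedType.Exports.
Import ComplexField.Normc.

Local Open Scope classical_set_scope.
Local Open Scope ring_scope.
Local Open Scope complex_scope.

Section NLS.
Context {R : realType}.
Local Notation mu := (@lebesgue_measure R).
Implicit Types (f g : R -> R[i]) (q u : R -> R -> R[i]).

(* The library has no derivative, integral or sigma-algebra for functions
   R -> R[i]; these notions are taken on real and imaginary parts. *)

Definition cderivable f (x : R) : Prop :=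
  derivable (fun y => complex.Re (f y)) x 1 /\
  derivable (fun y => complex.Im (f y)) x 1.

Definition cderive1 f : R -> R[i] := fun x =>
  derive1 (fun y => complex.Re (f y)) x +i* derive1 (fun y => complex.Im (f y)) x.

Definition cintegral f : R[i] :=
  (\int[mu]_x complex.Re (f x))%R +i* (\int[mu]_x complex.Im (f x))%R.

Definition cmeasurable f : Prop :=
  measurable_fun [set: R] (fun x => complex.Re (f x)) /\
  measurable_fun [set: R] (fun x => complex.Im (f x)).

Definition L2norm f : \bar R := 'N[mu]_2%:E [ EFin \o (@normc R \o f) ]%E.

Definition in_L2 f : Prop := cmeasurable f /\ (L2norm f < +oo)%E.

Definition cvg_L2 (fn : nat -> R -> R[i]) f : Prop :=
  (fun n => L2norm (fun x => fn n x - f x)) @ \oo --> 0%E.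

Definition schwartz f : Prop :=
  (forall n x, cderivable (iter n cderive1 f) x) /\
  (forall k n, exists M : R,
     forall x, `|x| ^+ k * normc (iter n cderive1 f x) <= M).

Definition cis (a : R) : R[i] := cos a +i* sin a.

Definition fourier_integral f : R -> R[i] := fun eta =>
  ((Num.sqrt (2 * pi))^-1)%:C * cintegral (fun x => f x * cis (- (eta * x))).

(* The integral above need not converge for f in L^2, where the Fourier
   transform is the extension by L^2-continuity from the Schwartz class. *)
Definition is_fourier f g : Prop :=
  in_L2 g /\
  exists fn : nat -> R -> R[i],
    [/\ forall n, schwartz (fn n), cvg_L2 fn f
      & cvg_L2 (fun n => fourier_integral (fn n)) g].

(* For f in L^2 such a g exists and is unique up to a null set (Plancherel);
   a representative is chosen. *)
Definition fourier f : R -> R[i] := xget (fun=> 0) [set g | is_fourier f g].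

Definition sobolev_norm (s : R) f : \bar R :=
  ((\int[mu]_eta ((1 + `|eta| ^+ 2) `^ s * normc (fourier f eta) ^+ 2)%:E)
     `^ 2^-1)%E.

Definition continuous2 u : Prop :=
  continuous (fun p : R * R => complex.Re (u p.1 p.2)) /\
  continuous (fun p : R * R => complex.Im (u p.1 p.2)).

Definition dt u : R -> R -> R[i] := fun xi t => cderive1 (u xi) t.
Definition dxi u : R -> R -> R[i] := fun xi t => cderive1 (u^~ t) xi.

Definition nls_classical_solution u (u0 : R -> R[i]) : Prop :=
  [/\ (forall xi t, [/\ cderivable (u xi) t, cderivable (u^~ t) xi
                      & cderivable ((dxi u)^~ t) xi]),
      [/\ continuous2 u, continuous2 (dt u), continuous2 (dxi u)
        & continuous2 (dxi (dxi u))],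
      (forall xi t, 'i%C * dt u xi t =
         - dxi (dxi u) xi t + 2 * `|u xi t| ^+ 2 * u xi t)
    & (forall xi, u xi 0 = u0 xi)].

Definition nls_schwartz_solution u (u0 : R -> R[i]) : Prop :=
  nls_classical_solution u u0 /\ forall t, schwartz (u^~ t).

(* The limit q does not depend on the approximating sequence, so asking for
   one sequence is the same as asking for all of them. Taking t = 0 shows
   that q(., 0) = q0 almost everywhere. *)
Definition nls_L2_solution q (q0 : R -> R[i]) : Prop :=
  (forall t, in_L2 (q^~ t)) /\
  exists (q0n : nat -> R -> R[i]) (qn : nat -> R -> R -> R[i]),
    [/\ forall n, schwartz (q0n n),
        cvg_L2 q0n q0,
        forall n, nls_schwartz_solution (qn n) (q0n n)
      & forall t, cvg_L2 (fun n => (qn n)^~ t) (q^~ t)].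

End NLS.

(* Main.v *)
Require Import Defs.
From HB Require Import structures.
From mathcomp Require Import all_boot all_order all_algebra.
From mathcomp Require Import complex.
From mathcomp Require Import all_classical all_reals all_analysis.
From mathcomp Require Import measurable_realfun.
From mathcomp Require Import ring lra.

Set Implicit Arguments.
Unset Strict Implicit.
Unset Printing Implicit Defensive.

Import Order.TTheory GRing.Theory Num.Theory.
Import numFieldNormedType.Exports.

Local Open Scope classical_set_scope.
Local Open Scope ring_scope.
Local Open Scope complex_scope.

(** Why the two bounds hold.

    The defocusing equation has a Lax pair. At an imaginary spectral parameter its
    spatial half is the system [f' = (kap / 2) f + q^* g], [g' = q f - (kap / 2) g],
    and the modulus of its transmission coefficient over the whole line does not
    depend on time. Let [Lam] be minus the logarithm of this modulus. The quotient [r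
    = g / f] solves a Riccati equation whose linearization is [w' = q - kap w]. To
    leading order [Lam] is [kap] times the mass (squared [L^2] norm) of [w], that is,
    [kap] times the energy [A (kap) = int |F q|^2 / (kap^2 + eta^2)], and the relative
    error is of order [m / kap], where [m] is the mass of [q] ([zs_log_estimate]).
    Hence for [8 m <= kap] the energies at any two times agree up to an absolute
    factor ([resolvent_mass_compare], [energy_compare]).

    By Stieltjes' formula [(k^2 + eta^2)^s] with [-1 < s < 0] is an average of the
    functions [1 / (lam + k^2 + eta^2)] over [lam > 0], with the weight [lam^s]. So
    the energies for [kap >= k], together with the mass for [s = 0], compare the
    integrals of [|F q|^2 (k^2 + eta^2)^s] at two times, with an absolute factor
    ([energy_interpolation]). The scale [k = 16 (1 + |q0|)^2] is large enough for
    this, and on passing from [(k^2 + eta^2)^s] to [(1 + eta^2)^s] at most the factor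
    [k^(-2 s)] is lost; after a square root this is the factor [(1 + |q0|)^(-2 s)] of
    the theorem.

    Three points need care. A classical solution is not assumed to decay uniformly in
    time, so the conservation law is derived on windows [[- l, l]]. There the quantity
    corresponding to [Lam] has a time derivative, the boundary flux, which is a total
    derivative in [l] plus terms controlled by the mass; averaging over [l] between
    [L] and [2 L] makes it vanish as [L] grows ([zs_logT_conserved]). The mass itself
    is not assumed to be conserved: as [kap] grows, [kap^2 A (kap)] tends to the mass,
    so the comparison of energies shows that the mass takes the same value at both
    ends of any time interval on which it is bounded; since it is lower semicontinuous
    in time, a Baire category argument then shows that it is constant
    ([lsc_rigid_constant], [mass_conserved]). Finally, for [L^2] solutions the Fourier
    transform is a limit along Schwartz sequences, which exists by Plancherel's
    identity ([plancherel], proved by Abel summation) and completeness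
    ([L2_complete]), and the weighted integrals pass to the limit ([weighted_limit]). *)

(** * Calculus of one real variable *)

Section RealCalculus.
Context {R : realType}.
Implicit Types (f g F : R -> R) (x a b : R).

Lemma rD_eq f x a b : is_derive x (1:R) f a -> a = b -> is_derive x (1:R) f b.
Proof. by move=> fa <-. Qed.

Lemma rD_cst (c x : R) : is_derive x (1:R) (fun=> c) 0.
Proof. exact: is_derive_cst. Qed.

Lemma rD_id (x : R) : is_derive x (1:R) (fun y => y) 1.
Proof. exact: is_derive_id. Qed.

Lemma rD_add f g x a b : is_derive x (1:R) f a -> is_derive x (1:R) g b ->
  is_derive x (1:R) (fun y => f y + g y) (a + b).
Proof. by move=> fa gb; exact: is_deriveD. Qed.

Lemma rD_opp f x a : is_derive x (1:R) f a -> is_derive x (1:R) (fun y => - f y) (- a).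
Proof. by move=> fa; exact: is_deriveN. Qed.

Lemma rD_sub f g x a b : is_derive x (1:R) f a -> is_derive x (1:R) g b ->
  is_derive x (1:R) (fun y => f y - g y) (a - b).
Proof. by move=> fa gb; exact: is_deriveB. Qed.

Lemma rD_mul f g x a b : is_derive x (1:R) f a -> is_derive x (1:R) g b ->
  is_derive x (1:R) (fun y => f y * g y) (a * g x + f x * b).
Proof.
move=> fa gb; have := @is_deriveM _ _ f g x 1 a b fa gb.
by move=> /rD_eq; apply; rewrite /GRing.scale /= addrC [g x * a]mulrC.
Qed.

Lemma rD_sqr f x a : is_derive x (1:R) f a ->
  is_derive x (1:R) (fun y => f y ^+ 2) (2 * f x * a).
Proof.
move=> fa; rewrite (_ : (fun y => _) = (fun y => f y * f y)); last first.
  by apply/funext => y; rewrite expr2.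
by apply: (rD_eq (rD_mul fa fa)); ring.
Qed.

Lemma rD_inv f x a : f x != 0 -> is_derive x (1:R) f a ->
  is_derive x (1:R) (fun y => (f y)^-1) (- a / f x ^+ 2).
Proof.
move=> fx0 fa; have := is_deriveV fx0 fa.
by move=> /rD_eq; apply; rewrite /GRing.scale /=; field.
Qed.

Lemma rD_comp f g x a b : is_derive (g x) (1:R) f a -> is_derive x (1:R) g b ->
  is_derive x (1:R) (fun y => f (g y)) (a * b).
Proof. by move=> fa gb; exact: is_derive1_comp. Qed.

Lemma rD_exp f x a : is_derive x (1:R) f a ->
  is_derive x (1:R) (fun y => expR (f y)) (expR (f x) * a).
Proof. by move=> fa; apply: rD_comp => //; exact: is_derive_expR. Qed.

Lemma rD_ln f x a : 0 < f x -> is_derive x (1:R) f a ->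
  is_derive x (1:R) (fun y => ln (f y)) (a / f x).
Proof.
move=> f0 fa; have h := @rD_comp (@ln R) f x _ _ (is_derive1_ln f0) fa.
by apply: (rD_eq h); rewrite mulrC.
Qed.

Lemma continuous_normr f : continuous f -> continuous (fun x => `|f x|).
Proof. by move=> cf x; apply: (@cvg_norm R R^o); exact: cf. Qed.

Lemma rD_continuous f x a : is_derive x (1:R) f a -> {for x, continuous f}.
Proof. by move=> [fd _]; apply: differentiable_continuous; exact/derivable1_diffP. Qed.

(** The one consequence of the mean value theorem on which every a priori
    estimate below rests. *)
Lemma ler_of_derive {F} {dF : R -> R} {a b} : a <= b ->
  (forall x, a <= x <= b -> is_derive x (1:R) F (dF x)) ->
  (forall x, a <= x <= b -> 0 <= dF x) -> F a <= F b.
Proof.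
move=> ab dFd dF0.
have h1 x : x \in `]a, b[%R -> is_derive x (1:R) F (dF x).
  by rewrite in_itv /= => /andP[/ltW ax /ltW xb]; apply: dFd; rewrite ax xb.
have h2 : {within `[a, b], continuous F}.
  apply: derivable_within_continuous => x; rewrite in_itv /= => xab.
  by have [] := dFd x xab.
have [c cab e] := MVT_segment ab h1 h2.
rewrite -subr_ge0 e mulr_ge0 ?subr_ge0//; apply: dF0.
by move: cab; rewrite in_itv.
Qed.

Lemma ger_of_derive {F} {dF : R -> R} {a b} : a <= b ->
  (forall x, a <= x <= b -> is_derive x (1:R) F (dF x)) ->
  (forall x, a <= x <= b -> dF x <= 0) -> F b <= F a.
Proof.
move=> ab dFd dF0; rewrite -lerN2.
apply: (@ler_of_derive (fun x => - F x) (fun x => - dF x)) => // x xab.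
  exact/rD_opp/dFd.
by rewrite oppr_ge0 dF0.
Qed.

(** The functions [G - F] and [G + F] are nondecreasing. *)
Lemma norm_le_of_derive {F} {dF G dG : R -> R} {a b} : a <= b ->
  (forall x, a <= x <= b -> is_derive x (1:R) F (dF x)) ->
  (forall x, a <= x <= b -> is_derive x (1:R) G (dG x)) ->
  (forall x, a <= x <= b -> `|dF x| <= dG x) -> `|F b - F a| <= G b - G a.
Proof.
move=> ab dFd dGd dFG; rewrite ler_norml; apply/andP; split.
  have h := @ler_of_derive (fun x => F x + G x) (fun x => dF x + dG x) a b ab.
  have {h}: F a + G a <= F b + G b.
    apply: h => x xab; first by apply: rD_add; [exact: dFd|exact: dGd].
    by have := dFG x xab; rewrite ler_norml => /andP[h _]; lra.
  lra.
have h := @ler_of_derive (fun x => G x - F x) (fun x => dG x - dF x) a b ab.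
have {h}: G a - F a <= G b - F b.
  apply: h => x xab; first by apply: rD_sub; [exact: dGd|exact: dFd].
  by have := dFG x xab; rewrite ler_norml => /andP[_ h]; lra.
lra.
Qed.

Lemma eq_of_derive0 {F} a b :
  (forall x, is_derive x (1:R) F 0) -> F a = F b.
Proof. by move=> h; exact: is_derive_0_is_cst. Qed.

(** The integral from [- n] is a primitive to the right of [- n] only. Normalized at 0,
    these primitives agree where they are defined, and are glued. *)
Lemma continuous_primitive f : continuous f ->
  exists F, F 0 = 0 /\ forall x, is_derive x (1:R) F (f x).
Proof.
move=> cf.
pose G (n : nat) x := (\int[@lebesgue_measure R]_(t in `[(- n%:R)%R, x]) f t)%R.
have dG n x : - n%:R < x -> is_derive x (1:R) (G n) (f x).
  move=> nx; have x1 : x < x + 1 by rewrite ltrDl.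
  have [|||h1 h2] := @continuous_FTC1 R f (BLeft (- n%:R)) x (x + 1) x1.
  - apply: continuous_compact_integrable; first exact: segment_compact.
    exact: continuous_subspaceT.
  - by rewrite /= lte_fin.
  - exact: cf.
  by split; [exact: h1|rewrite -h2 derive1E].
pose H n x := G n x - G n 0.
have HE n m x : (0 < n)%N -> (n <= m)%N -> `|x| < n%:R -> H n x = H m x.
  move=> n0 nm; rewrite ltr_norml => /andP[nx xn].
  have nm' : (n%:R : R) <= m%:R by rewrite ler_nat.
  have n0' : (0 : R) < n%:R by rewrite ltr0n.
  suff : forall y z, - n%:R < y -> y <= z -> G n z - G m z = G n y - G m y.
    move=> h; rewrite /H; have [x0|/ltW x0] := leP x 0.
      by have := h x 0 nx x0; lra.
    by have := h 0 x; rewrite oppr_lt0 => /(_ n0' x0); lra.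
  move=> y z ny yz; apply/eqP; rewrite eq_le.
  have d w : y <= w <= z -> is_derive w (1:R) (fun w => G n w - G m w) 0.
    move=> /andP[yw _]; apply: rD_eq; first by apply: rD_sub; apply: dG; lra.
    by rewrite subrr.
  by rewrite (ger_of_derive yz d) // (ler_of_derive yz d).
pose F x := H (Num.truncn `|x|).+1 x.
have FE n x : `|x| < n%:R -> F x = H n x.
  move=> xn; rewrite /F; apply: HE => //.
    rewrite -(ltr_nat R); apply: le_lt_trans xn.
    by have /andP[] := truncn_itv (normr_ge0 x).
  by have /andP[] := truncn_itv (normr_ge0 x).
exists F; split; first by rewrite /F /H subrr.
move=> x; pose n := (Num.truncn `|x|).+1.
have xn : `|x| < n%:R by have /andP[] := truncn_itv (normr_ge0 x).
apply: (@near_eq_is_derive _ _ _ (H n)).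
  have : \forall z \near x, `|z| < n%:R.
    by apply: (@cvgr_norm_lt R R^o _ (nbhs x) _ (fun z => z) x _ _ xn); exact: cvg_id.
  by apply: filterS => z zn; rewrite (FE n).
have nx : - n%:R < x by move: xn; rewrite ltr_norml => /andP[].
by apply: (rD_eq (rD_sub (dG n x nx) (rD_cst (G n 0) x))); rewrite subr0.
Qed.

End RealCalculus.

(** Structural differentiation; the derivatives of the functions at the leaves are taken
    from the context. *)
Ltac rD := lazymatch goal with
 | |- is_derive _ _ (fun _ => ?c) _ => eapply (@rD_cst _ c)
 | |- is_derive _ _ (fun y => y) _ => eapply rD_id
 | |- is_derive _ _ (fun y => @?f y + @?g y) _ =>
     eapply (@rD_add _ f g); [rD|rD]
 | |- is_derive _ _ (fun y => - @?f y) _ => eapply (@rD_opp _ f); rD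
 | |- is_derive _ _ (fun y => @?f y * @?g y) _ =>
     eapply (@rD_mul _ f g); [rD|rD]
 | |- is_derive _ _ (fun y => @?f y ^+ 2) _ => eapply (@rD_sqr _ f); rD
 | |- is_derive _ _ (fun y => expR (@?f y)) _ => eapply (@rD_exp _ f); rD
 | _ => try eassumption
 end.

(** * Linear differential systems *)

Section LinearODE.
Context {R : realType}.

Lemma continuous_sumr n (F : 'I_n -> R -> R) :
  (forall i, continuous (F i)) -> continuous (fun x => \sum_i F i x).
Proof.
move=> cF x; elim: n F cF => [|n IH] F cF.
  rewrite (_ : (fun y => _) = (fun=> 0)); first exact: cst_continuous.
  by apply/funext => y; rewrite big_ord0.
rewrite (_ : (fun y => _) = (fun y => (\sum_(i < n) F (widen_ord (leqnSn n) i) y) + F ord_max y)).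
  by apply: (@continuousD _ R^o); [exact: IH|exact: cF].
by apply/funext => y; rewrite big_ord_recr.
Qed.

(** The rate is explicit because the limit of the Picard iterates has to be taken uniformly
    on segments. *)
Lemma geometric_limit (a : nat -> R) (B : R) :
  (forall m, `|a m.+1 - a m| <= B / 2 ^+ m) ->
  forall m, `|a m - limn a| <= 2 * B / 2 ^+ m.
Proof.
move=> aB.
have B0 : 0 <= B by have := aB 0; rewrite expr0 divr1; apply: le_trans.
pose e m := 2 * B / 2 ^+ m.
have eS m : e m = e m.+1 + B / 2 ^+ m.
  by rewrite /e exprS; field; rewrite expf_neq0.
pose u m := a m - e m.
have uv m k : a m - e m <= a (m + k)%N - e (m + k)%N /\ a (m + k)%N + e (m + k)%N <= a m + e m.
  elim: k => [|k [IH1 IH2]]; first by rewrite addn0.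
  rewrite addnS; have := aB (m + k)%N; rewrite ler_norml => /andP[h1 h2].
  move: h1 h2 (eS (m + k)%N) IH1 IH2; set b := B / _ => h1 h2.
  move: (e (m + k)%N) (e (m + k).+1) (e m) => e1 e2 e3 h3 IH1 IH2.
  by split; lra.
have e0 m : 0 <= e m by rewrite /e divr_ge0// ?mulr_ge0// exprn_ge0.
have uub : has_ubound (range u).
  exists (a 0 + e 0) => _ [k _ <-]; have [_] := uv 0%N k.
  by rewrite add0n /u; have := e0 k; lra.
have ul : nondecreasing_seq u.
  by apply/nondecreasing_seqP => k; have [+ _] := uv k 1%N; rewrite addn1.
have uc := nondecreasing_cvgn ul uub.
have ec : e @ \oo --> 0.
  rewrite (_ : e = fun m => (2 * B) * (2^-1) ^+ m); last first.
    by apply/funext => m; rewrite /e exprVn.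
  rewrite -(mulr0 (2 * B)); apply: cvgMr; apply: cvg_expr.
  by rewrite ger0_norm; lra.
have ac : a @ \oo --> sup (range u).
  rewrite (_ : a = (fun m => u m + e m)); last by apply/funext => m; rewrite /u subrK.
  by rewrite -[sup _]addr0; apply: cvgD.
have -> : limn a = sup (range u) by apply/cvg_lim.
move=> m; rewrite -/(e m) distrC ler_distl; apply/andP; split.
  have : u m <= sup (range u) by apply: ub_le_sup => //; exists m.
  by rewrite /u; lra.
have : sup (range u) <= a m + e m.
  apply: ge_sup; first by exists (u 0); exists 0%N.
  move=> _ [k _ <-]; have [km|/ltnW mk] := leqP m k.
    by have [_] := uv m (k - m)%N; rewrite subnKC// /u; have := e0 k; lra.
  have [+ _] := uv k (m - k)%N; rewrite subnKC// /u.
  by have := e0 m; lra.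
lra.
Qed.

Lemma continuous_bounded_segment (f : R -> R) (X : R) : 0 <= X -> continuous f ->
  exists2 B : R, 0 <= B & forall x, `|x| <= X -> `|f x| <= B.
Proof.
move=> X0 cf.
have := @EVT_max R (fun x => `|f x|) (- X) X.
case; [lra| |].
  apply: continuous_subspaceT => x; apply: continuous_comp; first exact: cf.
  exact: (@norm_continuous _ R^o).
move=> c _ hc; exists `|f c| => // x; rewrite ler_norml => xX.
by apply: hc; rewrite in_itv.
Qed.

(** Picard iteration. The weight [expR (2 * K * `|x|)] turns the iteration into a
    contraction of ratio 1/2 on any segment, so the iterates converge
    geometrically there and the solution is global. *)
Lemma linear_ode n (A : 'I_n -> 'I_n -> R -> R) (c : 'I_n -> R) :
  (forall i j, continuous (A i j)) ->
  exists y : 'I_n -> R -> R, forall i, y i 0 = c i /\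
    forall x, is_derive x (1:R) (y i) (\sum_j A i j x * y j x).
Proof.
move=> cA.
pose P (f : R -> R) : R -> R := xget (fun=> 0)
  [set F : R -> R | F 0 = 0 /\ forall x, is_derive x (1:R) F (f x)].
have Pp f : continuous f -> P f 0 = 0 /\ forall x, is_derive x (1:R) (P f) (f x).
  move=> cf; have [F hF] := continuous_primitive cf.
  by have := @xgetI _ (fun=> 0) [set F : R -> R | F 0 = 0 /\ forall x, is_derive x (1:R) F (f x)] F hF.
have cAy y i : (forall j, continuous (y j)) -> continuous (fun x => \sum_j A i j x * y j x).
  move=> cy; apply: (continuous_sumr (F := fun j x => A i j x * y j x)) => j x.
  by apply: continuousM; [exact: cA|exact: cy].
pose next (y : 'I_n -> R -> R) i x := c i + P (fun x => \sum_j A i j x * y j x) x.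
pose Y m := iter m next (fun i _ => c i).
have nextD y i : (forall j, continuous (y j)) ->
    forall x, is_derive x (1:R) (next y i) (\sum_j A i j x * y j x).
  move=> cy x; have [_ d] := Pp _ (cAy y i cy).
  by apply: (rD_eq (rD_add (rD_cst (c i) x) (d x))); rewrite add0r.
have cY m j : continuous (Y m j).
  elim: m j => [|m IH] j x; first exact: cst_continuous.
  exact: (rD_continuous (nextD _ j IH x)).
have YD m i x : is_derive x (1:R) (Y m.+1 i) (\sum_j A i j x * Y m j x).
  exact: nextD.
have Y0 m i : Y m i 0 = c i.
  case: m => [//|m]; rewrite /Y /= /next.
  by have [-> _] := Pp _ (cAy _ i (cY m)); rewrite addr0.
have bdd X : 0 <= X -> exists2 K : R, 0 < K & forall i (z : 'I_n -> R) x D,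
    `|x| <= X -> 0 <= D -> (forall j, `|z j| <= D) -> `|\sum_j A i j x * z j| <= K * D.
  move=> X0.
  have cS : continuous (fun x => \sum_i \sum_j `|A i j x|).
    apply: (continuous_sumr (F := fun i x => \sum_j `|A i j x|)) => i.
    apply: (continuous_sumr (F := fun j x => `|A i j x|)) => j x.
    apply: continuous_comp; first exact: cA.
    exact: (@norm_continuous _ R^o).
  have [K0 K00 HK] := continuous_bounded_segment X0 cS.
  exists (K0 + 1); first lra.
  move=> i z x D xX D0 zD; apply: (le_trans (ler_norm_sum _ _ _)).
  apply: (@le_trans _ _ ((\sum_i \sum_j `|A i j x|) * D)).
    apply: (@le_trans _ _ ((\sum_j `|A i j x|) * D)).
      by rewrite mulr_suml; apply: ler_sum => j _; rewrite normrM ler_wpM2l.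
    by rewrite ler_wpM2r// [leRHS](bigD1 i)//= lerDl sumr_ge0// => k _; rewrite sumr_ge0.
  rewrite ler_wpM2r//; apply: le_trans (ler_norm _) _; apply: le_trans (HK x xX) _; lra.
have step (K D X : R) (h dh : R -> R) : 0 < K -> 0 <= D -> h 0 = 0 ->
    (forall x, is_derive x (1:R) h (dh x)) ->
    (forall x, `|x| <= X -> `|dh x| <= K * (D * expR (2 * K * `|x|))) ->
    forall x, `|x| <= X -> `|h x| <= D / 2 * expR (2 * K * `|x|).
  move=> K0 D0 h0 hd hb x xX.
  have E (s z : R) : is_derive z (1:R) (fun z => s * (D / 2) * expR (s * (2 * K * z)))
      (s ^+ 2 * (K * (D * expR (s * (2 * K * z))))).
    eapply rD_eq; first by rD.
    by rewrite /=; field.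
  have [x0|/ltW x0] := leP 0 x.
    rewrite ger0_norm// in xX *.
    have := @norm_le_of_derive R h dh _ _ 0 x x0 (fun z _ => hd z) (fun z _ => E 1 z).
    have H z : 0 <= z <= x -> `|dh z| <= 1 ^+ 2 * (K * (D * expR (1 * (2 * K * z)))).
      move=> /andP[z0 zx]; rewrite expr1n !mul1r; apply: le_trans (hb z _) _.
        by rewrite ger0_norm//; lra.
      by rewrite ger0_norm.
    move=> /(_ H); rewrite h0 subr0 !mul1r !mulr0 expR0.
    by move: D0; lra.
  rewrite (ler0_norm x0) in xX *.
  have := @norm_le_of_derive R h dh _ _ x 0 x0 (fun z _ => hd z) (fun z _ => E (-1) z).
  have H z : x <= z <= 0 -> `|dh z| <= (-1) ^+ 2 * (K * (D * expR (-1 * (2 * K * z)))).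
    move=> /andP[z0 zx]; rewrite sqrrN expr1n !mul1r; apply: le_trans (hb z _) _.
      by rewrite ler0_norm//; lra.
    by rewrite ler0_norm// mulrN mulN1r.
  move=> /(_ H); rewrite h0 sub0r normrN !mulr0 expR0 mulN1r.
  have -> : -1 * (2 * K * x) = 2 * K * - x by ring.
  by move: D0; lra.
have conv X : 0 <= X -> exists2 B : R, 0 <= B & forall i x m,
    `|x| <= X -> `|Y m i x - limn (fun m => Y m i x)| <= 2 * B / 2 ^+ m.
  move=> X0; have [K K0 HK] := bdd X X0.
  have [D D0 HD] : exists2 D : R, 0 <= D & forall i x, `|x| <= X -> `|Y 1%N i x - Y 0%N i x| <= D.
    have cS : continuous (fun x => \sum_i `|Y 1%N i x - Y 0%N i x|).
      apply: (continuous_sumr (F := fun i x => `|Y 1%N i x - Y 0%N i x|)) => i x.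
      apply: (@continuous_normr R (fun x => Y 1%N i x - Y 0%N i x)) => {}x.
      by apply: (@continuousB _ R^o); exact: cY.
    have [D D0 HD] := continuous_bounded_segment X0 cS.
    exists D => // i x /HD; apply: le_trans; apply: le_trans (ler_norm _).
    by rewrite (bigD1 i)//= lerDl sumr_ge0.
  have main m : forall i x, `|x| <= X ->
      `|Y m.+1 i x - Y m i x| <= D / 2 ^+ m * expR (2 * K * `|x|).
    elim: m => [|m IH] i x xX.
      rewrite expr0 divr1; apply: (le_trans (HD i x xX)); rewrite ler_peMr//.
      by rewrite -expR0 ler_expR !mulr_ge0// ltW.
    have -> : D / 2 ^+ m.+1 = D / 2 ^+ m / 2.
      by rewrite exprS; field; rewrite expf_neq0.
    apply: (@step K (D / 2 ^+ m) X (fun x => Y m.+2 i x - Y m.+1 i x)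
        (fun x => \sum_j A i j x * (Y m.+1 j x - Y m j x))) => //.
    - by rewrite divr_ge0// exprn_ge0.
    - by rewrite !Y0 subrr.
    - move=> z; apply: (rD_eq (rD_sub (YD m.+1 i z) (YD m i z))).
      by rewrite -sumrB; apply: eq_bigr => j _; rewrite mulrBr.
    - move=> z zX; apply: HK => //.
        by rewrite mulr_ge0 ?expR_ge0// divr_ge0// exprn_ge0.
      by move=> j; exact: IH.
  exists (D * expR (2 * K * X)); first by rewrite mulr_ge0// expR_ge0.
  move=> i x m xX; apply: (@geometric_limit (fun m => Y m i x)) => {}m.
  apply: le_trans (main m i x xX) _; rewrite mulrAC ler_wpM2r ?invr_ge0 ?exprn_ge0//.
  by rewrite ler_wpM2l// ler_expR ler_wpM2l// mulr_ge0// ltW.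
pose y i x := limn (fun m => Y m i x).
have small (B e : R) : 0 <= B -> 0 < e -> exists m, B / 2 ^+ m < e.
  move=> B0 e0; exists (Num.truncn (B / e)).+1.
  rewrite ltr_pdivrMr ?exprn_gt0//.
  have h : B / e < 2 ^+ (Num.truncn (B / e)).+1.
    have /andP[_ /lt_le_trans] := truncn_itv (divr_ge0 B0 (ltW e0)); apply.
    by rewrite -natrX ler_nat ltnW// ltn_expl.
  by rewrite mulrC -ltr_pdivrMr.
have cy i : continuous (y i).
  move=> x; apply/(@cvgrPdist_lt _ R^o) => e e0.
  have X0 : 0 <= `|x| + 1 by rewrite addr_ge0.
  have [B B0 HB] := conv _ X0.
  have e3 : 0 < e / 3 by rewrite divr_gt0.
  have [m hm] := small (2 * B) (e / 3) (mulr_ge0 (ler0n R 2) B0) e3.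
  have /(@cvgrPdist_lt _ R^o) /(_ _ e3) h1 := cY m i x.
  have h2 : \forall z \near x, `|x - z| < 1 by apply: (@nbhsx_ballx _ R^o).
  near=> z.
  have zx : `|x - z| < 1 by near: z.
  have zX : `|z| <= `|x| + 1.
    rewrite -[z](subrK x); apply: le_trans (ler_normD _ _) _.
    by rewrite distrC; move: zx; lra.
  have a1 := HB i z m zX.
  have a2 := HB i x m.
  have a3 : `|Y m i x - Y m i z| < e / 3 by near: z.
  have /a2 {}a2 : `|x| <= `|x| + 1 by rewrite lerDl.
  rewrite /y; move: a1 a2 a3 hm; set b := 2 * B / _.
  move: (limn _) (limn _) (Y m i x) (Y m i z) => l1 l2 y1 y2.
  rewrite !ler_norml ltr_norml => /andP[? ?] /andP[? ?] /andP[? ?] ?.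
  by rewrite ltr_norml; apply/andP; split; lra.
have yE : y = next y.
  apply/funext => i; apply/funext => x; apply/eqP; rewrite -subr_eq0.
  apply/negP => /negP; rewrite -normr_gt0 => e0.
  have [B B0 HB] := conv `|x| (normr_ge0 x).
  have [K K0 HK] := bdd `|x| (normr_ge0 x).
  have KB0 : 0 <= (K * `|x| + 1) * (2 * B).
    by rewrite !mulr_ge0// addr_ge0// mulr_ge0// ltW.
  have [m] := small ((K * `|x| + 1) * (2 * B)) _ KB0 e0.
  apply/negP; rewrite -leNgt.
  have b0 : 0 <= 2 * B / 2 ^+ m by rewrite divr_ge0 ?mulr_ge0// exprn_ge0.
  have h1 : `|Y m.+1 i x - y i x| <= 2 * B / 2 ^+ m.
    apply: le_trans (HB i x m.+1 (lexx _)) _.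
    rewrite ler_wpM2l ?mulr_ge0// lef_pV2 ?posrE ?exprn_gt0//.
    by rewrite ler_eXn2l// ltr1n.
  have hd z : is_derive z (1:R) (fun z => next y i z - Y m.+1 i z)
      (\sum_j A i j z * (y j z - Y m j z)).
    apply: (rD_eq (rD_sub (nextD y i cy z) (YD m i z))).
    by rewrite -sumrB; apply: eq_bigr => j _; rewrite mulrBr.
  have hb z : `|z| <= `|x| -> `|\sum_j A i j z * (y j z - Y m j z)| <= K * (2 * B / 2 ^+ m).
    by move=> zx; apply: HK => // j; rewrite distrC; exact: HB.
  have hl z : is_derive z (1:R) (fun z => K * (2 * B / 2 ^+ m) * z) (K * (2 * B / 2 ^+ m)).
    by eapply rD_eq; [rD|rewrite mul0r add0r mulr1].
  have n0 : next y i 0 - Y m.+1 i 0 = 0.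
    by rewrite Y0 /next; have [-> _] := Pp _ (cAy _ i cy); rewrite addr0 subrr.
  have h2 : `|next y i x - Y m.+1 i x| <= K * (2 * B / 2 ^+ m) * `|x|.
    have [x0|/ltW x0] := leP 0 x.
      have := @norm_le_of_derive R _ _ _ _ 0 x x0 (fun z _ => hd z) (fun z _ => hl z).
      rewrite n0 mulr0 !subr0 (ger0_norm x0); apply => z /andP[z0 zx].
      by apply: hb; rewrite !ger0_norm//; lra.
    have := @norm_le_of_derive R _ _ _ _ x 0 x0 (fun z _ => hd z) (fun z _ => hl z).
    rewrite n0 mulr0 !sub0r normrN (ler0_norm x0) mulrN; apply => z /andP[z0 zx].
    by apply: hb; rewrite !ler0_norm//; lra.
  rewrite -mulrA mulrDl mul1r -[y i x - _](addrNK (Y m.+1 i x)).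
  have -> : y i x - next y i x - Y m.+1 i x + Y m.+1 i x =
     (y i x - Y m.+1 i x) + (Y m.+1 i x - next y i x) by ring.
  apply: le_trans (ler_normD _ _) _; rewrite addrC distrC [X in _ + X]distrC.
  by apply: lerD => //; rewrite mulrAC.
exists y => i; split.
  by rewrite yE /next; have [-> _] := Pp _ (cAy _ i cy); rewrite addr0.
move=> x; rewrite [in X in is_derive _ _ X]yE; exact: nextD.
Unshelve. all: by end_near.
Qed.
End LinearODE.

(** * Complex-valued functions of a real variable *)

Section ComplexCalculus.
Context {R : realType}.
Local Notation C := R[i].
Local Notation Re := (@complex.Re R).
Local Notation Im := (@complex.Im R).
Implicit Types (z w : C) (f g : R -> C) (x : R).

Lemma ReD z w : Re (z + w) = Re z + Re w. Proof. by case: z w => [??] [??]. Qed.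
Lemma ImD z w : Im (z + w) = Im z + Im w. Proof. by case: z w => [??] [??]. Qed.
Lemma ReN z : Re (- z) = - Re z. Proof. by case: z. Qed.
Lemma ImN z : Im (- z) = - Im z. Proof. by case: z. Qed.
Lemma ReM z w : Re (z * w) = Re z * Re w - Im z * Im w.
Proof. by case: z w => [??] [??]. Qed.
Lemma ImM z w : Im (z * w) = Re z * Im w + Im z * Re w.
Proof. by case: z w => [??] [??]. Qed.
Lemma ReJ z : Re (conjc z) = Re z. Proof. by case: z. Qed.
Lemma ImJ z : Im (conjc z) = - Im z. Proof. by case: z. Qed.
Lemma ReC (a : R) : Re a%:C = a. Proof. by []. Qed.
Lemma ImC (a : R) : Im a%:C = 0. Proof. by []. Qed.
Lemma Rei : Re 'i = 0. Proof. by []. Qed.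
Lemma Imi : Im 'i = 1. Proof. by []. Qed.
Lemma Re0 : Re 0 = 0. Proof. by []. Qed.
Lemma Im0 : Im 0 = 0. Proof. by []. Qed.
Lemma Re1 : Re 1 = 1. Proof. by []. Qed.
Lemma Im1 : Im 1 = 0. Proof. by []. Qed.
Lemma Re_nat n : Re n%:R = n%:R. Proof. by elim: n => // n IH; rewrite !mulrS ReD IH. Qed.
Lemma Im_nat n : Im n%:R = 0. Proof. by elim: n => // n IH; rewrite mulrS ImD IH addr0. Qed.
(** Reduces an identity in [R[i]] to [ring] identities between real and imaginary parts. *)
Definition cE := (Rei, Imi, Re_nat, Im_nat, ReD, ImD, ReN, ImN, ReM, ImM, ReJ, ImJ, ReC, ImC, Re0, Im0, Re1, Im1).

Lemma eq_ReIm z w : Re z = Re w -> Im z = Im w -> z = w.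
Proof. by case: z w => [??] [??] /= -> ->. Qed.

(** The squared modulus as a real number: it is polynomial in the two parts. *)
Definition nsq z : R := Re z ^+ 2 + Im z ^+ 2.

Lemma nsq_ge0 z : 0 <= nsq z. Proof. by rewrite addr_ge0 ?sqr_ge0. Qed.
Lemma nsqM z w : nsq (z * w) = nsq z * nsq w.
Proof. by rewrite /nsq !cE; ring. Qed.
Lemma nsqJ z : nsq (conjc z) = nsq z. Proof. by rewrite /nsq !cE; ring. Qed.
Lemma nsqN z : nsq (- z) = nsq z. Proof. by rewrite /nsq !cE; ring. Qed.
Lemma nsq0 : nsq 0 = 0. Proof. by rewrite /nsq !cE; ring. Qed.
Lemma nsq1 : nsq 1 = 1. Proof. by rewrite /nsq !cE; ring. Qed.
Lemma nsqi : nsq 'i = 1. Proof. by rewrite /nsq !cE; ring. Qed.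
Lemma nsqC (a : R) : nsq a%:C = a ^+ 2. Proof. by rewrite /nsq !cE; ring. Qed.
Lemma nsqX z n : nsq (z ^+ n) = nsq z ^+ n.
Proof. by elim: n => [|n IH]; rewrite ?expr0 ?nsq1// !exprS nsqM IH. Qed.
Lemma nsq_eq0 z : nsq z = 0 -> z = 0.
Proof.
move=> /eqP; rewrite paddr_eq0 ?sqr_ge0// !sqrf_eq0 => /andP[/eqP a /eqP b].
by apply: eq_ReIm.
Qed.
Lemma nsq_gt0 z : z != 0 -> 0 < nsq z.
Proof.
move=> z0; rewrite lt_def nsq_ge0 andbT; apply: contra z0 => /eqP/nsq_eq0 ->//.
Qed.
Lemma nsqV z : nsq z^-1 = (nsq z)^-1.
Proof.
have [->|z0] := eqVneq z 0; first by rewrite invr0 nsq0 invr0.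
have /eqP := nsqM z z^-1; rewrite divff// nsq1.
have n0 := nsq_gt0 z0; rewrite eq_sym => /eqP h.
by apply: (mulfI (lt0r_neq0 n0)); rewrite h divff// lt0r_neq0.
Qed.

Lemma normc_nsq z : Normc.normc z ^+ 2 = nsq z.
Proof. by case: z => a b; rewrite sqr_sqrtr// addr_ge0 ?sqr_ge0. Qed.
Lemma normcE' z : Normc.normc z = Num.sqrt (nsq z).
Proof. by case: z. Qed.
Lemma normC_nsq z : `|z| ^+ 2 = (nsq z)%:C.
Proof. by rewrite -add_Re2_Im2. Qed.
Lemma conjM z : conjc z * z = (nsq z)%:C.
Proof. by apply: eq_ReIm; rewrite /nsq !cE; ring. Qed.

(** Expand the square of the modulus of [s z - w^*]. *)
Lemma young (s : R) z w : 0 < s -> 2 * Re (z * w) <= s * nsq z + nsq w / s.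
Proof.
move=> s0; rewrite -subr_ge0.
have -> : s * nsq z + nsq w / s - 2 * Re (z * w) =
  ((s * Re z - Re w) ^+ 2 + (s * Im z + Im w) ^+ 2) / s.
  by rewrite /nsq !cE; field; exact: lt0r_neq0.
by rewrite divr_ge0 ?addr_ge0 ?sqr_ge0// ltW.
Qed.

Lemma young_norm (s : R) z w : 0 < s -> 2 * `|Re (z * w)| <= s * nsq z + nsq w / s.
Proof.
move=> s0; have [h|h] := leP 0 (Re (z * w)); first by rewrite ger0_norm//; exact: young.
by rewrite ltr0_norm// -ReN -mulNr; apply: le_trans (young _ _ s0) _; rewrite nsqN.
Qed.

(** Young's inequality for the cross term. *)
Lemma nsqD (s : R) z w : 0 < s -> nsq (z + w) <= (1 + s) * nsq z + (1 + s^-1) * nsq w.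
Proof.
move=> s0; have := @young s z (conjc w) s0; rewrite nsqJ.
suff -> : nsq (z + w) = nsq z + nsq w + 2 * Re (z * conjc w) by lra.
by rewrite /nsq !cE; ring.
Qed.

Definition cD f x (l : C) : Prop :=
  is_derive x (1:R) (fun y => Re (f y)) (Re l) /\
  is_derive x (1:R) (fun y => Im (f y)) (Im l).

Definition ccont f : Prop :=
  continuous (fun x => Re (f x)) /\ continuous (fun x => Im (f x)).

Lemma cD_eq f x l l' : cD f x l -> l = l' -> cD f x l'.
Proof. by move=> h <-. Qed.
Lemma cD_ccont f (df : R -> C) : (forall x, cD f x (df x)) -> ccont f.
Proof. by move=> h; split=> x; have [a b] := h x; [exact: rD_continuous a|exact: rD_continuous b]. Qed.
Lemma cD_cst (c : C) x : cD (fun=> c) x 0.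
Proof. by split; exact: rD_cst. Qed.
Lemma cD_real (f : R -> R) x a : is_derive x (1:R) f a -> cD (fun y => (f y)%:C) x a%:C.
Proof. by split; [|exact: rD_cst]. Qed.
Lemma cD_add f g x a b : cD f x a -> cD g x b -> cD (fun y => f y + g y) x (a + b).
Proof.
move=> [f1 f2] [g1 g2]; split.
  under eq_fun do rewrite ReD.
  by rewrite ReD; apply: rD_add.
under eq_fun do rewrite ImD.
by rewrite ImD; apply: rD_add.
Qed.
Lemma cD_opp f x a : cD f x a -> cD (fun y => - f y) x (- a).
Proof.
move=> [f1 f2]; split.
  under eq_fun do rewrite ReN.
  by rewrite ReN; apply: rD_opp.
under eq_fun do rewrite ImN.
by rewrite ImN; apply: rD_opp.
Qed.
Lemma cD_mul f g x a b : cD f x a -> cD g x b -> cD (fun y => f y * g y) x (a * g x + f x * b).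
Proof.
move=> [f1 f2] [g1 g2]; split.
  under eq_fun do rewrite ReM.
  by eapply rD_eq; [rD|rewrite !cE; ring].
under eq_fun do rewrite ImM.
by eapply rD_eq; [rD|rewrite !cE; ring].
Qed.
Lemma cD_conj f x a : cD f x a -> cD (fun y => conjc (f y)) x (conjc a).
Proof.
move=> [f1 f2]; split.
  under eq_fun do rewrite ReJ.
  by rewrite ReJ.
under eq_fun do rewrite ImJ.
by rewrite ImJ; apply: rD_opp.
Qed.
Lemma cD_sqr f x a : cD f x a -> cD (fun y => f y ^+ 2) x (2 * f x * a).
Proof.
move=> fa; rewrite (_ : (fun y => _) = (fun y => f y * f y)); last first.
  by apply/funext => y; rewrite expr2.
by apply: (cD_eq (cD_mul fa fa)); ring.
Qed.
Lemma cD_nsq f x a : cD f x a -> is_derive x (1:R) (fun y => nsq (f y)) (2 * Re (conjc (f x) * a)).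
Proof.
move=> [f1 f2]; rewrite /nsq.
by eapply rD_eq; [rD|rewrite !cE; ring].
Qed.
Lemma ReV z : Re z^-1 = Re z / nsq z.
Proof. by case: z. Qed.
Lemma ImV z : Im z^-1 = - Im z / nsq z.
Proof. by case: z => a b; rewrite /= mulNr. Qed.
Lemma Re_div z w : Re (z / w) = Re (conjc w * z) / nsq w.
Proof. by rewrite ReM ReV ImV ReM ReJ ImJ; ring. Qed.
Lemma cD_inv f x a : f x != 0 -> cD f x a -> cD (fun y => (f y)^-1) x (- a / f x ^+ 2).
Proof.
move=> fx0 fa; have n0 := lt0r_neq0 (nsq_gt0 fx0).
have dn := @rD_inv R (fun y => nsq (f y)) x _ n0 (cD_nsq fa).
have h : cD (fun y => conjc (f y) * ((nsq (f y))^-1)%:C) x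
   (conjc a * ((nsq (f x))^-1)%:C + conjc (f x) * (- (2 * Re (conjc (f x) * a)) / nsq (f x) ^+ 2)%:C).
  by apply: cD_mul; [exact: cD_conj|exact: cD_real].
rewrite (_ : (fun y => _) = (fun y => conjc (f y) * ((nsq (f y))^-1)%:C)); last first.
  by apply/funext => y; apply: eq_ReIm; rewrite ?ReV ?ImV !cE; ring.
apply: (cD_eq h).
have ninv : (nsq (f x))^-1%:C = (f x)^-1 * (conjc (f x))^-1.
  by rewrite -invfM [f x * _]mulrC conjM fmorphV.
have cf0 : conjc (f x) != 0 by rewrite conjc_eq0.
have reE : (2 * Re (conjc (f x) * a))%:C = conjc (f x) * a + f x * conjc a.
  by apply: eq_ReIm; rewrite !cE; ring.
have -> : (- (2 * Re (conjc (f x) * a)) / nsq (f x) ^+ 2)%:C =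
   - (conjc (f x) * a + f x * conjc a) * (nsq (f x))^-1%:C ^+ 2.
  by rewrite -reE -exprVn; apply: eq_ReIm; rewrite expr2 !cE; ring.
by rewrite ninv; field; rewrite fx0 cf0.
Qed.
End ComplexCalculus.

Ltac cD := lazymatch goal with
 | |- cD (fun _ => ?c) _ _ => eapply (@cD_cst _ c)
 | |- cD (fun y => @?f y + @?g y) _ _ => eapply (@cD_add _ f g); [cD|cD]
 | |- cD (fun y => - @?f y) _ _ => eapply (@cD_opp _ f); cD
 | |- cD (fun y => @?f y * @?g y) _ _ => eapply (@cD_mul _ f g); [cD|cD]
 | |- cD (fun y => @?f y ^+ 2) _ _ => eapply (@cD_sqr _ f); cD
 | |- cD (fun y => conjc (@?f y)) _ _ => eapply (@cD_conj _ f); cD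
 | _ => try eassumption
 end.

(** * The Zakharov-Shabat system at an imaginary spectral parameter *)

Section Riccati.
Context {R : realType}.
Local Notation C := R[i].
Local Notation Re := (@complex.Re R).
Local Notation Im := (@complex.Im R).

(** The spatial half of the Lax pair of the defocusing equation, in the gauge that makes
    the exponents real. The two lower case functions are a column of a solution matrix. *)
Definition zs_column (k : R) (q f g : R -> C) : Prop := forall x,
  cD f x (k%:C * f x + conjc (q x) * g x) /\ cD g x (q x * f x - k%:C * g x).

(** A real linear system of size four. *)
Lemma zs_column_exists (k : R) (q : R -> C) (f0 g0 : C) : ccont q ->
  exists f g, [/\ f 0 = f0, g 0 = g0 & zs_column k q f g].
Proof.
move=> [cu cv]; set u := fun x => Re (q x) in cu; set v := fun x => Im (q x) in cv.
pose A (i j : 'I_4) (x : R) : R := nth 0 (nth [::]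
  [:: [:: k; 0; u x; v x]; [:: 0; k; - v x; u x];
      [:: u x; - v x; - k; 0]; [:: v x; u x; 0; - k]] i) j.
pose c (i : 'I_4) := nth 0 [:: Re f0; Im f0; Re g0; Im g0] i.
have cA i j : continuous (A i j).
  have cvN : continuous (fun x => - v x) by move=> x; apply: (@continuousN _ R^o); exact: cv.
  case: i => [[|[|[|[|i]]]] hi] //; case: j => [[|[|[|[|j]]]] hj] //; rewrite /A /=;
    first [by apply: cu|by apply: cv|by apply: cvN|by apply: cst_continuous].
have [y hy] := linear_ode c cA.
pose o (n : nat) (h : (n < 4)%N) := Ordinal h.
pose i0 := @o 0%N isT; pose i1 := @o 1%N isT; pose i2 := @o 2%N isT; pose i3 := @o 3%N isT.
exists (fun x => y i0 x +i* y i1 x), (fun x => y i2 x +i* y i3 x).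
have [y0 d0] := hy i0; have [y1 d1] := hy i1; have [y2 d2] := hy i2; have [y3 d3] := hy i3.
have S (F : 'I_4 -> R) : \sum_j F j = F i0 + F i1 + F i2 + F i3.
  rewrite !big_ord_recl big_ord0 addr0 !addrA.
  by congr (_ + _ + _ + _); congr F; apply: val_inj.
split; [by rewrite y0 y1 /c /=; case: (f0)|by rewrite y2 y3 /c /=; case: (g0)|].
move=> x; split; split; rewrite !cE /=.
- by apply: (rD_eq (d0 x)); rewrite S /A /= -/(u x) -/(v x); ring.
- by apply: (rD_eq (d1 x)); rewrite S /A /= -/(u x) -/(v x); ring.
- by apply: (rD_eq (d2 x)); rewrite S /A /= -/(u x) -/(v x); ring.
- by apply: (rD_eq (d3 x)); rewrite S /A /= -/(u x) -/(v x); ring.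
Qed.

(** The form [|f|^2 - |g|^2] has derivative [2 k (|f|^2 + |g|^2)]. Here the defocusing sign
    enters: [f] cannot vanish, and [g / f] stays in the unit disc. *)
Lemma zs_column_cone (k : R) (q f g : R -> C) (y x : R) : 0 <= k ->
  zs_column k q f g -> f y = 1 -> g y = 0 -> y <= x -> 1 <= nsq (f x) - nsq (g x).
Proof.
move=> k0 hfg fy gy yx.
have d z : is_derive z (1:R) (fun z => nsq (f z) - nsq (g z))
    (2 * k * (nsq (f z) + nsq (g z))).
  have [df dg] := hfg z.
  by apply: (rD_eq (rD_sub (cD_nsq df) (cD_nsq dg))); rewrite /nsq !cE; ring.
have := ler_of_derive yx (fun z _ => d z).
rewrite fy gy nsq1 nsq0 subr0; apply => z _.
by rewrite !mulr_ge0// addr_ge0 ?nsq_ge0.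
Qed.

(** Freezes [h] to the left of [y], so that it has a primitive on the whole line. *)
Lemma continuous_halfline_ext (h : R -> R) (y : R) :
  (forall x, y <= x -> {for x, continuous h}) ->
  continuous (fun x => h (Num.max x y)).
Proof.
move=> ch x; apply: (@continuous_comp _ _ _ (fun x => Num.max x y) h).
  by apply: continuous_max; [exact: cvg_id|exact: cvg_cst].
by apply: ch; rewrite le_max lexx orbT.
Qed.

(** Take [s = S / (2 m)]. *)
Lemma sqr_le_of_young (S m r : R) : 0 < m -> 0 <= S ->
  (forall s, 0 < s -> S <= s * m + r / s) -> S ^+ 2 <= 4 * m * r.
Proof.
move=> m0; rewrite le_eqVlt => /orP[/eqP <- h|S0 /(_ (S / (2 * m)))].
  suff r0 : 0 <= r by rewrite expr0n /= !mulr_ge0// ltW.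
  rewrite leNgt; apply/negP => r0.
  have s0 : 0 < - r / (2 * m) by rewrite divr_gt0// ?mulr_gt0// oppr_gt0.
  have sq0 : 0 < Num.sqrt (- r / (2 * m)) by rewrite sqrtr_gt0.
  have := h _ sq0; rewrite -(ler_pM2r sq0) mul0r mulrDl divfK ?lt0r_neq0//.
  rewrite mulrAC -expr2 sqr_sqrtr; last exact: ltW.
  have -> : - r / (2 * m) * m + r = r / 2 by field; exact: lt0r_neq0.
  lra.
have s0 : 0 < S / (2 * m) by rewrite divr_gt0// mulr_gt0.
move=> /(_ s0); have -> : S / (2 * m) * m + r / (S / (2 * m)) = S / 2 + 2 * m * r / S.
  by field; rewrite !lt0r_neq0.
rewrite -(ler_pM2r S0) mulrDl divfK ?lt0r_neq0// expr2; lra.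
Qed.

Section Estimate.
Variables (kap m : R) (q w f g : R -> C) (P W : R -> R) (y l : R).
Hypotheses (m0 : 0 < m) (mkap : 8 * m <= kap) (yl : y <= l).
Hypotheses (dP : forall x, is_derive x (1:R) P (nsq (q x)))
  (dW : forall x, is_derive x (1:R) W (nsq (w x)))
  (Pm : P l - P y <= m).
Hypotheses (dw : forall x, cD w x (q x - kap%:C * w x)).
Hypotheses (hfg : zs_column (kap / 2) q f g) (fy : f y = 1) (gy : g y = 0).

Let k0 : 0 < kap. Proof. by apply: lt_le_trans mkap; rewrite mulr_gt0. Qed.

Let X x := nsq (f x) - nsq (g x).
Let r x := g x / f x.
Let n x := nsq (r x).
Let th := 2 * m / kap.

Let X1 x : y <= x -> 1 <= X x.
Proof. by apply: (zs_column_cone _ hfg) => //; rewrite divr_ge0// ltW. Qed.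

Let nf1 x : y <= x -> 1 <= nsq (f x).
Proof. by move=> /X1; have := nsq_ge0 (g x); rewrite /X; lra. Qed.

Let f0 x : y <= x -> f x != 0.
Proof. by move=> /nf1; apply: contraTneq => ->; rewrite nsq0 -ltNge. Qed.

Let nE x : n x = nsq (g x) / nsq (f x).
Proof. by rewrite /n /r nsqM nsqV. Qed.

Let n1 x : y <= x -> 0 <= n x < 1.
Proof.
move=> yx; rewrite nsq_ge0 /= nE ltr_pdivrMr; first by have := X1 yx; rewrite /X; lra.
by apply: lt_le_trans (nf1 yx).
Qed.

Let dr x : y <= x -> cD r x (q x - kap%:C * r x - conjc (q x) * r x ^+ 2).
Proof.
move=> yx; have [df dg] := hfg x; have fx := f0 yx.
have dfi := cD_inv fx df.
apply: (cD_eq (cD_mul dg dfi)); rewrite /r.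
have -> : kap%:C = 2 * (kap / 2)%:C by apply: eq_ReIm; rewrite !cE; field.
by field.
Qed.

Let dn x : y <= x -> is_derive x (1:R) n
  (2 * Re (conjc (r x) * q x) * (1 - n x) - 2 * kap * n x).
Proof.
move=> yx; apply: (rD_eq (cD_nsq (dr yx))).
rewrite /n /nsq expr2; move: (r x) (q x) => [? ?] [? ?].
by rewrite !cE /=; ring.
Qed.

Let n_le_young s x : 0 < s -> y <= x ->
  2 * Re (conjc (r x) * q x) * (1 - n x) <= s * n x + nsq (q x) / s.
Proof.
move=> s0 yx; have /andP[n0 nl1] := n1 yx.
have := young (conjc (r x)) (q x) s0; rewrite nsqJ -/(n x) => h.
have b0 : 0 <= s * n x + nsq (q x) / s.
  by rewrite addr_ge0 ?mulr_ge0 ?invr_ge0 ?nsq_ge0// ltW.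
apply: (@le_trans _ _ ((s * n x + nsq (q x) / s) * (1 - n x))).
  by rewrite ler_wpM2r// subr_ge0 ltW.
by rewrite ler_piMr// lerBlDr lerDl.
Qed.

Let Pmono a b : y <= a -> a <= b -> b <= l -> 0 <= P b - P a <= m.
Proof.
move=> ya ab bl.
have M c d : c <= d -> P c <= P d.
  by move=> cd; apply: (ler_of_derive cd (fun z _ => dP z)) => z _; exact: nsq_ge0.
have := M _ _ ya; have := M _ _ ab; have := M _ _ bl; move: Pm => ? ? ? ?.
by apply/andP; split; lra.
Qed.

Let ny : n y = 0. Proof. by rewrite nE gy nsq0 mul0r. Qed.

(** Young's inequality in the Riccati equation gives [n' <= |q|^2 / (2 kap)]. *)
Lemma riccati_sup x : y <= x <= l -> n x <= m / (2 * kap).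
Proof.
move=> /andP[yx xl]; have k20 : 0 < 2 * kap by rewrite mulr_gt0.
have d z : y <= z <= x -> is_derive z (1:R) (fun z => n z - P z / (2 * kap))
   (2 * Re (conjc (r z) * q z) * (1 - n z) - 2 * kap * n z - nsq (q z) / (2 * kap)).
  move=> /andP[yz zx]; have dPz := dP z; have dnz := dn yz.
  by eapply rD_eq; [rD|ring].
have := ger_of_derive yx d; rewrite ny sub0r => h.
have {h} : n x - P x / (2 * kap) <= - (P y / (2 * kap)).
  by apply: h => z /andP[yz _]; have := n_le_young k20 yz; lra.
have /andP[_ Px] := Pmono (lexx y) yx xl.
have : (P x - P y) / (2 * kap) <= m / (2 * kap) by rewrite ler_pM2r ?invr_gt0.
lra.
Qed.

Let cn x : y <= x -> {for x, continuous n}.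
Proof. by move=> yx; apply: rD_continuous (dn yx). Qed.

Let d x := r x - w x.

Let dd x : y <= x -> cD d x (- (kap%:C * d x) - conjc (q x) * r x ^+ 2).
Proof.
move=> yx; have h1 := dr yx; have h2 := dw x.
by rewrite /d; eapply cD_eq; [cD|ring].
Qed.

Let ndD x : y <= x -> is_derive x (1:R) (fun x => nsq (d x))
  (2 * Re (conjc (d x) * (- (kap%:C * d x) - conjc (q x) * r x ^+ 2))).
Proof. by move=> yx; apply: cD_nsq; exact: dd. Qed.

Let exN : exists N : R -> R, forall x, y <= x -> is_derive x (1:R) N (n x).
Proof.
have [N [_ dN]] := continuous_primitive (continuous_halfline_ext cn).
by exists N => x yx; apply: (rD_eq (dN x)); rewrite max_l.
Qed.

Let exD : exists D : R -> R, forall x, y <= x -> is_derive x (1:R) D (nsq (d x)).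
Proof.
have cd x : y <= x -> {for x, continuous (fun x => nsq (d x))}.
  by move=> yx; apply: rD_continuous (ndD yx).
have [N [_ dN]] := continuous_primitive (continuous_halfline_ext cd).
by exists N => x yx; apply: (rD_eq (dN x)); rewrite max_l.
Qed.

(** The growth [kap / 2 * (l - y)] is that of the free system. As the window grows to the
    line, this becomes the logarithm of the modulus of the inverse transmission coefficient. *)
Definition zs_log : R := ln (nsq (f l)) / 2 - kap / 2 * (l - y).

(** Two comparisons are combined. The difference [d = r - w] solves the linearized
    equation with the source [q^* r^2]; since [n^2 <= 4 m int n], its mass is at most
    [th^2 int n] up to a boundary term, so [int n] and the mass of [w] agree up to [1 + O (th)].
    On the other hand [X = |f|^2 - |g|^2] has logarithmic derivative
    [kap (1 + 2 n / (1 - n))], so half of [ln X] is the free growth plus [kap int n] up to a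
    factor [1 - th / 4], and [ln |f|^2] differs from [ln X] by the boundary term [ln (1 - n)].
    The terms in [w y] and [g l / f l] vanish for a wide window. *)
Theorem zs_log_estimate :
  kap * (W l - W y) <= (1 + 3 * th) * zs_log + (1 + th^-1) * nsq (w y) /\
  (1 - 2 * th) * zs_log <= (1 + th) * (kap * (W l - W y)) + (1 + th^-1) * nsq (w y)
      + nsq (g l / f l).
Proof.
have [N dN] := exN; have [D dD] := exD.
pose r2 := N l - N y; pose d2 := D l - D y; pose w2 := W l - W y; pose e := nsq (w y).
have th0 : 0 < th by rewrite divr_gt0 ?mulr_gt0.
have th1 : th <= 1 / 4.
  have h := mkap; rewrite /th ler_pdivrMr//. lra.
have Nmono a b : y <= a -> a <= b -> N a <= N b.
  move=> ya ab; apply: (ler_of_derive ab (dF := n)) => z /andP[az _].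
    by apply: dN; lra.
  exact: nsq_ge0.
have r20 : 0 <= r2 by rewrite subr_ge0 Nmono.
(* Integrate [2 |q| |r| <= s |q|^2 + |r|^2 / s] and optimize over [s]. *)
have n2 x : y <= x <= l -> n x ^+ 2 <= 4 * m * r2.
  move=> /andP[yx xl]; apply: sqr_le_of_young => //; first exact: nsq_ge0.
  move=> s s0; have si0 : 0 < s^-1 by rewrite invr_gt0.
  have dz z : y <= z <= x -> is_derive z (1:R) (fun z => n z - (P z * s + N z / s))
     (2 * Re (conjc (r z) * q z) * (1 - n z) - 2 * kap * n z - (nsq (q z) * s + n z / s)).
    move=> /andP[yz zx]; have dPz := dP z; have dnz := dn yz; have dNz := dN z yz.
    by eapply rD_eq; [rD|ring].
  have := ger_of_derive yx dz; rewrite ny sub0r => h.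
  have {h} : n x - (P x * s + N x / s) <= - (P y * s + N y / s).
    apply: h => z /andP[yz _]; have := n_le_young si0 yz; rewrite invrK.
    have /andP[n0 _] := n1 yz; have : 0 <= 2 * kap * n z by rewrite !mulr_ge0// ltW.
    lra.
  have /andP[_ Px] := Pmono (lexx y) yx xl.
  have : s * (P x - P y) <= s * m by rewrite ler_pM2l.
  have : (N x - N y) / s <= r2 / s by rewrite ler_pM2r// /r2; have := Nmono _ _ yx xl; lra.
  lra.
(* The energy of [d]: the source is bounded pointwise by [|q| n]. *)
have d2le : d2 <= e / kap + th ^+ 2 * r2.
  have dz z : y <= z <= l -> is_derive z (1:R)
     (fun z => nsq (d z) + kap * D z - 4 * m * r2 / kap * P z)
     (2 * Re (conjc (d z) * (- (kap%:C * d z) - conjc (q z) * r z ^+ 2))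
        + kap * nsq (d z) - 4 * m * r2 / kap * nsq (q z)).
    move=> /andP[yz zl]; have h1 := ndD yz; have h2 := dD z yz; have h3 := dP z.
    by eapply rD_eq; [rD|ring].
  have := ger_of_derive yl dz => h.
  have {h} : nsq (d l) + kap * D l - 4 * m * r2 / kap * P l <=
      nsq (d y) + kap * D y - 4 * m * r2 / kap * P y.
    apply: h => z zyl; have := young (- conjc (d z)) (conjc (q z) * r z ^+ 2) k0.
    rewrite nsqN nsqM !nsqJ nsqX -/(n z).
    have : nsq (q z) * n z ^+ 2 / kap <= nsq (q z) * (4 * m * r2) / kap.
      by rewrite ler_pM2r ?invr_gt0// ler_wpM2l ?nsq_ge0// n2.
    have -> : Re (conjc (d z) * (- (kap%:C * d z) - conjc (q z) * r z ^+ 2)) =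
      - kap * nsq (d z) + Re (- conjc (d z) * (conjc (q z) * r z ^+ 2)).
      rewrite /nsq expr2; move: (d z) (q z) (r z) => [? ?] [? ?] [? ?].
      by rewrite !cE /=; ring.
    lra.
  have -> : nsq (d y) = e by rewrite /d /r gy mul0r sub0r nsqN.
  have := nsq_ge0 (d l) => hd h.
  have : kap * d2 <= e + 4 * m * r2 / kap * (P l - P y) by rewrite /d2; lra.
  have : 4 * m * r2 / kap * (P l - P y) <= 4 * m * r2 / kap * m.
    by apply: ler_wpM2l => //; rewrite divr_ge0 ?mulr_ge0// ltW.
  move=> h1 h2; rewrite -(ler_pM2l k0).
  have -> : kap * (e / kap + th ^+ 2 * r2) = e + 4 * m * r2 / kap * m.
    by rewrite /th; field; exact: lt0r_neq0.
  lra.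
have w2le : w2 <= (1 + th) * r2 + (1 + th^-1) * d2.
  have dz z : y <= z <= l -> is_derive z (1:R)
     (fun z => W z - ((1 + th) * N z + (1 + th^-1) * D z))
     (nsq (w z) - ((1 + th) * n z + (1 + th^-1) * nsq (d z))).
    move=> /andP[yz zl]; have h1 := dW z; have h2 := dD z yz; have h3 := dN z yz.
    by eapply rD_eq; [rD|ring].
  have := ger_of_derive yl dz; rewrite /w2 /r2 /d2 => h.
  have {h} := h _; suff : forall z, y <= z <= l -> nsq (w z) - ((1 + th) * n z + (1 + th^-1) * nsq (d z)) <= 0.
    by move=> hh /(_ hh); lra.
  move=> z _; have := nsqD (r z) (- d z) th0; rewrite nsqN -/(n z).
  have -> : r z + - d z = w z by rewrite /d; ring.
  lra.
have r2le : r2 <= (1 + th) * w2 + (1 + th^-1) * d2.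
  have dz z : y <= z <= l -> is_derive z (1:R)
     (fun z => N z - ((1 + th) * W z + (1 + th^-1) * D z))
     (n z - ((1 + th) * nsq (w z) + (1 + th^-1) * nsq (d z))).
    move=> /andP[yz zl]; have h1 := dW z; have h2 := dD z yz; have h3 := dN z yz.
    by eapply rD_eq; [rD|ring].
  have := ger_of_derive yl dz; rewrite /w2 /r2 /d2 => h.
  have {h} := h _; suff : forall z, y <= z <= l -> n z - ((1 + th) * nsq (w z) + (1 + th^-1) * nsq (d z)) <= 0.
    by move=> hh /(_ hh); lra.
  move=> z _; have := nsqD (w z) (d z) th0.
  have -> : w z + d z = r z by rewrite /d; ring.
  by rewrite -/(n z); lra.
have XE x : y <= x -> X x = nsq (f x) * (1 - n x).
  move=> yx; rewrite nE mulrBr mulr1 mulrC divfK//; apply: lt0r_neq0.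
  by apply: lt_le_trans (nf1 yx).
have dX z : y <= z -> is_derive z (1:R) X (kap * (nsq (f z) + nsq (g z))).
  move=> yz; have [df dg] := hfg z.
  by apply: (rD_eq (rD_sub (cD_nsq df) (cD_nsq dg))); rewrite /nsq !cE; field.
have ratio z : y <= z -> kap * (nsq (f z) + nsq (g z)) / X z = kap * (1 + 2 * (n z / (1 - n z))).
  move=> yz; have /andP[_ n1z] := n1 yz; rewrite XE// nE.
  have fz : nsq (f z) != 0 by apply: lt0r_neq0; apply: lt_le_trans (nf1 yz).
  field; rewrite fz /=; move: (X1 yz); rewrite /X => h.
  by apply: lt0r_neq0; apply: lt_le_trans h.
have dlX z : y <= z -> is_derive z (1:R) (fun z => ln (X z)) (kap * (1 + 2 * (n z / (1 - n z)))).
  move=> yz; rewrite -ratio//; apply: rD_ln; last exact: dX.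
  by apply: lt_le_trans (X1 yz).
have Xy : X y = 1 by rewrite /X fy gy nsq1 nsq0 subr0.
(* The integrand [n / (1 - n)] exceeds [n]. *)
have low : kap * r2 <= ln (X l) / 2 - kap / 2 * (l - y).
  have dz z : y <= z <= l -> is_derive z (1:R)
     (fun z => ln (X z) / 2 - kap / 2 * z - kap * N z)
     (kap * (1 + 2 * (n z / (1 - n z))) / 2 - kap / 2 - kap * n z).
    move=> /andP[yz zl]; have h1 := dlX z yz; have h3 := dN z yz.
    by eapply rD_eq; [rD|ring].
  have := ler_of_derive yl dz; rewrite Xy ln1 /r2 => h.
  suff : forall z, y <= z <= l -> 0 <= kap * (1 + 2 * (n z / (1 - n z))) / 2 - kap / 2 - kap * n z.
    by move=> /h; lra.
  move=> z /andP[yz _]; have /andP[n0 n1z] := n1 yz.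
  have -> : kap * (1 + 2 * (n z / (1 - n z))) / 2 - kap / 2 - kap * n z =
     kap * (n z ^+ 2 / (1 - n z)) by field; apply: lt0r_neq0; lra.
  by rewrite mulr_ge0 ?divr_ge0 ?sqr_ge0//; [exact: ltW|lra].
have nth x : y <= x <= l -> n x <= th / 4.
  move=> /riccati_sup h; apply: le_trans h _.
  suff -> : m / (2 * kap) = th / 4 by [].
  by rewrite /th; field; exact: lt0r_neq0.
(* The integrand [n / (1 - n)] is at most [n / (1 - th / 4)], by [riccati_sup]. *)
have upp : (1 - th / 4) * (ln (X l) / 2 - kap / 2 * (l - y)) <= kap * r2.
  have dz z : y <= z <= l -> is_derive z (1:R)
     (fun z => (1 - th / 4) * (ln (X z) / 2 - kap / 2 * z) - kap * N z)
     ((1 - th / 4) * (kap * (1 + 2 * (n z / (1 - n z))) / 2 - kap / 2) - kap * n z).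
    move=> /andP[yz zl]; have h1 := dlX z yz; have h3 := dN z yz.
    by eapply rD_eq; [rD|ring].
  have := ger_of_derive yl dz; rewrite Xy ln1 /r2 => h.
  suff : forall z, y <= z <= l -> (1 - th / 4) * (kap * (1 + 2 * (n z / (1 - n z))) / 2 - kap / 2) - kap * n z <= 0.
    by move=> /h; lra.
  move=> z yzl; have nz := nth z yzl; have /andP[yz _] := yzl; have /andP[n0 n1z] := n1 yz.
  have -> : (1 - th / 4) * (kap * (1 + 2 * (n z / (1 - n z))) / 2 - kap / 2) - kap * n z =
     - (kap * (n z / (1 - n z) * (th / 4 - n z))) by field; apply: lt0r_neq0; lra.
  by rewrite oppr_le0 !mulr_ge0 ?invr_ge0//; [exact: ltW|lra|lra].
have ll : y <= l <= l by rewrite yl lexx.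
have /andP[nl0 nl1] := n1 yl; have nlth := nth l ll.
have lnE : ln (nsq (f l)) = ln (X l) - ln (1 - n l).
  rewrite XE// lnM ?posrE; last lra.
    by rewrite addrK.
  by apply: lt_le_trans (nf1 yl).
have ln_low : ln (1 - n l) <= 0 by rewrite ln_le0//; lra.
have ln_upp : - ln (1 - n l) <= 2 * n l.
  rewrite -lnV ?posrE; last lra.
  have -> : (1 - n l)^-1 = 1 + n l / (1 - n l) by field; apply: lt0r_neq0; lra.
  apply: le_trans (le_ln1Dx _) _.
    by apply: lt_le_trans (divr_ge0 nl0 _); [rewrite ltrN10|lra].
  rewrite ler_pdivrMr; last lra.
  have : 0 <= n l * (1 - 2 * n l) by apply: mulr_ge0 => //; lra.
  lra.
have e0 : 0 <= e by exact: nsq_ge0.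
have lam0 : kap * r2 <= zs_log by rewrite /zs_log lnE; lra.
have kr0 : 0 <= kap * r2 by rewrite mulr_ge0// ltW.
have tV : 0 < th^-1 by rewrite invr_gt0.
have kd2 : kap * d2 <= e + th ^+ 2 * (kap * r2).
  have := d2le; rewrite -(ler_pM2l k0).
  suff -> : kap * (e / kap + th ^+ 2 * r2) = e + th ^+ 2 * (kap * r2) by [].
  by field; exact: lt0r_neq0.
have kd2' : (1 + th^-1) * (kap * d2) <= (1 + th^-1) * e + (th + th ^+ 2) * (kap * r2).
  have -> : (1 + th^-1) * e + (th + th ^+ 2) * (kap * r2) = (1 + th^-1) * (e + th ^+ 2 * (kap * r2)).
    by field; exact: lt0r_neq0.
  by rewrite ler_pM2l//; lra.
have tt : th ^+ 2 <= th / 4 by rewrite expr2 ler_pM2l//; lra.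
have ttk : th ^+ 2 * (kap * r2) <= th / 4 * (kap * r2) by rewrite ler_wpM2r.
split.
  have : kap * w2 <= (1 + th) * (kap * r2) + (1 + th^-1) * (kap * d2).
    by have := w2le; rewrite -(ler_pM2l k0); lra.
  have : (1 + 3 * th) * (kap * r2) <= (1 + 3 * th) * zs_log by rewrite ler_pM2l//; lra.
  have : 0 <= th * (kap * r2) by rewrite mulr_ge0// ltW.
  by rewrite -/w2 -/e; lra.
have h1 : kap * r2 <= (1 + th) * (kap * w2) + (1 + th^-1) * (kap * d2).
  by have := r2le; rewrite -(ler_pM2l k0); lra.
rewrite -/w2 -/e -[nsq (g l / f l)]/(n l).
set L0 := ln (X l) / 2 - kap / 2 * (l - y) in low upp.
have lamL : zs_log <= L0 + n l by rewrite /zs_log lnE /L0; lra.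
have L00 : 0 <= L0 by lra.
have t0 : 0 <= th * L0 by rewrite mulr_ge0// ltW.
have h2 : (1 - th - th ^+ 2) * (kap * r2) <= (1 + th) * (kap * w2) + (1 + th^-1) * e by lra.
have h3 : (1 - th - th ^+ 2) * ((1 - th / 4) * L0) <= (1 - th - th ^+ 2) * (kap * r2).
  by rewrite ler_wpM2l//; lra.
have h4 : (1 - 2 * th) * L0 <= (1 - th - th ^+ 2) * ((1 - th / 4) * L0).
  rewrite -subr_ge0.
  have -> : (1 - th - th ^+ 2) * ((1 - th / 4) * L0) - (1 - 2 * th) * L0 =
     (th * L0) * (3 / 4 - 3 / 4 * th + th ^+ 2 / 4) by field.
  by rewrite mulr_ge0//; have := sqr_ge0 th; lra.
have h5 : (1 - 2 * th) * zs_log <= (1 - 2 * th) * (L0 + n l) by rewrite ler_wpM2l//; lra.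
have : 0 <= th * n l by rewrite mulr_ge0// ltW.
lra.
Qed.

(** To the right of [z] the Riccati variable is driven by a small potential and forgets its
    value at [z] exponentially fast. *)
Lemma riccati_decay (eps z : R) : y <= z <= l ->
  (forall x, z <= x <= l -> nsq (q x) <= eps) ->
  nsq (g l / f l) <= eps / kap ^+ 2 + expR (- (kap * (l - z))).
Proof.
move=> /andP[yz zl] hq; rewrite -[nsq (g l / f l)]/(n l).
have dz x : z <= x <= l -> is_derive x (1:R)
    (fun x => expR (kap * x) * (n x - eps / kap ^+ 2))
    (expR (kap * x) * (kap * (n x - eps / kap ^+ 2) +
      (2 * Re (conjc (r x) * q x) * (1 - n x) - 2 * kap * n x))).
  move=> /andP[zx xl]; have h := dn (le_trans yz zx).
  by eapply rD_eq; [rD|ring].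
have := ger_of_derive zl dz => h.
have {h} : expR (kap * l) * (n l - eps / kap ^+ 2) <= expR (kap * z) * (n z - eps / kap ^+ 2).
  apply: h => x /andP[zx xl]; rewrite pmulr_rle0 ?expR_gt0//.
  have := n_le_young k0 (le_trans yz zx).
  have : nsq (q x) / kap <= eps / kap by rewrite ler_pM2r ?invr_gt0// hq// zx xl.
  have -> : kap * (n x - eps / kap ^+ 2) = kap * n x - eps / kap.
    by field; exact: lt0r_neq0.
  lra.
have /andP[_ nz1] := n1 yz.
have e0 : 0 <= eps / kap ^+ 2.
  by rewrite divr_ge0 ?sqr_ge0//; apply: le_trans (nsq_ge0 (q z)) (hq z _); rewrite lexx zl.
have : expR (kap * z) * (n z - eps / kap ^+ 2) <= expR (kap * z) * 1.
  by rewrite ler_pM2l ?expR_gt0//; lra.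
move=> h1 h2; have := le_trans h2 h1.
rewrite -(ler_pM2l (expR_gt0 (- (kap * l)))) !mulrA -!expRD addrC addrN expR0 mul1r mulr1.
have -> : - (kap * l) + kap * z = - (kap * (l - z)) by ring.
lra.
Qed.
End Estimate.
End Riccati.

(** * Uniformity in time on bounded windows *)

Section UniformTime.
Context {R : realType}.

(** A near-covering argument on the compact segment. *)
Lemma uniform_in_time (F : R -> R -> R) (X t e : R) :
  continuous (fun p : R * R => F p.1 p.2) -> 0 < e ->
  \forall s \near t, forall x, `|x| <= X -> `|F x s - F x t| <= e.
Proof.
move=> cF e0.
have cK : compact (`[- X, X]%classic : set R) by exact: segment_compact.
have /compact_near_coveringP/near_covering_withinP := cK.
move=> /(_ R (nbhs t) (fun s x => `|F x s - F x t| <= e) _).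
have H : forall x, `[- X, X]%classic x -> \forall x' \near x & i \near t,
    `[- X, X]%classic x' -> `|F x' i - F x' t| <= e.
  move=> x _; have e2 : 0 < e / 2 by rewrite divr_gt0.
  have /(@cvgrPdist_lt _ R^o) /(_ _ e2) := cF (x, t).
  move=> [[A B] /= [nA nB] AB].
  exists (A, B) => //= -[x' i] [/= Ax' Bi] _.
  have h1 := AB (x', i) (conj Ax' Bi).
  have h2 := AB (x', t) (conj Ax' (nbhs_singleton nB)).
  move: h1 h2 => /=; rewrite !ltr_norml ler_norml => /andP[? ?] /andP[? ?].
  by apply/andP; split; lra.
move=> /(_ H); apply: filterS => s hs x; rewrite ler_norml => xX.
by apply: hs; rewrite /= in_itv.
Qed.

Lemma bounded_rectangle (F : R -> R -> R) (X a b : R) :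
  continuous (fun p : R * R => F p.1 p.2) ->
  exists2 B : R, 0 <= B & forall x s, `|x| <= X -> a <= s <= b -> `|F x s| <= B.
Proof.
move=> cF.
pose K : set (R * R) := (`[- X, X]%classic `*` `[a, b]%classic).
have cK : compact K by apply: compact_setX; exact: segment_compact.
have [K0|/set0P K0] := eqVneq K set0.
  exists 0 => // x s; rewrite ler_norml => xX sab.
  by exfalso; have : K (x, s) by []; rewrite K0.
have cN : {within K, continuous (fun p => `|F p.1 p.2|)}.
  by apply: continuous_subspaceT => p; apply: (@cvg_norm R R^o); exact: cF.
have [[x0 s0] _ h] := compact_EVT_max K0 cK cN.
exists `|F x0 s0| => // x s; rewrite ler_norml => xX sab.
by apply: (h (x, s)); rewrite inE; split; rewrite /= in_itv.
Qed.

(** The function [exp (- K x) (S x + E / K)] is nonincreasing for positive [x]; negative [x]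
    are treated by reflection. *)
Lemma gronwall0 (S dS : R -> R) (K E X : R) : 0 < K ->
  S 0 = 0 -> (forall x, is_derive x (1:R) S (dS x)) ->
  (forall x, `|x| <= X -> `|dS x| <= K * S x + E) ->
  forall x, `|x| <= X -> S x <= E / K * (expR (K * `|x|) - 1).
Proof.
move=> K0.
suff pos : forall (S dS : R -> R), S 0 = 0 -> (forall x, is_derive x (1:R) S (dS x)) ->
  (forall x, `|x| <= X -> `|dS x| <= K * S x + E) ->
  forall x, 0 <= x -> x <= X -> S x <= E / K * (expR (K * x) - 1).
  move=> S0 dSd hb x xX; have [x0|/ltW x0] := leP 0 x.
    by rewrite ger0_norm// in xX *; exact: (pos S dS).
  rewrite ler0_norm// in xX *.
  have := pos (fun z => S (- z)) (fun z => - dS (- z)).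
  rewrite oppr0 => /(_ S0) h; rewrite -{1}[x]opprK; apply: h => //; last by rewrite oppr_ge0.
    move=> z; have h1 := dSd (- z).
    have h2 : is_derive z (1:R) (fun z : R => - z) (-1) by exact: rD_opp (rD_id z).
    by apply: (rD_eq (rD_comp h1 h2)); rewrite mulrN1.
  by move=> z zX; rewrite normrN; apply: hb; rewrite normrN.
move=> {}S {}dS S0 dSd hb x x0 xX.
have d z : is_derive z (1:R) (fun z => expR (- (K * z)) * (S z + E / K))
   (expR (- (K * z)) * (dS z - K * S z - E)).
  have h := dSd z; eapply rD_eq; first by rD.
  by field; exact: lt0r_neq0.
have := ger_of_derive x0 (fun z _ => d z).
rewrite S0 mulr0 oppr0 expR0 mul1r add0r => h.
have {h} : expR (- (K * x)) * (S x + E / K) <= E / K.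
  apply: h => z /andP[z0 zx]; rewrite pmulr_rle0 ?expR_gt0//.
  have := hb z; rewrite ger0_norm// => /(_ (le_trans zx xX)).
  by move=> /(le_trans (ler_norm _)); lra.
rewrite -(ler_pM2l (expR_gt0 (K * x))) mulrA -expRD addrN expR0 mul1r; lra.
Qed.

Lemma is_derive_of_littleo (f : R -> R) (t l : R) :
  (forall e, 0 < e -> \forall s \near t, `|f s - f t - (s - t) * l| <= e * `|s - t|) ->
  is_derive t (1:R) f l.
Proof.
move=> H.
have c : (fun h => h^-1 *: ((f \o shift t) (h *: (1:R)) - f t)) @ 0^' --> l.
  apply/(@cvgrPdist_le _ R^o) => e e0.
  have [d /= d0 hd] := H e e0.
  exists d => //= h; rewrite /= sub0r normrN => hd' h0.
  have := hd (h + t); rewrite /= opprD addrCA subrr addr0 normrN => /(_ hd').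
  rewrite /GRing.scale /= mulr1 addrK => hl.
  have -> : l - h^-1 * (f (h + t) - f t) = - ((f (h + t) - f t - h * l) / h) by field.
  by rewrite normrN normrM normfV ler_pdivrMr// normr_gt0.
by split; [apply/cvg_ex; exists l|exact/cvg_lim].
Qed.
End UniformTime.

(** * Differentiating the system in time *)

Section TimeDerivative.
Context {R : realType}.
Local Notation C := R[i].
Local Notation Re := (@complex.Re R).
Local Notation Im := (@complex.Im R).

Lemma ccont_bounded (f : R -> C) (X : R) : 0 <= X -> ccont f ->
  exists2 B : R, 0 <= B & forall x, `|x| <= X -> nsq (f x) <= B.
Proof.
move=> X0 [c1 c2]; have [B1 B10 h1] := continuous_bounded_segment X0 c1.
have [B2 B20 h2] := continuous_bounded_segment X0 c2.
exists (B1 ^+ 2 + B2 ^+ 2); first by rewrite addr_ge0 ?sqr_ge0.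
move=> x xX; rewrite /nsq -[Re _ ^+ 2]real_normK ?num_real// -[Im _ ^+ 2]real_normK ?num_real//.
by rewrite lerD// ler_sqr ?nnegrE ?normr_ge0//; [exact: h1|exact: h2].
Qed.

Lemma continuous2_slice (u : R -> R -> C) (t : R) : continuous2 u -> ccont (u^~ t).
Proof.
move=> [c1 c2]; split => x.
  apply: (@cvg_comp _ _ _ (fun x : R => (x, t)) (fun p : R * R => Re (u p.1 p.2)) (nbhs x) (nbhs (x, t)) _ _ (c1 (x, t))); exact: (cvg_pair cvg_id (cvg_cst t)).
apply: (@cvg_comp _ _ _ (fun x : R => (x, t)) (fun p : R * R => Im (u p.1 p.2)) (nbhs x) (nbhs (x, t)) _ _ (c2 (x, t))); exact: (cvg_pair cvg_id (cvg_cst t)).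
Qed.

Lemma cD_of_littleo (f : R -> C) (t : R) (l : C) :
  (forall e, 0 < e -> \forall s \near t,
     nsq (f s - f t - (s - t)%:C * l) <= e * (s - t) ^+ 2) -> cD f t l.
Proof.
move=> h; have aux (z : C) (e : R) (b : R) : 0 < e -> nsq z <= e ^+ 2 * b ^+ 2 ->
   `|Re z| <= e * `|b| /\ `|Im z| <= e * `|b|.
  move=> e0 hz; have eb : 0 <= e * `|b| by rewrite mulr_ge0// ltW.
  split; rewrite -ler_sqr ?nnegrE ?normr_ge0// exprMn !real_normK ?num_real//;
    apply: le_trans hz; rewrite /nsq ?lerDl ?lerDr sqr_ge0 //.
split; apply: is_derive_of_littleo => e e0; have e20 : 0 < e ^+ 2 by rewrite exprn_gt0.
  have := h _ e20; apply: filterS => s /(aux _ _ _ e0)[+ _].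
  by rewrite !cE mul0r subr0.
have := h _ e20; apply: filterS => s /(aux _ _ _ e0)[_ +].
by rewrite !cE mul0r addr0.
Qed.

Variables (k : R) (q qt : R -> R -> C).
Hypotheses (Ht : forall x t, cD (q x) t (qt x t)).
Hypotheses (cqt : continuous2 qt) (cqx : forall t, ccont (q^~ t)).

(** The mean value inequality in time; the uniformity in [x] is that of the continuity of
    [qt]. *)
Lemma increment_small (X t e : R) : 0 < e ->
  \forall s \near t, forall x, `|x| <= X ->
   nsq (q x s - q x t - (s - t)%:C * qt x t) <= e * (s - t) ^+ 2.
Proof.
move=> e0; pose e1 := Num.sqrt (e / 2).
have e10 : 0 < e1 by rewrite sqrtr_gt0 divr_gt0.
have e1E : e1 ^+ 2 = e / 2 by rewrite sqr_sqrtr// divr_ge0// ltW.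
have [cr ci] := cqt.
have [d1 /= d10 h1] := @uniform_in_time R (fun x s => Re (qt x s)) X t e1 cr e10.
have [d2 /= d20 h2] := @uniform_in_time R (fun x s => Im (qt x s)) X t e1 ci e10.
have main (f df : R -> R) s d : 0 < d -> `|t - s| < d ->
    (forall z, is_derive z (1:R) f (df z)) ->
    (forall z, `|t - z| < d -> `|df z - df t| <= e1) ->
    `|f s - f t - (s - t) * df t| <= e1 * `|s - t|.
  move=> d0 ts dfd hb.
  have D z : is_derive z (1:R) (fun z => f z - z * df t) (df z - df t).
    by have h := dfd z; eapply rD_eq; [rD|ring].
  have G z : is_derive z (1:R) (fun z => e1 * z) e1.
    by eapply rD_eq; [rD|ring].
  have [st|/ltW st] := leP t s.
    have := @norm_le_of_derive R _ _ _ _ t s st (fun z _ => D z) (fun z _ => G z).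
    have -> : f s - s * df t - (f t - t * df t) = f s - f t - (s - t) * df t by ring.
    have -> : e1 * `|s - t| = e1 * s - e1 * t by rewrite ger0_norm ?subr_ge0// mulrBr.
    apply => z /andP[tz zs]; apply: hb.
    by apply: le_lt_trans ts; rewrite !ler0_norm; lra.
  have := @norm_le_of_derive R _ _ _ _ s t st (fun z _ => D z) (fun z _ => G z).
  have -> : f t - t * df t - (f s - s * df t) = - (f s - f t - (s - t) * df t) by ring.
  have -> : e1 * `|s - t| = e1 * t - e1 * s.
    by rewrite ler0_norm ?subr_le0// opprB mulrBr.
  rewrite normrN; apply => z /andP[tz zs].
  by apply: hb; apply: le_lt_trans ts; rewrite !ger0_norm; lra.
have : \forall s \near t, `|t - s| < Num.min d1 d2.
  by apply: (@nbhsx_ballx _ R^o); rewrite lt_min d10 d20.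
apply: filterS => s; rewrite lt_min => /andP[s1 s2] x xX.
have b1 := main _ _ s d1 d10 s1 (fun z => (Ht x z).1) (fun z hz => h1 z hz x xX).
have b2 := main _ _ s d2 d20 s2 (fun z => (Ht x z).2) (fun z hz => h2 z hz x xX).
have sq (a : R) : `|a| <= e1 * `|s - t| -> a ^+ 2 <= e / 2 * (s - t) ^+ 2.
  move=> h; rewrite -e1E -[(s - t) ^+ 2]real_normK ?num_real// -exprMn.
  by rewrite -[a ^+ 2]real_normK ?num_real// ler_sqr ?nnegrE ?mulr_ge0// ltW.
have := sq _ b1; have := sq _ b2; rewrite /nsq !cE !mul0r subr0 addr0.
by lra.
Qed.

Lemma uniform_increment (X t e : R) : 0 < e ->
  \forall s \near t, forall x, `|x| <= X -> nsq (q x s - q x t) <= e.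
Proof.
move=> e0.
have e4 : 0 < e / 4 by rewrite divr_gt0.
have [B B0 hB] : exists2 B : R, 0 <= B & forall x, `|x| <= X -> nsq (qt x t) <= B.
  have [X0|X0] := leP 0 X; last first.
    by exists 0 => // x xX; exfalso; have := normr_ge0 x; lra.
  by apply: ccont_bounded => //; exact: continuous2_slice.
have h1 := increment_small X t e4.
have h2 : \forall s \near t, `|t - s| < Num.min 1 (e / (4 * (B + 1))).
  by apply: (@nbhsx_ballx _ R^o); rewrite lt_min ltr01 divr_gt0// mulr_gt0// ltr_wpDl.
apply: filterS2 h1 h2 => s h4; rewrite lt_min => /andP[s1 s2] x xX.
have := h4 x xX; have := nsqD (q x s - q x t - (s - t)%:C * qt x t) ((s - t)%:C * qt x t) ltr01.
rewrite subrK invr1 nsqM nsqC.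
have s3 : (s - t) ^+ 2 <= `|t - s|.
  rewrite -[(s - t) ^+ 2]real_normK ?num_real// distrC expr2 ler_piMl//; exact: ltW.
have s4 : (s - t) ^+ 2 <= 1 by apply: le_trans s3 (ltW s1).
have b1 : e / 4 * (s - t) ^+ 2 <= e / 4 by rewrite ler_piMr// ltW.
have b2 : (s - t) ^+ 2 * nsq (qt x t) <= e / 4.
  apply: (@le_trans _ _ (e / (4 * (B + 1)) * (B + 1))).
    apply: ler_pM; rewrite ?sqr_ge0 ?nsq_ge0//.
      by apply: le_trans s3 (ltW s2).
    by apply: le_trans (hB x xX) _; lra.
  have B1 : B + 1 != 0 by apply: lt0r_neq0; lra.
  by have -> : e / (4 * (B + 1)) * (B + 1) = e / 4 by field.
lra.
Qed.

(** Differentiating a family of solutions in the parameter: the increment solves the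
    same linear system with a small source, hence is small. *)
Lemma zs_column_time_derivative (f g : R -> R -> C) (f0 g0 : C) (t : R) (Mf Mg : R -> C) :
  (forall s, zs_column k (q^~ s) (f^~ s) (g^~ s)) ->
  (forall s, f 0 s = f0) -> (forall s, g 0 s = g0) ->
  Mf 0 = 0 -> Mg 0 = 0 ->
  (forall x, cD Mf x (k%:C * Mf x + conjc (q x t) * Mg x + conjc (qt x t) * g x t)) ->
  (forall x, cD Mg x (q x t * Mf x - k%:C * Mg x + qt x t * f x t)) ->
  forall x, cD (f x) t (Mf x) /\ cD (g x) t (Mg x).
Proof.
move=> hfg hf0 hg0 Mf0 Mg0 dMf dMg x.
pose X := `|x|; have X0 : 0 <= X by exact: normr_ge0.
have bdd (h : R -> C) (dh : R -> C) : (forall x, cD h x (dh x)) ->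
   exists2 B : R, 0 <= B & forall x, `|x| <= X -> nsq (h x) <= B.
  by move=> hd; apply: ccont_bounded => //; exact: cD_ccont hd.
have [Bf Bf0 hBf] := bdd _ _ (fun z => (hfg t z).1).
have [Bg Bg0 hBg] := bdd _ _ (fun z => (hfg t z).2).
have [BMf BMf0 hBMf] := bdd _ _ dMf.
have [BMg BMg0 hBMg] := bdd _ _ dMg.
have [Bq Bq0 hBq] := ccont_bounded X0 (cqx t).
(* [Q] bounds the potential at nearby times, [K] is the Gronwall rate, [G] measures the
   source terms and [Cx] is the resulting factor. *)
pose Q := 2 * Bq + 2.
pose K := 2 * `|k| + 2 * Q + 3.
have K0 : 0 < K by rewrite /K /Q; have := normr_ge0 k; lra.
pose G := 2 * (Bf + Bg + BMf + BMg) + 1.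
have G0 : 0 < G by rewrite /G; lra.
pose Cx := G / K * expR (K * X) + 1.
have Cx0 : 0 < Cx by rewrite ltr_wpDl// mulr_ge0 ?expR_ge0// divr_ge0// ltW.
have main e : 0 < e -> \forall s \near t,
   nsq (f x s - f x t - (s - t)%:C * Mf x) + nsq (g x s - g x t - (s - t)%:C * Mg x)
     <= e * (s - t) ^+ 2.
  move=> e0; pose e' := e / Cx; have e'0 : 0 < e' by rewrite divr_gt0.
  have h1 := increment_small X t e'0.
  have h2 := uniform_increment X t e'0.
  have h3 := uniform_increment X t ltr01.
  apply: filterS3 h1 h2 h3 => s k1 k2 k3.
  pose h := s - t.
  pose Df z := f z s - f z t - h%:C * Mf z.
  pose Dg z := g z s - g z t - h%:C * Mg z.
  pose e1 z := conjc (q z s - q z t - h%:C * qt z t) * g z t + h%:C * conjc (q z s - q z t) * Mg z.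
  pose e2 z := (q z s - q z t - h%:C * qt z t) * f z t + h%:C * (q z s - q z t) * Mf z.
  have dDf z : cD Df z (k%:C * Df z + conjc (q z s) * Dg z + e1 z).
    have [a1 _] := hfg s z; have [a2 _] := hfg t z; have a3 := dMf z.
    rewrite /Df; eapply cD_eq; first by cD.
    rewrite /e1 /Dg /Df /h.
    move: (f z s) (f z t) (Mf z) (g z s) (g z t) (Mg z) (q z s) (q z t) (qt z t) (s - t) =>
      [? ?] [? ?] [? ?] [? ?] [? ?] [? ?] [? ?] [? ?] [? ?] ?.
    by apply: eq_ReIm; rewrite !cE /=; ring.
  have dDg z : cD Dg z (q z s * Df z - k%:C * Dg z + e2 z).
    have [_ a1] := hfg s z; have [_ a2] := hfg t z; have a3 := dMg z.
    rewrite /Dg; eapply cD_eq; first by cD.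
    by rewrite /e2 /Dg /Df; ring.
  have dS z := rD_add (cD_nsq (dDf z)) (cD_nsq (dDg z)).
  have S0 : nsq (Df 0) + nsq (Dg 0) = 0.
    by rewrite /Df /Dg !hf0 !hg0 Mf0 Mg0 !subrr mulr0 oppr0 addr0 nsq0 addr0.
  pose E := e' * h ^+ 2 * G.
  have gr := @gronwall0 R _ _ K E X K0 S0 dS _ x (lexx _).
  have {gr} : forall z, `|z| <= X -> `|2 * Re (conjc (Df z) * (k%:C * Df z + conjc (q z s) * Dg z + e1 z)) +
      2 * Re (conjc (Dg z) * (q z s * Df z - k%:C * Dg z + e2 z))|
       <= K * (nsq (Df z) + nsq (Dg z)) + E.
    move=> z zX.
    have nq : nsq (q z s) <= Q.
      have := nsqD (q z s - q z t) (q z t) ltr01; rewrite subrK invr1.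
      by have := k3 z zX; have := hBq z zX; rewrite /Q; lra.
    have ne1 : nsq (e1 z) <= e' * h ^+ 2 * (2 * (Bg + BMg)).
      have := nsqD (conjc (q z s - q z t - h%:C * qt z t) * g z t) (h%:C * conjc (q z s - q z t) * Mg z) ltr01.
      rewrite invr1 -/(e1 z) !nsqM !nsqJ nsqC.
      have := ler_pM (nsq_ge0 _) (nsq_ge0 _) (k1 z zX) (hBg z zX).
      have := ler_pM (nsq_ge0 _) (nsq_ge0 _) (k2 z zX) (hBMg z zX).
      move=> /(ler_wpM2l (sqr_ge0 h)); rewrite -/h; lra.
    have ne2 : nsq (e2 z) <= e' * h ^+ 2 * (2 * (Bf + BMf)).
      have := nsqD ((q z s - q z t - h%:C * qt z t) * f z t) (h%:C * (q z s - q z t) * Mf z) ltr01.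
      rewrite invr1 -/(e2 z) !nsqM nsqC.
      have := ler_pM (nsq_ge0 _) (nsq_ge0 _) (k1 z zX) (hBf z zX).
      have := ler_pM (nsq_ge0 _) (nsq_ge0 _) (k2 z zX) (hBMf z zX).
      move=> /(ler_wpM2l (sqr_ge0 h)); rewrite -/h; lra.
    have y1 := young_norm (conjc (Df z)) (conjc (q z s) * Dg z) ltr01.
    have y2 := young_norm (conjc (Dg z)) (q z s * Df z) ltr01.
    have y3 := young_norm (conjc (Df z)) (e1 z) ltr01.
    have y4 := young_norm (conjc (Dg z)) (e2 z) ltr01.
    rewrite !nsqM !nsqJ !divr1 !mul1r in y1 y2 y3 y4.
    have nf := nsq_ge0 (Df z); have ng := nsq_ge0 (Dg z).
    have m1 : nsq (q z s) * nsq (Dg z) <= Q * nsq (Dg z) by rewrite ler_wpM2r.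
    have m2 : nsq (q z s) * nsq (Df z) <= Q * nsq (Df z) by rewrite ler_wpM2r.
    have -> : 2 * Re (conjc (Df z) * (k%:C * Df z + conjc (q z s) * Dg z + e1 z)) +
      2 * Re (conjc (Dg z) * (q z s * Df z - k%:C * Dg z + e2 z)) =
      2 * k * (nsq (Df z) - nsq (Dg z)) + 2 * Re (conjc (Df z) * (conjc (q z s) * Dg z))
       + 2 * Re (conjc (Dg z) * (q z s * Df z)) + 2 * Re (conjc (Df z) * e1 z)
       + 2 * Re (conjc (Dg z) * e2 z).
      move: (Df z) (Dg z) (e1 z) (e2 z) (q z s) => [? ?] [? ?] [? ?] [? ?] [? ?].
      by rewrite /nsq !cE /=; ring.
    have kk : `|2 * k * (nsq (Df z) - nsq (Dg z))| <= 2 * `|k| * (nsq (Df z) + nsq (Dg z)).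
      rewrite !normrM normr_nat ler_wpM2l ?mulr_ge0//.
      by apply: le_trans (ler_normB _ _) _; rewrite !ger0_norm.
    have tri (a b c d v : R) : `|a + b + c + d + v| <= `|a| + `|b| + `|c| + `|d| + `|v|.
      by do 4 (apply: le_trans (ler_normD _ _) _; rewrite lerD2r).
    apply: le_trans (tri _ _ _ _ _) _; rewrite 4![`|2 * Re _|]normrM normr_nat.
    have : E = e' * h ^+ 2 * (2 * (Bg + BMg)) + e' * h ^+ 2 * (2 * (Bf + BMf)) + e' * h ^+ 2.
      by rewrite /E /G; ring.
    have : 0 <= e' * h ^+ 2 by rewrite mulr_ge0 ?sqr_ge0// ltW.
    have : 0 <= Q * nsq (Df z) by rewrite mulr_ge0// /Q; lra.
    have : 0 <= Q * nsq (Dg z) by rewrite mulr_ge0// /Q; lra.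
    rewrite /K; move: ne1 ne2 y1 y2 y3 y4 m1 m2 kk; lra.
  move=> bb; have {bb}/= gr := @gronwall0 R _ _ K E X K0 S0 dS bb x (lexx _).
  apply: le_trans gr _; rewrite -/h.
  have -> : e = e' * Cx by rewrite /e' divfK// lt0r_neq0.
  have -> : E / K * (expR (K * `|x|) - 1) = e' * h ^+ 2 * (G / K * (expR (K * X) - 1)).
    by rewrite /E /X; field; exact: lt0r_neq0.
  have eh0 : 0 <= e' * h ^+ 2 by rewrite mulr_ge0 ?sqr_ge0// ltW.
  have GK : 0 < G / K by rewrite divr_gt0.
  by rewrite [leRHS]mulrAC; apply: ler_wpM2l => //; rewrite /Cx; lra.
split; apply: cD_of_littleo => e /main; apply: filterS => s; apply: le_trans.
  by rewrite lerDl nsq_ge0.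
by rewrite lerDr nsq_ge0.
Qed.

End TimeDerivative.

(** * Zero curvature and the boundary flux *)

(** The derivatives are part of the data, since the zero curvature equation below mixes
    [qt], [qx] and [qxx]. *)
Record nls_flow {R : realType} (q qt qx qxx : R -> R -> R[i]) : Prop := NlsFlow {
  flow_t : forall x t, cD (q x) t (qt x t);
  flow_x : forall x t, cD (q^~ t) x (qx x t);
  flow_xx : forall x t, cD (qx^~ t) x (qxx x t);
  flow_eq : forall x t, qt x t = 'i * qxx x t - 2 * 'i * (conjc (q x t) * q x t) * q x t;
  flow_c : continuous2 q;
  flow_ct : continuous2 qt;
  flow_cx : continuous2 qx }.

Section Flux.
Context {R : realType}.
Local Notation C := R[i].
Local Notation Re := (@complex.Re R).
Local Notation Im := (@complex.Im R).
Variables (q qt qx qxx : R -> R -> C).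
Hypothesis fl : nls_flow q qt qx qxx.
Variable kap : R.
Hypothesis kap0 : 0 < kap.
Let k := kap / 2.

Lemma fundamental_exists : exists a b c d : R -> R -> C, forall t,
  [/\ zs_column k (q^~ t) (a^~ t) (c^~ t), zs_column k (q^~ t) (b^~ t) (d^~ t) &
   [/\ a 0 t = 1, c 0 t = 0, b 0 t = 0 & d 0 t = 1]].
Proof.
have cq t : ccont (q^~ t) by apply: continuous2_slice; exact: flow_c fl.
have h1 t : exists p : (R -> C) * (R -> C), [/\ p.1 0 = 1, p.2 0 = 0 & zs_column k (q^~ t) p.1 p.2].
  by have [f [g h]] := zs_column_exists k 1 0 (cq t); exists (f, g).
have h2 t : exists p : (R -> C) * (R -> C), [/\ p.1 0 = 0, p.2 0 = 1 & zs_column k (q^~ t) p.1 p.2].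
  by have [f [g h]] := zs_column_exists k 0 1 (cq t); exists (f, g).
have [p hp] := choice h1; have [p' hp'] := choice h2.
exists (fun x t => (p t).1 x), (fun x t => (p' t).1 x), (fun x t => (p t).2 x), (fun x t => (p' t).2 x).
by move=> t; have [? ? ?] := hp t; have [? ? ?] := hp' t; split.
Qed.

Variables a b c d : R -> R -> C.
Hypothesis abcd : forall t,
  [/\ zs_column k (q^~ t) (a^~ t) (c^~ t), zs_column k (q^~ t) (b^~ t) (d^~ t) &
   [/\ a 0 t = 1, c 0 t = 0, b 0 t = 0 & d 0 t = 1]].

Let kC := k%:C.
Let kapE : kap%:C = 2 * kC.
Proof. by apply: eq_ReIm; rewrite /kC /k !cE; field. Qed.

(* The time half of the Lax pair is the matrix with rows [AA, BB] and [CC, - AA]. *)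
Let AA x t : C := 'i * (conjc (q x t) * q x t - 2 * kC ^+ 2).
Let BB x t : C := - 'i * (2 * kC * conjc (q x t) + conjc (qx x t)).
Let CC x t : C := 'i * (qx x t - 2 * kC * q x t).

Let conj_eq x t : conjc (qt x t) =
  - 'i * conjc (qxx x t) + 2 * 'i * (conjc (q x t) * q x t) * conjc (q x t).
Proof.
rewrite (flow_eq fl); move: (qxx x t) (q x t) => u v.
by case: u v => [? ?] [? ?]; apply: eq_ReIm; rewrite !cE /=; ring.
Qed.

Let i2 : ('i : C) ^+ 2 = -1. Proof. exact: sqr_i. Qed.

Let dAA x t : cD (AA^~ t) x ('i * (conjc (qx x t) * q x t + conjc (q x t) * qx x t)).
Proof.
have h := flow_x fl x t; rewrite /AA; eapply cD_eq; first by cD.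
by ring.
Qed.
Let dBB x t : cD (BB^~ t) x (- 'i * (2 * kC * conjc (qx x t) + conjc (qxx x t))).
Proof.
have h := flow_x fl x t; have h' := flow_xx fl x t; rewrite /BB; eapply cD_eq; first by cD.
by ring.
Qed.
Let dCC x t : cD (CC^~ t) x ('i * (qxx x t - 2 * kC * qx x t)).
Proof.
have h := flow_x fl x t; have h' := flow_xx fl x t; rewrite /CC; eapply cD_eq; first by cD.
by ring.
Qed.

(** Zero curvature: applying the time matrix to a solution solves the
    linearized spatial system. *)
Let zero_curv f g t : zs_column k (q^~ t) f g -> forall x,
  cD (fun x => AA x t * f x + BB x t * g x) x
   (kC * (AA x t * f x + BB x t * g x) + conjc (q x t) * (CC x t * f x - AA x t * g x)
     + conjc (qt x t) * g x) /\
  cD (fun x => CC x t * f x - AA x t * g x) x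
   (q x t * (AA x t * f x + BB x t * g x) - kC * (CC x t * f x - AA x t * g x)
     + qt x t * f x).
Proof.
move=> hfg x; have [hf hg] := hfg x.
have h1 := dAA x t; have h2 := dBB x t; have h3 := dCC x t.
split; (eapply cD_eq; first by cD).
  rewrite conj_eq -/kC /AA /BB /CC.
  move: (f x) (g x) (q x t) (conjc (q x t)) (qx x t) (conjc (qx x t)) (conjc (qxx x t)) kC.
  by move=> F G Q Q' Qx Qx' Qxx K; ring: i2.
rewrite (flow_eq fl) -/kC /AA /BB /CC.
move: (f x) (g x) (q x t) (conjc (q x t)) (qx x t) (conjc (qx x t)) (qxx x t) kC.
by move=> F G Q Q' Qx Qx' Qxx K; ring: i2.
Qed.

(** The columns are normalized at [x = 0], which subtracts the time matrix taken there. *)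
Let ddt x t :
  [/\ cD (a x) t (AA x t * a x t + BB x t * c x t - (a x t * AA 0 t + b x t * CC 0 t)),
   cD (c x) t (CC x t * a x t - AA x t * c x t - (c x t * AA 0 t + d x t * CC 0 t)),
   cD (b x) t (AA x t * b x t + BB x t * d x t - (a x t * BB 0 t - b x t * AA 0 t)) &
   cD (d x) t (CC x t * b x t - AA x t * d x t - (c x t * BB 0 t - d x t * AA 0 t))].
Proof.
have cqs s : ccont (q^~ s) by apply: continuous2_slice; exact: flow_c fl.
have [hac hbd [a0 c0 b0 d0]] := abcd t.
have T := @zs_column_time_derivative R k q qt (flow_t fl) (flow_ct fl) cqs.
have h1 := T a c 1 0 t
  (fun x => AA x t * a x t + BB x t * c x t - (a x t * AA 0 t + b x t * CC 0 t))
  (fun x => CC x t * a x t - AA x t * c x t - (c x t * AA 0 t + d x t * CC 0 t)).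
have h2 := T b d 0 1 t
  (fun x => AA x t * b x t + BB x t * d x t - (a x t * BB 0 t - b x t * AA 0 t))
  (fun x => CC x t * b x t - AA x t * d x t - (c x t * BB 0 t - d x t * AA 0 t)).
have [] := h1 _ _ _ _ _ _ _ x; last (move=> ? ?; have [] := h2 _ _ _ _ _ _ _ x => //).
- by move=> s; have [] := abcd s.
- by move=> s; have [_ _ []] := abcd s.
- by move=> s; have [_ _ []] := abcd s.
- by rewrite a0 c0 b0; ring.
- by rewrite a0 c0 d0; ring.
- move=> z; have [e1 _] := zero_curv hac z; have [e2 _] := hac z; have [e3 _] := hbd z.
  apply: (cD_eq (cD_add e1 (cD_opp (cD_add (cD_mul e2 (cD_cst (AA 0 t) z)) (cD_mul e3 (cD_cst (CC 0 t) z)))))).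
  by move: (AA 0 t) (BB 0 t) (CC 0 t) (AA z t) (BB z t) (CC z t) => A0 B0 C0 A B C; rewrite -/kC; ring.
- move=> z; have [_ e1] := zero_curv hac z; have [_ e2] := hac z; have [_ e3] := hbd z.
  apply: (cD_eq (cD_add e1 (cD_opp (cD_add (cD_mul e2 (cD_cst (AA 0 t) z)) (cD_mul e3 (cD_cst (CC 0 t) z)))))).
  by move: (AA 0 t) (BB 0 t) (CC 0 t) (AA z t) (BB z t) (CC z t) => A0 B0 C0 A B C; rewrite -/kC; ring.
- by move=> s; have [] := abcd s.
- by move=> s; have [_ _ []] := abcd s.
- by move=> s; have [_ _ []] := abcd s.
- by rewrite a0 b0 d0; ring.
- by rewrite b0 c0 d0; ring.
- move=> z; have [e1 _] := zero_curv hbd z; have [e2 _] := hac z; have [e3 _] := hbd z.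
  apply: (cD_eq (cD_add e1 (cD_opp (cD_add (cD_mul e2 (cD_cst (BB 0 t) z)) (cD_opp (cD_mul e3 (cD_cst (AA 0 t) z))))))).
  by move: (AA 0 t) (BB 0 t) (CC 0 t) (AA z t) (BB z t) (CC z t) => A0 B0 C0 A B C; rewrite -/kC; ring.
- move=> z; have [_ e1] := zero_curv hbd z; have [_ e2] := hac z; have [_ e3] := hbd z.
  apply: (cD_eq (cD_add e1 (cD_opp (cD_add (cD_mul e2 (cD_cst (BB 0 t) z)) (cD_opp (cD_mul e3 (cD_cst (AA 0 t) z))))))).
  by move: (AA 0 t) (BB 0 t) (CC 0 t) (AA z t) (BB z t) (CC z t) => A0 B0 C0 A B C; rewrite -/kC; ring.
Qed.

Lemma cD_neg (f : R -> C) x l : cD f (- x) l -> cD (fun y => f (- y)) x (- l).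
Proof.
have n : is_derive x (1:R) (fun z : R => - z) (-1) by exact: rD_opp (rD_id x).
by move=> [h1 h2]; split; rewrite cE -mulrN1; [apply: (rD_comp h1 n)|apply: (rD_comp h2 n)].
Qed.

(** Transfer matrix from [- l] to [l]: the fundamental matrix at [l] times the adjugate of
    the one at [- l], whose determinant is 1. *)
Definition T11 l t : C := a l t * d (- l) t - b l t * c (- l) t.
Definition T21 l t : C := c l t * d (- l) t - d l t * c (- l) t.
Definition T12 l t : C := b l t * a (- l) t - a l t * b (- l) t.
Definition T22 l t : C := d l t * a (- l) t - c l t * b (- l) t.

Let det x t : a x t * d x t - b x t * c x t = 1.
Proof.
have [hac hbd [a0 c0 b0 d0]] := abcd t.
have D y : cD (fun y => a y t * d y t - b y t * c y t) y 0.
  have [e1 e2] := hac y; have [e3 e4] := hbd y.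
  by eapply cD_eq; [cD|rewrite -/kC; ring].
have D0 : a 0 t * d 0 t - b 0 t * c 0 t = 1 by rewrite a0 c0 b0 d0; ring.
rewrite -D0; apply: eq_ReIm.
  exact: (@eq_of_derive0 R (fun y => Re (a y t * d y t - b y t * c y t)) x 0 (fun y => (D y).1)).
exact: (@eq_of_derive0 R (fun y => Im (a y t * d y t - b y t * c y t)) x 0 (fun y => (D y).2)).
Qed.

Let det2 l t : T11 l t * T22 l t - T21 l t * T12 l t = 1.
Proof.
rewrite -(mulr1 1) -{1}(det l t) -(det (- l) t) /T11 /T22 /T21 /T12; ring.
Qed.

Let dTl l t :
  [/\ cD (T11^~ t) l (2 * kC * T11 l t + conjc (q l t) * T21 l t + q (- l) t * T12 l t),
   cD (T21^~ t) l (q l t * T11 l t + q (- l) t * T22 l t) &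
   cD (T12^~ t) l (conjc (q l t) * T22 l t + conjc (q (- l) t) * T11 l t)].
Proof.
have [hac hbd _] := abcd t.
have [e1 e2] := hac l; have [e3 e4] := hbd l.
have [/cD_neg e5 /cD_neg e6] := hac (- l); have [/cD_neg e7 /cD_neg e8] := hbd (- l).
rewrite /T11 /T21 /T12 /T22.
by split; (eapply cD_eq; [cD|rewrite -/kC /=; ring]).
Qed.

Let k_ge0 : 0 <= k. Proof. by rewrite divr_ge0// ltW. Qed.

Lemma T21_column (y t : R) : zs_column k (q^~ t)
  (fun x => a x t * d y t - b x t * c y t) (fun x => c x t * d y t - d x t * c y t) /\
  (a y t * d y t - b y t * c y t = 1 /\ c y t * d y t - d y t * c y t = 0).
Proof.
split; last by rewrite det; split => //; ring.
have [hac hbd _] := abcd t => x.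
have [e1 e2] := hac x; have [e3 e4] := hbd x.
by split; (eapply cD_eq; [cD|ring]).
Qed.

Lemma T11_T21 (l t : R) : 0 <= l -> 1 + nsq (T21 l t) <= nsq (T11 l t).
Proof.
move=> l0; have [hc [h1 h2]] := T21_column (- l) t.
have ll : - l <= l by lra.
by have := zs_column_cone k_ge0 hc h1 h2 ll; rewrite -/(T11 l t) -/(T21 l t); lra.
Qed.

(** The first row is a column of the system for the reflected and conjugated potential. *)
Lemma T11_T12 (l t : R) : 0 <= l -> 1 + nsq (T12 l t) <= nsq (T11 l t).
Proof.
move=> l0; have [hac hbd _] := abcd t.
have hc : zs_column k (fun z => conjc (q (- z) t))
   (fun z => a l t * d (- z) t - b l t * c (- z) t)
   (fun z => b l t * a (- z) t - a l t * b (- z) t).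
  move=> z; have [/cD_neg e5 /cD_neg e6] := hac (- z); have [/cD_neg e7 /cD_neg e8] := hbd (- z).
  by split; (eapply cD_eq; [cD|rewrite ?conjcK; ring]).
have ll : - l <= l by lra.
have := zs_column_cone k_ge0 hc _ _ ll; rewrite opprK det => /(_ erefl).
have -> : b l t * a l t - a l t * b l t = 0 by ring.
by move=> /(_ erefl); rewrite -/(T11 l t) -/(T12 l t); lra.
Qed.

Let F0 (l t : R) : 0 <= l -> T11 l t != 0.
Proof.
move=> l0; have := T11_T12 t l0; have := nsq_ge0 (T12 l t) => h1 h2.
by apply/negP => /eqP h; move: h2; rewrite h nsq0; lra.
Qed.

Let dTt l t : cD (T11 l) t (AA l t * T11 l t + BB l t * T21 l t - AA (- l) t * T11 l t
   - CC (- l) t * T12 l t).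
Proof.
have [e1 e2 e3 e4] := ddt l t; have [f1 f2 f3 f4] := ddt (- l) t.
apply: (cD_eq (cD_add (cD_mul e1 f4) (cD_opp (cD_mul e3 f2)))); rewrite /T11 /T21 /T12.
move: (AA 0 t) (BB 0 t) (CC 0 t) (AA l t) (BB l t) (CC l t) (AA (- l) t) (BB (- l) t) (CC (- l) t).
by move=> A0 B0 C0 A B E A' B' E'; ring.
Qed.

Definition zs_logT l t : R := ln (nsq (T11 l t)) / 2 - kap * l.

Let r l t := T21 l t / T11 l t.
Let s l t := T12 l t / T11 l t.

Definition flux l t : R := Re (BB l t * r l t - CC (- l) t * s l t).
Definition flux_pot l t : R :=
  Re (- 'i * conjc (q l t) * r l t + 'i * q (- l) t * s l t).
Definition flux_rest l t : R :=
  Re (- 'i * (2 * kap%:C * (conjc (q l t) * r l t) + (conjc (q l t) * r l t) ^+ 2)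
      + 'i * (2 * kap%:C * (q (- l) t * s l t) + (q (- l) t * s l t) ^+ 2)).

Lemma d_zs_logT (l t : R) : 0 <= l -> is_derive t (1:R) (zs_logT l) (flux l t).
Proof.
move=> l0; have F00 := F0 t l0; have n0 := nsq_gt0 F00.
have h := @rD_ln R (fun t => nsq (T11 l t)) t _ n0 (cD_nsq (dTt l t)).
rewrite /zs_logT; eapply rD_eq; first by rD.
have -> : flux l t = Re ((AA l t * T11 l t + BB l t * T21 l t - AA (- l) t * T11 l t
   - CC (- l) t * T12 l t) / T11 l t).
  have -> : (AA l t * T11 l t + BB l t * T21 l t - AA (- l) t * T11 l t
   - CC (- l) t * T12 l t) / T11 l t = AA l t - AA (- l) t + (BB l t * r l t - CC (- l) t * s l t).
    by rewrite /r /s; field.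
  have reA x : Re (AA x t) = 0.
    have -> : AA x t = 'i * (nsq (q x t) - 2 * k ^+ 2)%:C.
      by rewrite /AA conjM; apply: eq_ReIm; rewrite /kC expr2 !cE; ring.
    by rewrite !cE; ring.
  by rewrite ReD ReD ReN !reA subr0 add0r.
move: (ln _) (_ - _ * T12 l t) => L z.
rewrite Re_div; move: (Re _) => u.
by field; exact: lt0r_neq0.
Qed.

Let dr (l t : R) : 0 <= l -> cD (r^~ t) l (q l t + q (- l) t / T11 l t ^+ 2 - 2 * kC * r l t
   - conjc (q l t) * r l t ^+ 2).
Proof.
move=> l0; have F00 := F0 t l0; have [e1 e2 e3] := dTl l t.
rewrite /r; apply: (cD_eq (cD_mul e2 (@cD_inv R (T11^~ t) l _ F00 e1))).
have -> : T22 l t = (1 + T21 l t * T12 l t) / T11 l t.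
  by rewrite -(det2 l t); field.
by field.
Qed.

Let ds (l t : R) : 0 <= l -> cD (s^~ t) l (conjc (q l t) / T11 l t ^+ 2 + conjc (q (- l) t)
   - 2 * kC * s l t - q (- l) t * s l t ^+ 2).
Proof.
move=> l0; have F00 := F0 t l0; have [e1 e2 e3] := dTl l t.
rewrite /s; apply: (cD_eq (cD_mul e3 (@cD_inv R (T11^~ t) l _ F00 e1))).
have -> : T22 l t = (1 + T21 l t * T12 l t) / T11 l t.
  by rewrite -(det2 l t); field.
by field.
Qed.

(** The [x]-derivative of [q] enters the flux only through a total derivative, so that
    the averaged flux is controlled by the mass alone. *)
Lemma d_flux_pot (l t : R) : 0 <= l ->
  is_derive l (1:R) (flux_pot^~ t) (flux l t - flux_rest l t).
Proof.
move=> l0; have e1 := dr t l0; have e2 := ds t l0.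
have e3 := flow_x fl l t; have e4 := cD_neg (flow_x fl (- l) t).
have D : cD (fun l => - 'i * conjc (q l t) * r l t + 'i * q (- l) t * s l t) l
   (BB l t * r l t - CC (- l) t * s l t -
     (- 'i * (2 * kap%:C * (conjc (q l t) * r l t) + (conjc (q l t) * r l t) ^+ 2)
      + 'i * (2 * kap%:C * (q (- l) t * s l t) + (q (- l) t * s l t) ^+ 2))
     + 'i * (conjc (q (- l) t) * q (- l) t - conjc (q l t) * q l t)).
  eapply cD_eq; first by cD.
  rewrite kapE /BB /CC /=.
  move: (r l t) (s l t) (q l t) (conjc (q l t)) (q (- l) t) (conjc (q (- l) t)) (T11 l t ^+ 2)^-1.
  by move=> r' s' q1 q1' q2 q2' f; ring.
rewrite /flux_pot; apply: (rD_eq D.1).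
have z (x y : R) : Re ('i * (x%:C - y%:C)) = 0 by rewrite !cE; ring.
by rewrite !conjM ReD z addr0 ReD ReN.
Qed.

Let nr (l t : R) : 0 <= l -> nsq (r l t) <= 1.
Proof.
move=> l0; have := T11_T21 t l0; have := nsq_ge0 (T21 l t) => h1 h2.
by rewrite /r nsqM nsqV ler_pdivrMr; lra.
Qed.

Let ns (l t : R) : 0 <= l -> nsq (s l t) <= 1.
Proof.
move=> l0; have := T11_T12 t l0; have := nsq_ge0 (T12 l t) => h1 h2.
by rewrite /s nsqM nsqV ler_pdivrMr; lra.
Qed.

Let Re_mul_le (sg : R) (z w : C) : 0 < sg -> nsq w <= 1 ->
  `|Re (z * w)| <= (sg * nsq z + sg^-1) / 2.
Proof.
move=> s0 w1; have := young_norm z w s0.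
by have : nsq w / sg <= 1 / sg by [rewrite ler_pM2r// invr_gt0]; lra.
Qed.

(** The weight [sg] is to be balanced against the length of the window. *)
Lemma flux_pot_bound (sg : R) (l t : R) : 0 < sg -> 0 <= l ->
  `|flux_pot l t| <= sg * (nsq (q l t) + nsq (q (- l) t)) / 2 + sg^-1.
Proof.
move=> s0 l0; rewrite /flux_pot ReD.
have h1 := Re_mul_le (- 'i * conjc (q l t)) s0 (nr t l0).
have h2 := Re_mul_le ('i * q (- l) t) s0 (ns t l0).
move: h1 h2; rewrite !nsqM nsqN nsqi nsqJ !mul1r => h1 h2.
by apply: le_trans (ler_normD _ _) _; lra.
Qed.

Lemma flux_rest_bound (sg : R) (l t : R) : 0 < sg -> 0 <= l ->
  `|flux_rest l t| <= (kap * sg + 1) * (nsq (q l t) + nsq (q (- l) t)) + 2 * kap / sg.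
Proof.
move=> s0 l0; rewrite /flux_rest.
have h1 := Re_mul_le (- 'i * conjc (q l t)) s0 (nr t l0).
have h2 := Re_mul_le ('i * q (- l) t) s0 (ns t l0).
have sq (i z w : C) : nsq i = 1 -> nsq w <= 1 -> `|Re (i * (z * w) ^+ 2)| <= nsq z.
  move=> i1 w1; rewrite expr2 mulrA; have := young_norm (i * (z * w)) (z * w) ltr01.
  rewrite !nsqM i1; have : nsq z * nsq w <= nsq z by rewrite ler_piMr ?nsq_ge0.
  lra.
have i1 : nsq (- 'i : C) = 1 by rewrite nsqN nsqi.
have h4 := sq (- 'i) (conjc (q l t)) _ i1 (nr t l0).
have h5 := sq 'i (q (- l) t) _ nsqi (ns t l0).
have -> : Re (- 'i * (2 * kap%:C * (conjc (q l t) * r l t) + (conjc (q l t) * r l t) ^+ 2)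
      + 'i * (2 * kap%:C * (q (- l) t * s l t) + (q (- l) t * s l t) ^+ 2)) =
   2 * kap * Re (- 'i * conjc (q l t) * r l t) + Re (- 'i * (conjc (q l t) * r l t) ^+ 2)
   + 2 * kap * Re ('i * q (- l) t * s l t) + Re ('i * (q (- l) t * s l t) ^+ 2).
  move: (conjc (q l t)) (r l t) (q (- l) t) (s l t) => [? ?] [? ?] [? ?] [? ?].
  by rewrite !expr2 !cE /=; ring.
move: h1 h2; rewrite !nsqM nsqN nsqi nsqJ !mul1r => h1 h2.
rewrite nsqJ in h4.
have k20 : 0 < 2 * kap by rewrite mulr_gt0.
have m1 := ler_wpM2l (ltW k20) h1; have m2 := ler_wpM2l (ltW k20) h2.
have tri (x y z v : R) : `|x + y + z + v| <= `|x| + `|y| + `|z| + `|v|.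
  by do 3 (apply: le_trans (ler_normD _ _) _; rewrite ?lerD2r).
apply: le_trans (tri _ _ _ _) _; rewrite 2![`|2 * kap * _|]normrM (gtr0_norm k20).
move: h4 h5 m1 m2; rewrite -!mulrA; lra.
Qed.

Lemma flux_bound (Bq Bx : R) (l t : R) : 0 <= l -> 0 <= Bq -> 0 <= Bx ->
  nsq (q l t) <= Bq -> nsq (q (- l) t) <= Bq ->
  nsq (qx l t) <= Bx -> nsq (qx (- l) t) <= Bx ->
  `|flux l t| <= 1 + 2 * kap ^+ 2 * Bq + 2 * Bx.
Proof.
move=> l0 Bq0 Bx0 h1 h2 h3 h4; rewrite /flux ReD ReN.
have nB : nsq (BB l t) <= 2 * (kap ^+ 2 * Bq) + 2 * Bx.
  rewrite /BB -kapE nsqM nsqN nsqi mul1r; apply: le_trans (nsqD _ _ ltr01) _.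
  rewrite invr1 nsqM !nsqJ nsqC; have : kap ^+ 2 * nsq (q l t) <= kap ^+ 2 * Bq by rewrite ler_wpM2l ?sqr_ge0.
  lra.
have nC : nsq (CC (- l) t) <= 2 * (kap ^+ 2 * Bq) + 2 * Bx.
  rewrite /CC -kapE nsqM nsqi mul1r; apply: le_trans (nsqD _ _ ltr01) _.
  rewrite invr1 nsqN nsqM nsqC; have : kap ^+ 2 * nsq (q (- l) t) <= kap ^+ 2 * Bq by rewrite ler_wpM2l ?sqr_ge0.
  lra.
have e1 := Re_mul_le (BB l t) ltr01 (nr t l0).
have e2 := Re_mul_le (CC (- l) t) ltr01 (ns t l0).
rewrite invr1 !mul1r in e1 e2.
apply: le_trans (ler_normD _ _) _; rewrite normrN; lra.
Qed.

Lemma flux_continuous (l t : R) : 0 <= l -> {for l, continuous (flux^~ t)}.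
Proof.
move=> l0; have e1 := dr t l0; have e2 := ds t l0.
have e3 := dBB l t; have e4 := cD_neg (dCC (- l) t).
have D := cD_add (cD_mul e3 e1) (cD_opp (cD_mul e4 e2)).
exact: rD_continuous D.1.
Qed.

Lemma zs_logT_continuous (l t : R) : 0 <= l -> {for l, continuous (zs_logT^~ t)}.
Proof.
move=> l0; have [e1 _ _] := dTl l t; have n0 := nsq_gt0 (F0 t l0).
have h := @rD_ln R (fun l => nsq (T11 l t)) l _ n0 (cD_nsq e1).
have D := rD_sub (rD_mul h (rD_cst 2^-1 l)) (rD_mul (rD_cst kap l) (rD_id l)).
exact: rD_continuous D.
Qed.

End Flux.

(** * Conservation of the transmission coefficient *)

Section SegmentIntegral.
Context {R : realType}.
Local Notation mu := (@lebesgue_measure R).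

Lemma within_of_for (a b : R) (f : R -> R) :
  (forall x, a <= x <= b -> {for x, continuous f}) -> {within `[a, b], continuous f}.
Proof.
move=> h; apply: continuous_in_subspaceT => x; rewrite inE /= in_itv /= => xab.
exact: h.
Qed.

Lemma integral_segment (a b : R) (f F : R -> R) : a < b ->
  (forall x, a <= x <= b -> is_derive x (1:R) F (f x)) ->
  (forall x, a <= x <= b -> {for x, continuous f}) ->
  (\int[mu]_(x in `[a, b]) (f x)%:E)%E = (F b - F a)%:E.
Proof.
move=> ab dF cf.
rewrite (@continuous_FTC2 R f F a b ab) ?EFinB//.
- exact: within_of_for.
- have cF x : a <= x <= b -> F z @[z --> x] --> F x.
    by move=> xab; have := rD_continuous (dF x xab).
  split.
  + move=> x; rewrite in_itv /= => /andP[ax xb].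
    by have [] := dF x _; rewrite ?(ltW ax) ?(ltW xb).
  + by apply: cvg_at_right_filter; apply: cF; rewrite lexx ltW.
  + by apply: cvg_at_left_filter; apply: cF; rewrite lexx ltW.
- move=> x; rewrite in_itv /= => /andP[ax xb].
  have xab : a <= x <= b by rewrite (ltW ax) (ltW xb).
  by have [d e] := dF x xab; rewrite derive1E e.
Qed.

Lemma segment_integrable (a b : R) (f : R -> R) :
  (forall x, a <= x <= b -> {for x, continuous f}) ->
  mu.-integrable `[a, b] (EFin \o f).
Proof.
move=> cf; apply: continuous_compact_integrable; first exact: segment_compact.
exact: within_of_for.
Qed.

Lemma segment_primitive (a b : R) (f : R -> R) : a <= b ->
  (forall x, a <= x <= b -> {for x, continuous f}) ->
  exists F, forall x, a <= x <= b -> is_derive x (1:R) F (f x).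
Proof.
move=> ab cf.
have cmm : continuous (fun x : R => Num.max (Num.min x b) a).
  move=> x; apply: (@continuous_max R R (fun x => Num.min x b) (fun=> a)) => //; last exact: cst_continuous.
  by apply: (@continuous_min R R (fun x => x) (fun=> b)) => //; last exact: cst_continuous.
have cg : continuous (fun x => f (Num.max (Num.min x b) a)).
  move=> x; apply: (@continuous_comp _ _ _ (fun x => Num.max (Num.min x b) a) f).
    exact: cmm.
  by apply: cf; rewrite le_max lexx orbT /= ge_max ab andbT ge_min lexx orbT.
have [F [_ dF]] := continuous_primitive cg.
exists F => x /andP[ax xb]; apply: (rD_eq (dF x)).
by rewrite min_l// max_l.
Qed.

Lemma Rintegral_segment (a b : R) (f F : R -> R) : a < b ->
  (forall x, a <= x <= b -> is_derive x (1:R) F (f x)) ->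
  (forall x, a <= x <= b -> {for x, continuous f}) ->
  (\int[mu]_(x in `[a, b]) (f x))%R = F b - F a.
Proof. by move=> ab dF cf; rewrite /Rintegral (integral_segment ab dF cf). Qed.
End SegmentIntegral.

Section Average.
Context {R : realType}.
Local Notation mu := (@lebesgue_measure R).
Local Notation C := R[i].
Variables (q qt qx qxx : R -> R -> C).
Hypothesis fl : nls_flow q qt qx qxx.
Variable kap : R.
Hypothesis kap0 : 0 < kap.
Variables a b c d : R -> R -> C.
Hypothesis abcd : forall t,
  [/\ zs_column (kap / 2) (q^~ t) (a^~ t) (c^~ t), zs_column (kap / 2) (q^~ t) (b^~ t) (d^~ t) &
   [/\ a 0 t = 1, c 0 t = 0, b 0 t = 0 & d 0 t = 1]].
Variables (t1 t2 M : R).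
Hypotheses (t12 : t1 <= t2) (M0 : 0 <= M).
Hypothesis mass_le : forall t, t1 <= t <= t2 -> forall (P : R -> R) x y,
  (forall z, is_derive z (1:R) P (nsq (q z t))) -> x <= y -> P y - P x <= M.

Local Notation lam := (zs_logT kap a b c d).
Local Notation fx := (flux q qx kap a b c d).

Section FixedN.
Variable n : R.
Hypothesis n1 : 1 <= n.
Let n0 : 0 < n. Proof. by apply: lt_le_trans n1. Qed.
(** The window [[L, 2 L]] has length [n^2], and [n] is the weight in Young's inequality. The
    terms [n M / L] and [1 / n] of the averaged flux are then both of order [1 / n]. *)
Let L := n ^+ 2.
Let L0 : 0 < L. Proof. by rewrite exprn_gt0. Qed.
Let LL : L < 2 * L. Proof. by move: L0; lra. Qed.

(** An averaging density. It vanishes at both ends of the window, so that the integration by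
    parts in [dflux_bound] has no boundary term. *)
Definition bump (x : R) : R := 6 * ((x - L) * (2 * L - x)) / L ^+ 3.

Lemma bump_ge0 x : L <= x <= 2 * L -> 0 <= bump x.
Proof.
move=> /andP[h1 h2]; rewrite /bump; apply: divr_ge0; last by rewrite exprn_ge0// ltW.
by rewrite mulr_ge0// mulr_ge0//; lra.
Qed.

Lemma bump_le x : bump x <= 3 / (2 * L).
Proof.
rewrite /bump ler_pdivrMr ?exprn_gt0//.
have -> : 3 / (2 * L) * L ^+ 3 = 3 / 2 * L ^+ 2 by field; exact: lt0r_neq0.
have := sqr_ge0 (x - 3 / 2 * L); lra.
Qed.

Lemma dbump x : is_derive x (1:R) bump (6 * (3 * L - 2 * x) / L ^+ 3).
Proof. by rewrite /bump; eapply rD_eq; [rD|ring]. Qed.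

Lemma dbump_le x : L <= x <= 2 * L -> `|6 * (3 * L - 2 * x) / L ^+ 3| <= 6 / L ^+ 2.
Proof.
move=> /andP[h1 h2].
have L3 : 0 < L ^+ 3 by rewrite exprn_gt0.
have h : `|3 * L - 2 * x| <= L by rewrite ler_norml; apply/andP; split; lra.
rewrite normrM normfV (gtr0_norm L3) ler_pdivrMr// normrM ger0_norm//.
have -> : 6 / L ^+ 2 * L ^+ 3 = 6 * L by field; exact: lt0r_neq0.
by rewrite ler_pM2l.
Qed.

Lemma bump_cont x : {for x, continuous bump}.
Proof. exact: rD_continuous (dbump x). Qed.

Definition avg_log (t : R) : R := (\int[mu]_(x in `[L, (2 * L)%R]) (bump x * lam x t))%R.
Let dflux (t : R) : R := (\int[mu]_(x in `[L, (2 * L)%R]) (bump x * fx x t))%R.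

Let pos x : L <= x <= 2 * L -> 0 <= x.
Proof. by move=> /andP[+ _]; apply: le_trans; exact: ltW. Qed.

Let c_lam (t x : R) : L <= x <= 2 * L -> {for x, continuous (fun x => bump x * lam x t)}.
Proof.
move=> xL; apply: (@continuousM R R); first exact: bump_cont.
exact: (zs_logT_continuous kap0 abcd (pos xL)).
Qed.

Let c_flux (t x : R) : L <= x <= 2 * L -> {for x, continuous (fun x => bump x * fx x t)}.
Proof.
move=> xL; apply: (@continuousM R R); first exact: bump_cont.
exact: (flux_continuous fl kap0 abcd (pos xL)).
Qed.

(** Differentiation under the integral: the flux is bounded for [x] in the window and times
    near [t]. *)
Lemma d_avg_log t : is_derive t (1:R) avg_log (dflux t).
Proof.
have [cq1 cq2] := flow_c fl; have [cx1 cx2] := flow_cx fl.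
have bd2 (u : R -> R -> C) : continuous2 u -> exists2 B : R, 0 <= B & forall x s,
    `|x| <= 2 * L -> t - 1 <= s <= t + 1 -> nsq (u x s) <= B.
  move=> [h1 h2]; have [B1 B10 hB1] := @bounded_rectangle R (fun x s => complex.Re (u x s)) (2 * L) (t - 1) (t + 1) h1.
  have [B2 B20 hB2] := @bounded_rectangle R (fun x s => complex.Im (u x s)) (2 * L) (t - 1) (t + 1) h2.
  exists (B1 ^+ 2 + B2 ^+ 2); first by rewrite addr_ge0 ?sqr_ge0.
  move=> x s xL st; rewrite /nsq -[complex.Re _ ^+ 2]real_normK ?num_real// -[complex.Im _ ^+ 2]real_normK ?num_real//.
  by rewrite lerD// ler_sqr ?nnegrE ?normr_ge0//; [exact: hB1|exact: hB2].
have [Bq Bq0 hBq] := bd2 _ (flow_c fl); have [Bx Bx0 hBx] := bd2 _ (flow_cx fl).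
pose K := 3 / (2 * L) * (1 + 2 * kap ^+ 2 * Bq + 2 * Bx).
have mB : measurable (`[L, (2 * L)%R]%classic : set (measurableTypeR R)) by exact: measurable_itv.
pose f (s : R) (x : measurableTypeR R) : R := bump x * lam x s.
have Ia : `]t - 1, t + 1[%classic t by rewrite /= in_itv /=; apply/andP; split; lra.
have intf s : `]t - 1, t + 1[%classic s -> mu.-integrable `[L, (2 * L)%R] (EFin \o f s).
  by move=> _; apply: segment_integrable => x xL; exact: c_lam.
have df s (x : measurableTypeR R) : `[L, (2 * L)%R]%classic x -> is_derive s (1:R) (f ^~ x) (bump x * fx x s).
  rewrite /= in_itv /= => xL; have h := d_zs_logT fl kap0 abcd s (pos xL).
  by rewrite /f; eapply rD_eq; [rD|rewrite mul0r add0r].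
have derf s (x : measurableTypeR R) : `]t - 1, t + 1[%classic s -> `[L, (2 * L)%R]%classic x ->
    derivable (f ^~ x) s 1.
  by move=> _ xL; have [] := df s x xL.
have pE s (x : measurableTypeR R) : `[L, (2 * L)%R]%classic x -> partial1of2 f s x = bump x * fx x s.
  by move=> xL; have [_ e] := df s x xL; rewrite partial1of2E.
have a0 : 0 <= 3 / (2 * L) by rewrite divr_ge0// mulr_ge0// ltW.
have b0 : 0 <= 1 + 2 * kap ^+ 2 * Bq + 2 * Bx.
  have : 0 <= kap ^+ 2 * Bq by rewrite mulr_ge0 ?sqr_ge0.
  by move: Bx0; lra.
have K0 : 0 <= K by exact: mulr_ge0.
have G_ub s (x : measurableTypeR R) : `]t - 1, t + 1[%classic s -> `[L, (2 * L)%R]%classic x ->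
    `|partial1of2 f s x| <= K.
  move=> hs xL; rewrite pE//; move: hs xL; rewrite /= !in_itv /= => /andP[s1 s2] xL.
  rewrite normrM ger0_norm ?bump_ge0//; apply: ler_pM; rewrite ?bump_ge0//; first exact: bump_le.
  have /andP[x1 x2] := xL; have x0 := pos xL.
  have st : t - 1 <= s <= t + 1 by rewrite !ltW.
  by apply: (flux_bound kap0 abcd x0 Bq0 Bx0); [apply: hBq|apply: hBq|apply: hBx|apply: hBx] => //;
    rewrite ?normrN ger0_norm.
have intG : mu.-integrable `[L, (2 * L)%R] (EFin \o (fun=> K)).
  by apply: segment_integrable => x _; exact: cst_continuous.
have D := @differentiation_under_integral R _ (measurableTypeR R) mu f _ mB t _ _ Ia intf derf (fun=> K) (fun=> K0) intG G_ub.
have D' := @derivable_under_integral R _ (measurableTypeR R) mu f _ mB t _ _ Ia intf derf (fun=> K) (fun=> K0) intG G_ub.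
split; first exact: D'.
rewrite -derive1E [LHS]D /dflux; apply: eq_Rintegral => x; rewrite inE => xL.
exact: pE.
Qed.

Let Cst := 6 * (M + 1) + 3 * ((kap + 1) * M + kap).

(** Integration by parts moves the derivative from [flux_pot] to [bump]; what remains is
    bounded by the mass. *)
Lemma dflux_bound (t : R) : t1 <= t <= t2 -> `|dflux t| <= Cst / n.
Proof.
move=> tt.
have [I dI] := segment_primitive (ltW LL) (@c_flux t).
rewrite /dflux (Rintegral_segment LL dI (@c_flux t)).
have cq : continuous (fun z => nsq (q z t)).
  move=> z; apply: (@rD_continuous R _ z); exact: cD_nsq (flow_x fl z t).
have [P [_ dP]] := continuous_primitive cq.
have dPN x : is_derive x (1:R) (fun z => P (- z)) (- nsq (q (- x) t)).
  have hn : is_derive x (1:R) (fun z : R => - z) (-1) by exact: rD_opp (rD_id x).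
  by apply: (rD_eq (rD_comp (dP (- x)) hn)); rewrite mulrN1.
pose pot := flux_pot q a b c d.
pose E x := 6 / L ^+ 2 * (n * (P x - P (- x)) / 2 + x / n)
   + 3 / (2 * L) * ((kap * n + 1) * (P x - P (- x)) + 2 * kap / n * x).
pose dE x := 6 / L ^+ 2 * (n * (nsq (q x t) + nsq (q (- x) t)) / 2 + n^-1)
   + 3 / (2 * L) * ((kap * n + 1) * (nsq (q x t) + nsq (q (- x) t)) + 2 * kap / n).
have hE x : L <= x <= 2 * L -> is_derive x (1:R) E (dE x).
  move=> _; have h1 := dP x; have h2 := dPN x; rewrite /E /dE.
  by eapply rD_eq; [rD|ring].
have hI x : L <= x <= 2 * L -> is_derive x (1:R) (fun x => I x - bump x * pot x t)
   (bump x * flux_rest q kap a b c d x t - 6 * (3 * L - 2 * x) / L ^+ 3 * pot x t).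
  move=> xL; have h1 := dI x xL; have h2 := dbump x; have h3 := d_flux_pot fl kap0 abcd t (pos xL).
  by eapply rD_eq; [rD|rewrite /pot; ring].
have := norm_le_of_derive (ltW LL) hI hE.
have bL : bump L = 0 by rewrite /bump subrr mul0r mulr0 mul0r.
have b2L : bump (2 * L) = 0 by rewrite /bump subrr !mulr0 mul0r.
rewrite bL b2L !mul0r !subr0 => h.
have {h}h : `|I (2 * L) - I L| <= E (2 * L) - E L.
  apply: h => x xL; apply: le_trans (ler_normB _ _) _; rewrite addrC /dE; apply: lerD.
    rewrite normrM; apply: ler_pM; rewrite ?normr_ge0//; first exact: dbump_le.
    exact: (flux_pot_bound kap0 abcd t n0 (pos xL)).
  rewrite normrM; apply: ler_pM; rewrite ?normr_ge0//.
    by rewrite ger0_norm ?bump_ge0//; exact: bump_le.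
  exact: (flux_rest_bound kap0 abcd t n0 (pos xL)).
apply: le_trans h _.
have m1 := mass_le tt dP (ltW LL).
have m2 : P (- L) - P (- (2 * L)) <= M by apply: (mass_le tt dP); move: LL; lra.
pose D := (P (2 * L) - P L) + (P (- L) - P (- (2 * L))).
have D2 : D <= 2 * M by rewrite /D; lra.
have -> : E (2 * L) - E L = 6 / L ^+ 2 * (n * D / 2 + L / n) + 3 / (2 * L) * ((kap * n + 1) * D + 2 * kap / n * L).
  by rewrite /E /D; ring.
have g1 : 6 / L ^+ 2 * (n * D / 2 + L / n) <= 6 / L ^+ 2 * (n * M + L / n).
  rewrite ler_pM2l ?divr_gt0 ?exprn_gt0// lerD2r.
  by have := ler_wpM2l (ltW n0) D2; lra.
have g2 : 3 / (2 * L) * ((kap * n + 1) * D + 2 * kap / n * L) <=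
   3 / (2 * L) * ((kap * n + 1) * (2 * M) + 2 * kap / n * L).
  rewrite ler_pM2l ?divr_gt0 ?mulr_gt0// lerD2r ler_wpM2l//.
  by rewrite addr_ge0// mulr_ge0 ?ltW.
apply: le_trans (lerD g1 g2) _.
rewrite ler_pdivlMr//.
have -> : (6 / L ^+ 2 * (n * M + L / n) + 3 / (2 * L) * ((kap * n + 1) * (2 * M) + 2 * kap / n * L)) * n =
   6 * (M / n ^+ 2 + 1 / n ^+ 2) + 3 * ((kap + n^-1) * M + kap).
  by rewrite /L; field; exact: lt0r_neq0.
have i1 : n^-1 <= 1 by rewrite invf_le1.
have i2 : (n ^+ 2)^-1 <= 1 by rewrite invf_le1 ?exprn_gt0// exprn_ege1.
have j1 : M / n ^+ 2 <= M by rewrite ler_piMr.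
have j2 : (kap + n^-1) * M <= (kap + 1) * M by rewrite ler_wpM2r// lerD2l.
by rewrite /Cst; lra.
Qed.

Lemma avg_log_var : `|avg_log t2 - avg_log t1| <= Cst / n * (t2 - t1).
Proof.
have h := @norm_le_of_derive R avg_log dflux (fun t => Cst / n * t) (fun=> Cst / n) t1 t2 t12
  (fun t _ => d_avg_log t).
rewrite mulrBr; apply: h => t tt; last exact: dflux_bound.
by eapply rD_eq; [rD|ring].
Qed.

Let bumpI x : is_derive x (1:R)
  (fun x => 6 / L ^+ 3 * (3 * L / 2 * x ^+ 2 - 2 * L ^+ 2 * x - x * x ^+ 2 / 3)) (bump x).
Proof. by rewrite /bump; eapply rD_eq; [rD|field; exact: lt0r_neq0]. Qed.

Lemma avg_log_ge (t lo : R) : (forall l, L <= l -> lo <= lam l t) -> lo <= avg_log t.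
Proof.
move=> h; have [I dI] := segment_primitive (ltW LL) (@c_lam t).
rewrite /avg_log (Rintegral_segment LL dI (@c_lam t)).
pose B x := 6 / L ^+ 3 * (3 * L / 2 * x ^+ 2 - 2 * L ^+ 2 * x - x * x ^+ 2 / 3).
have D x : L <= x <= 2 * L -> is_derive x (1:R) (fun x => I x - lo * B x) (bump x * lam x t - lo * bump x).
  move=> xL; have h1 := dI x xL; have h2 := bumpI x.
  by eapply rD_eq; [rD|ring].
have := ler_of_derive (ltW LL) D => h'.
have {h'} : I L - lo * B L <= I (2 * L) - lo * B (2 * L).
  apply: h' => x xL; rewrite -[lo * _]mulrC -mulrBr mulr_ge0 ?bump_ge0// subr_ge0 h//.
  by case/andP: xL.
have : B (2 * L) - B L = 1 by rewrite /B; field; exact: lt0r_neq0.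
move=> e1 e2; have : lo = lo * B (2 * L) - lo * B L by rewrite -mulrBr e1 mulr1.
lra.
Qed.

Lemma avg_log_le (t hi : R) : (forall l, L <= l -> lam l t <= hi) -> avg_log t <= hi.
Proof.
move=> h; have [I dI] := segment_primitive (ltW LL) (@c_lam t).
rewrite /avg_log (Rintegral_segment LL dI (@c_lam t)).
pose B x := 6 / L ^+ 3 * (3 * L / 2 * x ^+ 2 - 2 * L ^+ 2 * x - x * x ^+ 2 / 3).
have D x : L <= x <= 2 * L -> is_derive x (1:R) (fun x => I x - hi * B x) (bump x * lam x t - hi * bump x).
  move=> xL; have h1 := dI x xL; have h2 := bumpI x.
  by eapply rD_eq; [rD|ring].
have := ger_of_derive (ltW LL) D => h'.
have {h'} : I (2 * L) - hi * B (2 * L) <= I L - hi * B L.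
  apply: h' => x xL; rewrite -[hi * _]mulrC -mulrBr mulr_ge0_le0 ?bump_ge0// subr_le0 h//.
  by case/andP: xL.
have : B (2 * L) - B L = 1 by rewrite /B; field; exact: lt0r_neq0.
move=> e1 e2; have : hi = hi * B (2 * L) - hi * B L by rewrite -mulrBr e1 mulr1.
lra.
Qed.
End FixedN.

(** With a bound on the mass, the logarithm of the transfer coefficient is conserved
    in the limit of an infinite window. *)
Theorem zs_logT_conserved (s1 s2 lo hi L0 : R) :
  (s1 = t1 /\ s2 = t2) \/ (s1 = t2 /\ s2 = t1) ->
  (forall l, L0 <= l -> lo <= lam l s1) -> (forall l, L0 <= l -> lam l s2 <= hi) ->
  lo <= hi.
Proof.
move=> ss hlo hhi; rewrite leNgt; apply/negP => hl.
pose Cst := 6 * (M + 1) + 3 * ((kap + 1) * M + kap).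
have C0 : 0 < Cst.
  have : 0 <= (kap + 1) * M by rewrite mulr_ge0// addr_ge0// ltW.
  by move: M0 kap0; rewrite /Cst; lra.
(* The window must start beyond [L0], and the drift [Cst / n * (t2 - t1)] must be less than
   the gap [lo - hi]. *)
pose n := 1 + `|L0| + Cst * (t2 - t1 + 1) / (lo - hi).
have D0 : 0 < lo - hi by rewrite subr_gt0.
have w0 : 0 < Cst * (t2 - t1 + 1) / (lo - hi) by rewrite divr_gt0// mulr_gt0//; move: t12; lra.
have n1 : 1 <= n by rewrite /n; have := normr_ge0 L0; lra.
have nL : L0 <= n ^+ 2.
  have : n <= n ^+ 2 by rewrite expr2 ler_peMl// (le_trans _ n1).
  by apply: le_trans; rewrite /n; have := ler_norm L0; lra.
have n0 : 0 < n by apply: lt_le_trans n1.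
have A1 := avg_log_ge n1 (fun l hl' => hlo l (le_trans nL hl')).
have A2 := avg_log_le n1 (fun l hl' => hhi l (le_trans nL hl')).
have V := avg_log_var n1; rewrite -/Cst in V.
have : Cst / n * (t2 - t1) < lo - hi.
  rewrite mulrAC ltr_pdivrMr// [ltRHS]mulrC -ltr_pdivrMr//.
  apply: (@lt_le_trans _ _ (Cst * (t2 - t1 + 1) / (lo - hi))).
    by rewrite ltr_pM2r ?invr_gt0// ltr_pM2l//; lra.
  by rewrite /n; have := normr_ge0 L0; lra.
move: V; rewrite ler_norml => /andP[V1 V2].
by case: ss => [[e1 e2]|[e1 e2]]; rewrite e1 in A1; rewrite e2 in A2; lra.
Qed.
End Average.

(** * Integrals over the line *)

Section LineIntegral.
Context {R : realType}.
Local Notation mu := (@lebesgue_measure R).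
Implicit Types (f g F : R -> R).

Definition Rint f : Prop := mu.-integrable [set: R] (EFin \o f).
Definition RI f : R := (\int[mu]_x f x)%R.

Lemma cont_meas f : continuous f -> measurable_fun [set: R] f.
Proof. by move=> cf; exact: continuous_measurable_fun. Qed.

Lemma Rint_dom f g : measurable_fun [set: R] f -> Rint g ->
  (forall x, `|f x| <= g x) -> Rint f.
Proof.
move=> mf ig fg; apply: (le_integrable _ _ _ ig) => //.
  exact/measurable_EFinP.
by move=> x _ /=; rewrite lee_fin; apply: le_trans (fg x) (ler_norm _).
Qed.

Lemma RI_ge0 f : (forall x, 0 <= f x) -> 0 <= RI f.
Proof. by move=> f0; exact: Rintegral_ge0. Qed.

Lemma RI_le f g : Rint f -> Rint g -> (forall x, f x <= g x) -> RI f <= RI g.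
Proof. by move=> f1 g1 fg; apply: le_Rintegral => // x _. Qed.

Lemma RID f g : Rint f -> Rint g -> RI (fun x => f x + g x) = RI f + RI g.
Proof. by move=> f1 g1; rewrite /RI RintegralD. Qed.

Lemma RIB f g : Rint f -> Rint g -> RI (fun x => f x - g x) = RI f - RI g.
Proof. by move=> f1 g1; rewrite /RI RintegralB. Qed.

Lemma RIZ (c : R) f : Rint f -> RI (fun x => c * f x) = c * RI f.
Proof. by move=> f1; rewrite /RI RintegralZl. Qed.

Lemma RintD f g : Rint f -> Rint g -> Rint (fun x => f x + g x).
Proof.
move=> f1 g1; rewrite /Rint (_ : EFin \o _ = (EFin \o f) \+ (EFin \o g))%E.
  exact: integrableD.
by apply/funext.
Qed.

Lemma RintB f g : Rint f -> Rint g -> Rint (fun x => f x - g x).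
Proof.
move=> f1 g1; rewrite /Rint (_ : EFin \o _ = (EFin \o f) \- (EFin \o g))%E.
  exact: integrableB.
by apply/funext.
Qed.

Lemma RintZ (c : R) f : Rint f -> Rint (fun x => c * f x).
Proof.
move=> f1; rewrite /Rint (_ : EFin \o _ = (fun x => c%:E * (EFin \o f) x))%E.
  exact: integrableZl.
by apply/funext.
Qed.

Lemma RI_EFin f : Rint f -> (\int[mu]_x (f x)%:E)%E = (RI f)%:E.
Proof. by move=> f1; rewrite /RI /Rintegral fineK// integrable_fin_num. Qed.

Lemma RI_dct (fn : nat -> R -> R) f g :
  (forall n, measurable_fun [set: R] (fn n)) -> measurable_fun [set: R] f ->
  Rint g -> (forall n x, `|fn n x| <= g x) -> (forall x, fn n x @[n --> \oo] --> f x) ->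
  Rint f /\ RI (fn n) @[n --> \oo] --> RI f.
Proof.
move=> mfn mf ig fng fnf.
have h1 n : measurable_fun [set: R] (EFin \o fn n) by exact/measurable_EFinP.
have h2 : measurable_fun [set: R] (EFin \o f) by exact/measurable_EFinP.
have h3 : {ae mu, forall x, [set: R] x -> (fun n => EFin (fn n x)) n @[n --> \oo] --> EFin (f x)}.
  apply: aeW => x _; apply: cvg_EFin; last exact: fnf.
  by apply: nearW.
have h4 : {ae mu, forall x n, [set: R] x -> (`|EFin (fn n x)| <= (g x)%:E)%E}.
  by apply: aeW => x n _; rewrite lee_fin.
have [i1 _ i2] := @dominated_convergence _ _ R mu [set: R] measurableT
   (fun n => EFin \o fn n) (EFin \o f) (EFin \o g) h1 h2 h3 ig h4.
split => //.
have rn n : Rint (fn n) by exact: (Rint_dom (mfn n) ig).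
have fi := @integrable_fin_num _ _ _ mu _ measurableT _ i1.
rewrite /RI /Rintegral; apply: fine_cvg; rewrite fineK//.
Qed.

Lemma cvg_primitive_integral f F : continuous f -> (forall x, 0 <= f x) ->
  (forall x, is_derive x (1:R) F (f x)) ->
  (F n.+1%:R - F (- n.+1%:R))%:E @[n --> \oo] --> (\int[mu]_x (f x)%:E)%E.
Proof.
move=> cf f0 dF.
pose A (n : nat) : set R := `[- n.+1%:R, n.+1%:R]%classic.
have UA : \bigcup_n A n = [set: R].
  rewrite -subTset => x _; exists (Num.truncn `|x|) => //=.
  rewrite /A /= in_itv /= -ler_norml ltW//.
  by have /andP[] := truncn_itv (normr_ge0 x).
have h1 : nondecreasing_seq A.
  apply/nondecreasing_seqP => n; rewrite subsetEset /A => x /=; rewrite !in_itv /=.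
  move=> /andP[h1 h2]; apply/andP; split.
    by apply: le_trans h1; rewrite lerN2 ler_nat.
  by apply: le_trans h2 _; rewrite ler_nat.
have h2 n : measurable (A n : set (measurableTypeR R)) by exact: measurable_itv.
have h3 n : measurable_fun (A n : set (measurableTypeR R)) (EFin \o f).
  by apply/measurable_EFinP; apply: measurable_funTS; exact: cont_meas.
have h4 (n : nat) x : A n x -> (0 <= (EFin \o f) x)%E by move=> _; rewrite lee_fin.
have := @ge0_nondecreasing_set_cvg_integral _ (measurableTypeR R) R A (EFin \o f) mu h1 h2 h3 h4.
have nn (n : nat) : (- n.+1%:R : R) < n.+1%:R by rewrite gtrN// ltr0Sn.
rewrite UA; under eq_fun => n do
  rewrite (integral_segment (nn n) (fun x _ => dF x) (fun x _ => @cf x)).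
by [].
Qed.

Lemma Rint_of_primitive f F (B : R) : continuous f -> (forall x, 0 <= f x) ->
  (forall x, is_derive x (1:R) F (f x)) ->
  (forall n : nat, F n.+1%:R - F (- n.+1%:R) <= B) -> Rint f.
Proof.
move=> cf f0 dF hB; apply/integrableP; split.
  by apply/measurable_EFinP; exact: cont_meas.
have h := cvg_primitive_integral cf f0 dF.
have : (\int[mu]_x (f x)%:E <= B%:E)%E.
  rewrite -(cvg_lim _ h)//; apply: lime_le; first exact: (cvgP _ h).
  by apply: nearW => n; rewrite lee_fin.
have -> : (\int[mu]_x `|(EFin \o f) x|)%E = (\int[mu]_x (f x)%:E)%E.
  by apply: eq_integral => x _; rewrite /= ger0_norm.
by move=> /le_lt_trans; apply; rewrite ltry.
Qed.

Lemma improper_FTC f F (a b : R) : continuous f -> Rint f ->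
  (forall x, is_derive x (1:R) F (f x)) ->
  F n.+1%:R @[n --> \oo] --> b -> F (- n.+1%:R) @[n --> \oo] --> a ->
  RI f = b - a.
Proof.
move=> cf intf dF Fb Fa.
pose A (n : nat) : set R := `[- n.+1%:R, n.+1%:R]%classic.
pose fn n := f \_ (A n).
have mA n : measurable (A n) by exact: measurable_itv.
have E n : RI (fn n) = F n.+1%:R - F (- n.+1%:R).
  have nn : (- n.+1%:R : R) < n.+1%:R by rewrite gtrN// ltr0Sn.
  rewrite /RI /fn -Rintegral_mkcond.
  exact: (Rintegral_segment nn (fun x _ => dF x) (fun x _ => @cf x)).
have mf := cont_meas cf.
have mfn n : measurable_fun [set: R] (fn n).
  by apply/(measurable_restrictT f (mA n)); exact: measurable_funTS.
have ig : Rint (fun x => `|f x|).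
  exact: (integrable_norm intf).
have dom n x : `|fn n x| <= `|f x|.
  by rewrite /fn patchE; case: ifP => //; rewrite normr0.
have lim x : fn n x @[n --> \oo] --> f x.
  apply: cvg_near_cst; exists (Num.truncn `|x|) => // n /= hn.
  rewrite /fn patchE mem_set// /A /= in_itv /= -ler_norml.
  have /andP[_ /ltW h] := truncn_itv (normr_ge0 x).
  by apply: le_trans h _; rewrite ler_nat.
have [_ h1] := RI_dct mfn mf ig dom lim.
have h2 : RI (fn n) @[n --> \oo] --> b - a.
  by under eq_fun do rewrite E; apply: cvgB.
exact: (cvg_unique _ h1 h2).
Qed.

Definition wt (x : R) : R := (1 + x ^+ 2)^-1.

Lemma wt_den (x : R) : 0 < 1 + x ^+ 2.
Proof. by rewrite ltr_pwDl// sqr_ge0. Qed.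
Lemma wt_gt0 x : 0 < wt x. Proof. by rewrite invr_gt0 wt_den. Qed.
Lemma wt_le1 x : wt x <= 1.
Proof. by rewrite invf_le1 ?wt_den// lerDl sqr_ge0. Qed.
Lemma dwt x : is_derive x (1:R) wt (- (2 * x) * wt x ^+ 2).
Proof.
have d : is_derive x (1:R) (fun x : R => 1 + x ^+ 2) (2 * x).
  by eapply rD_eq; [rD|ring].
apply: (rD_eq (@rD_inv R (fun x : R => 1 + x ^+ 2) x _ (lt0r_neq0 (wt_den x)) d)).
by rewrite /wt exprVn.
Qed.
Lemma cwt : continuous wt. Proof. by move=> x; apply: rD_continuous (dwt x). Qed.

Lemma Rint_wt : Rint wt.
Proof.
apply: (@Rint_of_primitive wt (@atan R) pi) => //; first exact: cwt.
  by move=> x; exact: ltW (wt_gt0 x).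
  move=> n; have := atan_gtNpi2 (- n.+1%:R : R); have := @atan_ltpi2 R n.+1%:R; lra.
Qed.

Lemma RI_wt : RI wt = pi.
Proof.
have -> : (pi : R) = pi / 2 - (- (pi / 2)) by field.
have toy : (n.+1%:R : R) @[n --> \oo] --> +oo%R.
  have := @cvgr_idn R; rewrite -cvg_shiftS; exact.
have h : atan (n.+1%:R : R) @[n --> \oo] --> pi / 2.
  by apply: (cvg_comp _ _ toy (@cvgy_atan R)).
apply: (improper_FTC cwt Rint_wt (F := @atan R)) => //.
by under eq_fun do rewrite atanN; exact: cvgN.
Qed.

Lemma wt_lim (K : R) : K * wt n.+1%:R @[n --> \oo] --> 0.
Proof.
rewrite -(mulr0 K); apply: cvgMr.
apply: (@squeeze_cvgr _ _ _ _ (fun=> 0) (fun n => n.+1%:R^-1)).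
- apply: nearW => n; rewrite ltW ?wt_gt0//= lef_pV2 ?posrE ?wt_den ?ltr0Sn//.
  apply: (@le_trans _ _ (n.+1%:R ^+ 2)); last by rewrite lerDr.
  by rewrite expr2 ler_peMr// ler1n.
- exact: cvg_cst.
- exact: cvg_harmonic.
Qed.

End LineIntegral.

(** * Comparison of energies at two times *)

Section Decay.
Context {R : realType}.
Local Notation C := R[i].
Local Notation Re := (@complex.Re R).
Local Notation Im := (@complex.Im R).

(** Of the Schwartz class only continuity and quadratic decay are used. *)
Definition decaying (f : R -> C) : Prop := ccont f /\
  exists2 K : R, 0 <= K & forall x, `|Re (f x)| <= K * wt x /\ `|Im (f x)| <= K * wt x.

Definition mass (f : R -> C) : R := RI (fun x => nsq (f x)).

Lemma cont_nsq (f : R -> C) : ccont f -> continuous (fun x => nsq (f x)).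
Proof.
move=> [c1 c2] x; rewrite /nsq (_ : (fun x => _) =
  (fun x => Re (f x) * Re (f x) + Im (f x) * Im (f x))); last first.
  by apply/funext => y; rewrite !expr2.
by apply: cvgD; apply: cvgM; [exact: c1|exact: c1|exact: c2|exact: c2].
Qed.

Lemma nsq_le_norm (z : C) (b : R) : `|Re z| <= b -> `|Im z| <= b -> nsq z <= 2 * b ^+ 2.
Proof.
move=> h1 h2; have b0 : 0 <= b by apply: le_trans h1.
rewrite /nsq -[Re _ ^+ 2]real_normK ?num_real// -[Im _ ^+ 2]real_normK ?num_real//.
have h3 : `|Re z| ^+ 2 <= b ^+ 2 by rewrite ler_sqr.
have h4 : `|Im z| ^+ 2 <= b ^+ 2 by rewrite ler_sqr.
lra.
Qed.

Lemma decaying_nsq (f : R -> C) : decaying f ->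
  exists2 K : R, 0 <= K & forall x, nsq (f x) <= K * wt x.
Proof.
move=> [_ [K K0 h]]; exists (2 * K ^+ 2); first by rewrite mulr_ge0// sqr_ge0.
move=> x; have [h1 h2] := h x; apply: le_trans (nsq_le_norm h1 h2) _.
rewrite exprMn mulrA ler_wpM2l ?mulr_ge0 ?sqr_ge0//.
by rewrite expr2 ler_piMl ?wt_le1// ltW// wt_gt0.
Qed.

Lemma Rint_nsq (f : R -> C) : decaying f -> Rint (fun x => nsq (f x)).
Proof.
move=> fn; have [K K0 hK] := decaying_nsq fn.
apply: (Rint_dom _ (RintZ K Rint_wt)); first by apply: cont_meas; apply: cont_nsq; case: fn.
by move=> x; rewrite ger0_norm ?nsq_ge0.
Qed.

Lemma mass_primitive (f : R -> C) (P : R -> R) : decaying f ->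
  (forall x, is_derive x (1:R) P (nsq (f x))) ->
  (forall x y, x <= y -> P x <= P y) /\
  P n.+1%:R - P (- n.+1%:R) @[n --> \oo] --> mass f.
Proof.
move=> fn dP; split.
  by move=> x y xy; apply: (ler_of_derive xy (fun z _ => dP z)) => z _; exact: nsq_ge0.
have h := cvg_primitive_integral (cont_nsq fn.1) (fun x => nsq_ge0 (f x)) dP.
rewrite (RI_EFin (Rint_nsq fn)) in h.
exact: (fine_cvg h).
Qed.

Lemma mass_primitive_le (f : R -> C) (P : R -> R) : decaying f ->
  (forall x, is_derive x (1:R) P (nsq (f x))) ->
  forall x y, P y - P x <= mass f.
Proof.
move=> fn dP x y; have [mono lim] := mass_primitive fn dP.
rewrite -(cvg_lim _ lim)//; apply: limr_ge; first exact: (cvgP _ lim).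
exists (Num.truncn (`|x| + `|y|)) => // n /= hn.
have /andP[_ h] := truncn_itv (addr_ge0 (normr_ge0 x) (normr_ge0 y)).
have h2 : (Num.truncn (`|x| + `|y|)).+1%:R <= n.+1%:R :> R by rewrite ler_nat.
have h3 : P y <= P n.+1%:R.
  by apply: mono; have := ler_norm y; have := normr_ge0 x; lra.
have h4 : P (- n.+1%:R) <= P x.
  by apply: mono; have := ler_norm (- x); rewrite normrN; have := normr_ge0 y; lra.
lra.
Qed.

Lemma mass_primitive_near (f : R -> C) (P : R -> R) (e : R) : decaying f -> 0 < e ->
  (forall x, is_derive x (1:R) P (nsq (f x))) ->
  exists L, forall l, L <= l -> mass f - e <= P l - P (- l).
Proof.
move=> fn e0 dP; have [mono lim] := mass_primitive fn dP.
have /(@cvgrPdist_le _ R^o) /(_ _ e0) [n _ h] := lim.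
exists n.+1%:R => l nl; have := h n (leqnn n) => /=; rewrite ler_norml => /andP[h1 h2].
have h3 : P n.+1%:R <= P l by exact: mono.
have h4 : P (- l) <= P (- n.+1%:R) by apply: mono; rewrite lerN2.
lra.
Qed.

Lemma decaying_tail (f : R -> C) (e : R) : decaying f -> 0 < e ->
  exists2 L, 0 <= L & forall x, L <= `|x| -> nsq (f x) <= e.
Proof.
move=> fn e0; have [K K0 hK] := decaying_nsq fn.
exists (K / e + 1); first by rewrite addr_ge0// divr_ge0// ltW.
move=> x xL; apply: le_trans (hK x) _; rewrite /wt ler_pdivrMr ?wt_den//.
have x1 : 1 <= `|x| by apply: le_trans xL; rewrite lerDr divr_ge0// ltW.
have : `|x| <= x ^+ 2 by rewrite -real_normK ?num_real// expr2 ler_peMl.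
have : K / e <= `|x| by apply: le_trans xL; rewrite lerDl.
rewrite ler_pdivrMr// mulrC => h1 h2.
by apply: (le_trans h1); rewrite ler_pM2l//; lra.
Qed.

(** The function [exp (kap x) w] is the primitive [G - c] of [exp (kap x) g] that vanishes at
    minus infinity. The barrier [H = K exp (kap x) wt] grows faster than [G] since
    [2 <= kap], so [c] is the infimum of [G + H]. *)
Lemma real_resolvent (g : R -> R) (kap K : R) : continuous g -> 2 <= kap -> 0 <= K ->
  (forall x, `|g x| <= K * wt x) ->
  exists w : R -> R, (forall x, is_derive x (1:R) w (g x - kap * w x)) /\
    forall x, `|w x| <= K * wt x.
Proof.
move=> cg k2 K0 hg.
have cG : continuous (fun x => expR (kap * x) * g x).
  move=> x; apply: cvgM; last exact: cg.
  have h : is_derive x (1:R) (fun x => expR (kap * x)) (expR (kap * x) * kap).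
    by eapply rD_eq; [rD|ring].
  exact: (rD_continuous h).
have [G [_ dG]] := continuous_primitive cG.
pose H x := K * (expR (kap * x) * wt x).
have dH x : is_derive x (1:R) H (K * (expR (kap * x) * (wt x * (kap - 2 * x * wt x)))).
  by have h := dwt x; rewrite /H; eapply rD_eq; [rD|ring].
have dGH x : `|expR (kap * x) * g x| <= K * (expR (kap * x) * (wt x * (kap - 2 * x * wt x))).
  rewrite normrM ger0_norm ?expR_ge0// mulrCA ler_pM2l ?expR_gt0//.
  apply: le_trans (hg x) _; rewrite ler_wpM2l// ler_peMr ?(ltW (wt_gt0 x))//.
  suff : 2 * x * wt x <= 1 by lra.
  rewrite /wt ler_pdivrMr ?wt_den// mul1r.
  by have := sqr_ge0 (x - 1); lra.
have mono x y : x <= y -> G x + H x <= G y + H y /\ G y - H y <= G x - H x.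
  move=> xy; have := norm_le_of_derive xy (fun z _ => dG z) (fun z _ => dH z) (fun z _ => dGH z).
  by rewrite ler_norml => /andP[h1 h2]; split; lra.
have H0 x : 0 <= H x by rewrite mulr_ge0// mulr_ge0 ?expR_ge0// ltW// wt_gt0.
pose c := inf (range (fun x => G x + H x)).
have lb x : lbound (range (fun x => G x + H x)) (G x - H x).
  move=> _ [y _ <-]; have [xy|/ltW yx] := leP x y.
    by have [h1 _] := mono _ _ xy; have := H0 x; lra.
  by have [_ h1] := mono _ _ yx; have := H0 y; lra.
have cG1 x : `|G x - c| <= H x.
  rewrite ler_norml; apply/andP; split.
    have : c <= G x + H x by apply: ge_inf; [exists (G 0 - H 0); exact: lb|exists x].
    lra.
  have : G x - H x <= c by apply: lb_le_inf; [exists (G 0 + H 0); exists 0|exact: lb].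
  lra.
exists (fun x => expR (- (kap * x)) * (G x - c)); split => x.
  have h := dG x; eapply rD_eq; first by rD.
  have : expR (- (kap * x)) * expR (kap * x) = 1 by rewrite -expRD addNr expR0.
  move: (expR (- (kap * x))) (expR (kap * x)) => u v uv.
  by ring: uv.
rewrite normrM ger0_norm ?expR_ge0//.
have -> : K * wt x = expR (- (kap * x)) * H x.
  rewrite /H [RHS]mulrCA [expR (- _) * _]mulrA -expRD addNr expR0 mul1r //.
by rewrite ler_pM2l ?expR_gt0.
Qed.

(** The operator inverting [d/dx + kap]. *)
Lemma resolvent (f : R -> C) (kap : R) : 2 <= kap -> decaying f ->
  exists2 w, decaying w & forall x, cD w x (f x - kap%:C * w x).
Proof.
move=> k2 [[c1 c2] [K K0 hK]].
have [w1 [d1 b1]] := real_resolvent c1 k2 K0 (fun x => (hK x).1).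
have [w2 [d2 b2]] := real_resolvent c2 k2 K0 (fun x => (hK x).2).
have D x : cD (fun x => w1 x +i* w2 x) x (f x - kap%:C * (w1 x +i* w2 x)).
  split; rewrite !cE /=.
    by apply: (rD_eq (d1 x)); ring.
  by apply: (rD_eq (d2 x)); ring.
exists (fun x => w1 x +i* w2 x) => //; split; first exact: cD_ccont D.
by exists K => // x; split; [exact: b1|exact: b2].
Qed.

Section Compare.
Variables (q qt qx qxx : R -> R -> C).
Hypothesis fl : nls_flow q qt qx qxx.
Hypothesis decayingq : forall t, decaying (q^~ t).
Variables (kap m t1 t2 : R).
Hypotheses (k2 : 2 <= kap) (m0 : 0 < m) (mkap : 8 * m <= kap) (t12 : t1 <= t2).
Hypothesis mass_le : forall t, t1 <= t <= t2 -> mass (q^~ t) <= m.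
Let th := 2 * m / kap.

(** The window is taken so wide that the boundary terms of [zs_log_estimate] are below
    [e1]; then [zs_logT_conserved] compares the two times. *)
Theorem resolvent_mass_compare (s1 s2 : R) (w1 w2 : R -> C) :
  (s1 = t1 /\ s2 = t2) \/ (s1 = t2 /\ s2 = t1) ->
  decaying w1 -> (forall x, cD w1 x (q x s1 - kap%:C * w1 x)) ->
  decaying w2 -> (forall x, cD w2 x (q x s2 - kap%:C * w2 x)) ->
  (1 - 2 * th) * mass w1 <= (1 + 3 * th) * ((1 + th) * mass w2).
Proof.
move=> ss nw1 dw1 nw2 dw2.
have k0 : 0 < kap by apply: lt_le_trans k2.
have th0 : 0 < th by rewrite divr_gt0// mulr_gt0.
have th1 : th <= 1 / 4 by rewrite /th ler_pdivrMr//; move: mkap; lra.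
have [a [b [c [d abcd]]]] := fundamental_exists fl kap.
have prim t : exists P : R -> R, forall x, is_derive x (1:R) P (nsq (q x t)).
  by have [P [_ dP]] := continuous_primitive (cont_nsq (decayingq t).1); exists P.
have ml t : t1 <= t <= t2 -> forall (P : R -> R) x y,
   (forall z, is_derive z (1:R) P (nsq (q z t))) -> x <= y -> P y - P x <= m.
  by move=> tt P x y dP _; apply: le_trans (mass_primitive_le (decayingq t) dP _ _) (mass_le tt).
have C := zs_logT_conserved fl k0 abcd t12 (ltW m0) ml.
have s1t : t1 <= s1 <= t2 by case: ss => [[-> _]|[-> _]]; rewrite lexx t12.
have s2t : t1 <= s2 <= t2 by case: ss => [[_ ->]|[_ ->]]; rewrite lexx t12.
have [P1 dP1] := prim s1; have [P2 dP2] := prim s2.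
have [W1 [_ dW1]] := continuous_primitive (cont_nsq nw1.1).
have [W2 [_ dW2]] := continuous_primitive (cont_nsq nw2.1).
apply/ler_addgt0Pr => e e0.
pose e1 := e * kap / (32 * (kap + (1 + th^-1) + 1 + (1 + kap ^- 2))).
have D0 : 0 < kap + (1 + th^-1) + 1 + (1 + kap ^- 2).
  by rewrite !addr_gt0// ?invr_gt0// exprn_gt0.
have e10 : 0 < e1 by rewrite divr_gt0 ?mulr_gt0.
have [L1 hL1] := mass_primitive_near nw1 e10 dW1.
have [L2 L20 hL2] := decaying_tail nw1 e10.
have [L3 L30 hL3] := decaying_tail nw2 e10.
have [L4 L40 hL4] := decaying_tail (decayingq s2) e10.
have est t w W P (l : R) : t1 <= t <= t2 -> 0 <= l -> (forall x, cD w x (q x t - kap%:C * w x)) ->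
   (forall x, is_derive x (1:R) W (nsq (w x))) -> (forall x, is_derive x (1:R) P (nsq (q x t))) ->
   kap * (W l - W (- l)) <= (1 + 3 * th) * zs_logT kap a b c d l t + (1 + th^-1) * nsq (w (- l)) /\
   (1 - 2 * th) * zs_logT kap a b c d l t <=
     (1 + th) * (kap * (W l - W (- l))) + (1 + th^-1) * nsq (w (- l)) + nsq (T21 c d l t / T11 a b c d l t).
  move=> tt l0 dw dW dP; have [hc [f1 g1]] := T21_column abcd (- l) t.
  have ll : - l <= l by lra.
  have := zs_log_estimate m0 mkap ll dP dW (ml t tt P _ _ dP ll) dw hc f1 g1.
  by rewrite /zs_log opprK (_ : kap / 2 * (l + l) = kap * l); [|field].
pose L0 := `|L1| + L2 + L3 + 2 * L4 + 2 / kap * `|ln e1|.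
have lo l : L0 <= l -> (kap * (mass w1 - e1) - (1 + th^-1) * e1) / (1 + 3 * th) <= zs_logT kap a b c d l s1.
  move=> Ll; have la : 0 <= 2 / kap * `|ln e1| by rewrite mulr_ge0 ?divr_ge0// ltW.
  have l0 : 0 <= l by apply: le_trans Ll; rewrite /L0 !addr_ge0// mulr_ge0.
  have [h _] := est s1 w1 W1 P1 l s1t l0 dw1 dW1 dP1.
  have h1 := hL1 l; have h2 := hL2 (- l); rewrite normrN (ger0_norm l0) in h2.
  have {}h1 : mass w1 - e1 <= W1 l - W1 (- l).
    by apply: h1; apply: le_trans Ll; have := ler_norm L1; rewrite /L0; lra.
  have {}h2 : nsq (w1 (- l)) <= e1.
    by apply: h2; apply: le_trans Ll; have := normr_ge0 L1; rewrite /L0; lra.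
  rewrite ler_pdivrMr; last by move: th0; lra.
  have g1 : kap * (mass w1 - e1) <= kap * (W1 l - W1 (- l)) by rewrite ler_pM2l.
  have g2 : (1 + th^-1) * nsq (w1 (- l)) <= (1 + th^-1) * e1.
    by rewrite ler_wpM2l// addr_ge0// invr_ge0 ltW.
  lra.
have hi l : L0 <= l -> zs_logT kap a b c d l s2 <=
    ((1 + th) * (kap * mass w2) + (1 + th^-1) * e1 + (1 + kap ^- 2) * e1) / (1 - 2 * th).
  move=> Ll; have la : 0 <= 2 / kap * `|ln e1| by rewrite mulr_ge0 ?divr_ge0// ltW.
  have l0 : 0 <= l by apply: le_trans Ll; rewrite /L0 !addr_ge0// mulr_ge0.
  have [_ h] := est s2 w2 W2 P2 l s2t l0 dw2 dW2 dP2.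
  have h2 := hL3 (- l); rewrite normrN (ger0_norm l0) in h2.
  have {}h2 : nsq (w2 (- l)) <= e1.
    by apply: h2; apply: le_trans Ll; have := normr_ge0 L1; rewrite /L0; lra.
  have h3 := mass_primitive_le nw2 dW2 (- l) l.
  have h4 : nsq (T21 c d l s2 / T11 a b c d l s2) <= (1 + kap ^- 2) * e1.
    have [hc [f1 g1]] := T21_column abcd (- l) s2.
    have z2 : - l <= l / 2 <= l by apply/andP; split; lra.
    have := riccati_decay m0 mkap hc f1 g1 z2 (eps := e1) => h4.
    have {}h4 := h4 _; apply: le_trans (h4 _) _.
      move=> x /andP[x1 x2]; apply: hL4; rewrite ger0_norm; last lra.
      by apply: le_trans x1; rewrite ler_pdivlMr//; move: Ll; have := normr_ge0 L1; rewrite /L0; lra.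
    rewrite mulrDl mul1r addrC [X in _ <= _ + X]mulrC lerD2r.
    have -> : - (kap * (l - l / 2)) = - (kap / 2 * l) by field.
    have hl : `|ln e1| <= kap / 2 * l.
      have -> : `|ln e1| = kap / 2 * (2 / kap * `|ln e1|) by field; exact: lt0r_neq0.
      rewrite ler_pM2l ?divr_gt0//; apply: le_trans Ll.
      by have := normr_ge0 L1; rewrite /L0; lra.
    rewrite -[leRHS]lnK ?posrE// ler_expR.
    by have := ler_norm (- ln e1); rewrite normrN; lra.
  rewrite ler_pdivlMr; last by move: th1; lra.
  have g1 : (1 + th) * (kap * (W2 l - W2 (- l))) <= (1 + th) * (kap * mass w2).
    by rewrite ler_pM2l ?addr_gt0// ler_pM2l.
  have g2 : (1 + th^-1) * nsq (w2 (- l)) <= (1 + th^-1) * e1.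
    by rewrite ler_wpM2l// addr_ge0// invr_ge0 ltW.
  lra.
have := C s1 s2 _ _ L0 ss lo hi.
have t3 : 0 < 1 + 3 * th by move: th0; lra.
have t2' : 0 < 1 - 2 * th by move: th1; lra.
rewrite ler_pdivrMr// mulrAC ler_pdivlMr// => h.
have e1E : (kap + (1 + th^-1) + 1 + (1 + kap ^- 2)) * e1 = e * kap / 32.
  rewrite /e1; move: (lt0r_neq0 D0); move: (_ + _ + _ + _) => D Dn.
  by field; rewrite Dn.
have tV : 0 < th^-1 by rewrite invr_gt0.
have kV : 0 < kap ^- 2 by rewrite invr_gt0 exprn_gt0.
rewrite -(ler_pM2l k0).
pose X := (kap + (1 + th^-1)) * e1; pose Y := ((1 + th^-1) + (1 + kap ^- 2)) * e1.
have X0 : 0 <= X by rewrite mulr_ge0 ?(ltW e10)// !addr_ge0// ltW.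
have Y0 : 0 <= Y by rewrite mulr_ge0 ?(ltW e10)// !addr_ge0// ltW.
have XE : X <= e * kap / 32.
  by rewrite -e1E /X ler_wpM2r ?(ltW e10)//; lra.
have YE : Y <= e * kap / 32.
  by rewrite -e1E /Y ler_wpM2r ?(ltW e10)//; lra.
have X2 : (1 - 2 * th) * X <= X by rewrite ler_piMl//; lra.
have Y2 : (1 + 3 * th) * Y <= 2 * Y by rewrite ler_wpM2r//; lra.
have ek : 0 < e * kap by rewrite mulr_gt0.
have h' : kap * mass w1 * (1 - 2 * th) - (1 - 2 * th) * X <=
    (1 + 3 * th) * ((1 + th) * (kap * mass w2)) + (1 + 3 * th) * Y.
  by move: h; rewrite /X /Y; lra.
move: X Y X0 Y0 XE YE X2 Y2 h' => X Y X0 Y0 XE YE X2 Y2 h'; lra.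
Qed.
End Compare.
End Decay.

(** * Limits and exchanges of integrals *)

Section Toolkit.
Context {R : realType}.
Local Notation mu := (@lebesgue_measure R).
Implicit Types (f g F : R -> R).

Lemma Rint_meas f : Rint f -> measurable_fun [set: R] f.
Proof. by move=> /integrableP[h _]; exact/measurable_EFinP. Qed.

Lemma RI_norm_le f : Rint f -> `|RI f| <= RI (fun x => `|f x|).
Proof. by move=> i; exact: le_normr_Rintegral. Qed.

(** Domination by a product gives integrability on the plane. *)
Lemma RI_fubini (h : R -> R -> R) (a b : R -> R) :
  measurable_fun [set: R * R] (fun p : R * R => h p.1 p.2) ->
  Rint a -> Rint b -> (forall x, 0 <= a x) -> (forall x, 0 <= b x) ->
  (forall x y, `|h x y| <= a x * b y) ->
  [/\ forall x, Rint (h x), forall y, Rint (h^~ y), Rint (fun x => RI (h x)),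
    Rint (fun y => RI (h^~ y)) & RI (fun x => RI (h x)) = RI (fun y => RI (h^~ y))].
Proof.
move=> mh ia ib a0 b0 hab.
have m1 x : measurable_fun [set: R] (h x).
  by apply: (measurableT_comp mh (g := fun y => (x, y))); exact: measurable_pair1.
have m2 y : measurable_fun [set: R] (h^~ y).
  by apply: (measurableT_comp mh (g := fun x => (x, y))); exact: measurable_pair2.
have i1 x : Rint (h x) by apply: (Rint_dom (m1 x) (RintZ (a x) ib)).
have i2 y : Rint (h^~ y).
  by apply: (Rint_dom (m2 y) (RintZ (b y) ia)) => x; rewrite mulrC.
pose H (p : R * R) := (h p.1 p.2)%:E.
have mH : measurable_fun [set: R * R] H by exact/measurable_EFinP.
have iH : (mu \x mu)%E.-integrable [set: R * R] H.
  have [_ iP] := @integrable12ltyP _ _ (measurableTypeR R) (measurableTypeR R) R mu mu H mH.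
  apply: iP.
  have b1 x : (\int[mu]_y `|H (x, y)| <= (a x * RI b)%:E)%E.
    rewrite -RIZ// -RI_EFin; last exact: RintZ.
    apply: ge0_le_integral => //.
    - by apply/measurable_EFinP; apply: measurableT_comp => //; exact: m1.
    - by apply/measurable_EFinP; exact: (Rint_meas (RintZ (a x) ib)).
    - by move=> y _; rewrite lee_fin.
  apply: (@le_lt_trans _ _ (\int[mu]_x (a x * RI b)%:E)%E).
    apply: ge0_le_integral => //.
    - by move=> x _; exact: integral_ge0.
    - apply: (@measurable_fun_fubini_tonelli_F _ _ (measurableTypeR R) (measurableTypeR R) R mu (fun p => `|H p|%E)) => //.
      by apply: measurableT_comp.
    - apply/measurable_EFinP; apply: measurable_funM => //; exact: Rint_meas.
  have ic : Rint (fun x => a x * RI b).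
    rewrite (_ : (fun x => _) = (fun x => RI b * a x)); first exact: RintZ.
    by apply/funext => x; rewrite mulrC.
  by rewrite (RI_EFin ic) ltry.
have F1 : (fun x => \int[mu]_y H (x, y))%E = (EFin \o (fun x => RI (h x))).
  by apply/funext => x; rewrite /= -RI_EFin.
have F2 : (fun y => \int[mu]_x H (x, y))%E = (EFin \o (fun y => RI (h^~ y))).
  by apply/funext => y; rewrite /= -RI_EFin.
have j1 : Rint (fun x => RI (h x)) by rewrite /Rint -F1; exact: integrable_fubini_F iH.
have j2 : Rint (fun y => RI (h^~ y)).
  apply: (Rint_dom _ (RintZ (RI a) ib)).
    by apply/measurable_EFinP; rewrite -/(EFin \o (fun y => RI (h^~ y))) -F2; exact: measurable_fubini_G iH.
  move=> y; apply: le_trans (RI_norm_le (i2 y)) _.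
  rewrite mulrC -RIZ//; apply: RI_le => //; first exact: (integrable_norm (i2 y)).
    exact: RintZ.
  by move=> x; rewrite mulrC.
split; [exact: i1|exact: i2|exact: j1|exact: j2|].
have := Fubini iH.
have -> : (\int[mu]_x \int[mu]_y H (x, y))%E = (RI (fun x => RI (h x)))%:E.
  by rewrite -(RI_EFin j1); apply: eq_integral => x _; rewrite -(RI_EFin (i1 x)).
have -> : (\int[mu]_y \int[mu]_x H (x, y))%E = (RI (fun y => RI (h^~ y)))%:E.
  by rewrite -(RI_EFin j2); apply: eq_integral => y _; rewrite -(RI_EFin (i2 y)).
exact: EFin_inj.
Qed.

Lemma RI_mct (gn : nat -> R -> R) g (c : R) :
  (forall n x, 0 <= gn n x) -> (forall x, nondecreasing_seq (gn^~ x)) ->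
  measurable_fun [set: R] g -> (forall n, Rint (gn n)) ->
  (forall x, gn n x @[n --> \oo] --> g x) -> RI (gn n) @[n --> \oo] --> c ->
  Rint g /\ RI g = c.
Proof.
move=> gn0 ndg mg ign lim limc.
have g0 x : 0 <= g x.
  rewrite -(cvg_lim _ (lim x))//; apply: limr_ge; first exact: (cvgP _ (lim x)).
  by apply: nearW => n.
have h1 n : measurable_fun [set: R] (EFin \o gn n).
  by apply/measurable_EFinP; exact: Rint_meas.
have E : (\int[mu]_x (g x)%:E = c%:E)%E.
  have := @cvg_monotone_convergence _ _ R mu [set: R] measurableT (fun n => EFin \o gn n) h1
    (fun n x _ => gn0 n x) (fun x _ n m nm => ndg x n m nm).
  have -> : (fun x => limn (fun n => (EFin \o gn n) x)) = EFin \o g.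
    apply/funext => x; apply/cvg_lim => //; apply: cvg_EFin; last exact: lim.
    exact: nearW.
  move=> h; apply: (cvg_unique _ h) => //.
  rewrite (_ : (fun n => _) = (fun n => (RI (gn n))%:E)); last first.
    by apply/funext => n; rewrite -(RI_EFin (ign n)).
  apply: cvg_EFin; last exact: limc.
  exact: nearW.
have ig : Rint g.
  apply/integrableP; split; first exact/measurable_EFinP.
  have -> : (\int[mu]_x `|(EFin \o g) x|)%E = (\int[mu]_x (g x)%:E)%E.
    by apply: eq_integral => x _; rewrite /= ger0_norm.
  by rewrite E ltry.
by split => //; move: E; rewrite (RI_EFin ig) => -[].
Qed.

Lemma cvg_primitive f F (a b : nat -> R) : continuous f -> Rint f ->
  (forall x, is_derive x (1:R) F (f x)) ->
  (forall X, \forall n \near \oo, a n <= - X /\ X <= b n) ->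
  F (b n) - F (a n) @[n --> \oo] --> RI f.
Proof.
move=> cf intf dF hab.
pose A (n : nat) : set R := `[a n, b n]%classic.
pose fn n := f \_ (A n).
have mA n : measurable (A n) by exact: measurable_itv.
have mf := cont_meas cf.
have mfn n : measurable_fun [set: R] (fn n).
  by apply/(measurable_restrictT f (mA n)); exact: measurable_funTS.
have ig : Rint (fun x => `|f x|) by exact: (integrable_norm intf).
have dom n x : `|fn n x| <= `|f x|.
  by rewrite /fn patchE; case: ifP => //; rewrite normr0.
have lim x : fn n x @[n --> \oo] --> f x.
  apply: cvg_near_cst; have := hab `|x|; apply: filterS => n [h1 h2].
  rewrite /fn patchE mem_set// /A /= in_itv /=.
  by have := ler_norm x; have := ler_norm (- x); rewrite normrN => ? ?; apply/andP; split; lra.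
have [_ h1] := RI_dct mfn mf ig dom lim.
apply: cvg_trans h1; apply: near_eq_cvg; have := hab 1; apply: filterS => n [g1 g2].
have nn : a n < b n by lra.
rewrite /RI /fn -Rintegral_mkcond.
by rewrite (Rintegral_segment nn (fun x _ => dF x) (fun x _ => @cf x)).
Qed.

Lemma natS_cofinal (X : R) : \forall n \near \oo, - (n.+1%:R) <= - X /\ X <= n.+1%:R :> R.
Proof.
exists (Num.truncn `|X|) => // n /= hn; rewrite lerN2.
have /andP[_ h] := truncn_itv (normr_ge0 X).
have h2 : X <= n.+1%:R.
  apply: le_trans (ler_norm X) _; apply: le_trans (ltW h) _.
  by rewrite ler_nat.
by split.
Qed.

Lemma RI_affine f (x e : R) : 0 < e -> continuous f -> Rint f ->
  Rint (fun s => f (x + e * s)) -> RI f = e * RI (fun s => f (x + e * s)).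
Proof.
move=> e0 cf i1 i2; have [F [_ dF]] := continuous_primitive cf.
have dl s : is_derive s (1:R) (fun s => x + e * s) e by eapply rD_eq; [rD|ring].
have cg : continuous (fun s => f (x + e * s)).
  by move=> s; apply: (@continuous_comp _ _ _ (fun s => x + e * s) f); [exact: rD_continuous (dl s)|exact: cf].
have dG s : is_derive s (1:R) (fun s => F (x + e * s)) (e * f (x + e * s)).
  by apply: (rD_eq (@rD_comp R F (fun s => x + e * s) s _ _ (dF (x + e * s)) (dl s))); rewrite mulrC.
have ceg : continuous (fun s => e * f (x + e * s)).
  by move=> s; apply: cvgM; [exact: cvg_cst|exact: cg].
have h1 := cvg_primitive (f := fun s => e * f (x + e * s)) ceg (RintZ e i2) dG natS_cofinal.
have h2 := @cvg_primitive f F (fun n => x + e * - n.+1%:R) (fun n => x + e * n.+1%:R) cf i1 dF.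
rewrite -RIZ//; apply: (cvg_unique _ (h2 _) h1) => //.
move=> X; have := natS_cofinal ((`|X| + `|x|) / e); apply: filterS => n [_ h].
have {}h : `|X| + `|x| <= e * n.+1%:R by rewrite mulrC -ler_pdivrMr.
have := ler_norm X; have := ler_norm x; have := ler_norm (- x); rewrite normrN => ? ? ?.
by split; rewrite ?mulrN; lra.
Qed.

(** For a continuous function given by different formulas on the two half-lines. *)
Lemma primitive_split (h A B dA dB F : R -> R) :
  (forall x, is_derive x (1:R) F (h x)) ->
  (forall x, is_derive x (1:R) A (dA x)) -> (forall x, is_derive x (1:R) B (dB x)) ->
  (forall x, 0 <= x -> h x = dA x) -> (forall x, x <= 0 -> h x = dB x) ->
  forall x, 0 <= x -> F x - F (- x) = A x - A 0 + (B 0 - B (- x)).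
Proof.
move=> dF hA hB eA eB x x0.
have d1 z : 0 <= z <= x -> is_derive z (1:R) (fun z => F z - A z) 0.
  by move=> /andP[z0 _]; apply: (rD_eq (rD_sub (dF z) (hA z))); rewrite eA// subrr.
have h1 := ler_of_derive x0 d1 (fun z _ => lexx _).
have h2 := ger_of_derive x0 d1 (fun z _ => lexx _).
have xN : - x <= 0 by rewrite oppr_le0.
have d2 z : - x <= z <= 0 -> is_derive z (1:R) (fun z => F z - B z) 0.
  by move=> /andP[_ z0]; apply: (rD_eq (rD_sub (dF z) (hB z))); rewrite eB// subrr.
have h3 := ler_of_derive xN d2 (fun z _ => lexx _).
have h4 := ger_of_derive xN d2 (fun z _ => lexx _).
lra.
Qed.
End Toolkit.

(** * The Abel kernel *)

Section Abel.
Context {R : realType}.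

Lemma rD_cos (f : R -> R) (x a : R) : is_derive x (1:R) f a ->
  is_derive x (1:R) (fun y => cos (f y)) (- sin (f x) * a).
Proof. by move=> fa; exact: (@rD_comp R cos f x _ _ (is_derive_cos (f x)) fa). Qed.
Lemma rD_sin (f : R -> R) (x a : R) : is_derive x (1:R) f a ->
  is_derive x (1:R) (fun y => sin (f y)) (cos (f x) * a).
Proof. by move=> fa; exact: (@rD_comp R sin f x _ _ (is_derive_sin (f x)) fa). Qed.

Lemma norm_cos_le1 (x : R) : `|cos x| <= 1.
Proof. by rewrite ler_norml cos_geN1 cos_le1. Qed.
Lemma norm_sin_le1 (x : R) : `|sin x| <= 1.
Proof. by rewrite ler_norml sin_geN1 sin_le1. Qed.

Definition abel (e x : R) : R := expR (- (e * `|x|)).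

Lemma c_abel e : continuous (abel e).
Proof.
move=> x; rewrite /abel; apply: (@continuous_comp _ _ _ (fun x => - (e * `|x|)) expR).
  apply: cvgN; apply: cvgM; first exact: cvg_cst.
  exact: (@continuous_normr R (fun x => x) (fun x => cvg_id)).
exact: continuous_expR.
Qed.

Lemma abel_gt0 e x : 0 < abel e x. Proof. exact: expR_gt0. Qed.

Lemma abel_pos e x : 0 <= x -> abel e x = expR (- (e * x)).
Proof. by move=> x0; rewrite /abel ger0_norm. Qed.
Lemma abel_neg e x : x <= 0 -> abel e x = expR (e * x).
Proof. by move=> x0; rewrite /abel ler0_norm// mulrN opprK. Qed.

Lemma c_lin (k : R) : continuous (fun x : R => k * x).
Proof. by move=> x; apply: cvgM; [exact: cvg_cst|exact: cvg_id]. Qed.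

Lemma c_cos (k : R) : continuous (fun x : R => cos (k * x)).
Proof. by move=> x; apply: (@continuous_comp _ _ _ (fun x => k * x) cos); [exact: c_lin|exact: continuous_cos]. Qed.
Lemma c_sin (k : R) : continuous (fun x : R => sin (k * x)).
Proof. by move=> x; apply: (@continuous_comp _ _ _ (fun x => k * x) sin); [exact: c_lin|exact: continuous_sin]. Qed.

Section Transform.
Variable e : R.
Hypothesis e0 : 0 < e.

Lemma exp_lim (K : R) : K * expR (- (e * n.+1%:R)) @[n --> \oo] --> 0.
Proof.
rewrite -(mulr0 K); apply: cvgMr.
apply: (@squeeze_cvgr _ _ _ _ (fun=> 0) (fun n => e^-1 * n.+1%:R^-1)).
- apply: nearW => n; rewrite expR_ge0 /= expRN -invfM lef_pV2 ?posrE ?expR_gt0 ?mulr_gt0//.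
  by apply: le_trans (expR_ge1Dx _); rewrite lerDr.
- exact: cvg_cst.
- by rewrite -(mulr0 e^-1); apply: cvgMr; exact: cvg_harmonic.
Qed.

Lemma Rint_abel : Rint (abel e).
Proof.
have [F [_ dF]] := continuous_primitive (c_abel (e := e)).
have dA x : is_derive x (1:R) (fun x => - (expR (- (e * x)) / e)) (expR (- (e * x))).
  by eapply rD_eq; [rD|field; exact: lt0r_neq0].
have dB x : is_derive x (1:R) (fun x => expR (e * x) / e) (expR (e * x)).
  by eapply rD_eq; [rD|field; exact: lt0r_neq0].
apply: (@Rint_of_primitive R _ F (2 / e) (c_abel (e := e)) _ dF).
  by move=> x; exact: ltW (abel_gt0 e x).
move=> n; rewrite (primitive_split dF dA dB (abel_pos e) (abel_neg e))//.
rewrite !mulr0 oppr0 expR0.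
have h1 : 0 <= expR (- (e * n.+1%:R)) / e by rewrite divr_ge0 ?expR_ge0// ltW.
have h2 : 0 <= expR (e * - n.+1%:R) / e by rewrite divr_ge0 ?expR_ge0// ltW.
lra.
Qed.

Lemma Rint_abel_mul (h : R -> R) : measurable_fun [set: R] h -> (forall x, `|h x| <= 1) ->
  Rint (fun x => abel e x * h x).
Proof.
move=> mh h1; apply: (Rint_dom _ Rint_abel).
  by apply: measurable_funM => //; apply: cont_meas; exact: c_abel.
by move=> x; rewrite normrM ger0_norm ?(ltW (abel_gt0 e x))// ler_piMr// ltW// abel_gt0.
Qed.

Lemma abel_cos v : RI (fun x => abel e x * cos (v * x)) = 2 * e / (e ^+ 2 + v ^+ 2).
Proof.
have D0 : 0 < e ^+ 2 + v ^+ 2 by rewrite ltr_pwDl ?exprn_gt0// sqr_ge0.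
have Dn := lt0r_neq0 D0.
have ch : continuous (fun x => abel e x * cos (v * x)).
  by move=> x; apply: cvgM; [exact: c_abel|exact: c_cos].
have ih := Rint_abel_mul (cont_meas (c_cos (k := v))) (fun x => norm_cos_le1 (v * x)).
have [F [_ dF]] := continuous_primitive ch.
pose A x := expR (- (e * x)) * (v * sin (v * x) - e * cos (v * x)) / (e ^+ 2 + v ^+ 2).
pose B x := expR (e * x) * (v * sin (v * x) + e * cos (v * x)) / (e ^+ 2 + v ^+ 2).
have dl (k x : R) : is_derive x (1:R) (fun x => k * x) k by eapply rD_eq; [rD|ring].
have dA x : is_derive x (1:R) A (expR (- (e * x)) * cos (v * x)).
  have h1 := rD_sin (dl v x); have h2 := rD_cos (dl v x).
  by rewrite /A; eapply rD_eq; [rD|field].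
have dB x : is_derive x (1:R) B (expR (e * x) * cos (v * x)).
  have h1 := rD_sin (dl v x); have h2 := rD_cos (dl v x).
  by rewrite /B; eapply rD_eq; [rD|field].
have eA x : 0 <= x -> abel e x * cos (v * x) = expR (- (e * x)) * cos (v * x).
  by move=> x0; rewrite abel_pos.
have eB x : x <= 0 -> abel e x * cos (v * x) = expR (e * x) * cos (v * x).
  by move=> x0; rewrite abel_neg.
have FE n : F n.+1%:R - F (- n.+1%:R) = 2 * e / (e ^+ 2 + v ^+ 2) + 2 * A n.+1%:R.
  rewrite (primitive_split dF dA dB eA eB)// /A /B !mulr0 !mulrN oppr0 expR0 sin0 cos0 sinN cosN.
  by field.
have h1 := cvg_primitive ch ih dF natS_cofinal.
suff h2 : F n.+1%:R - F (- n.+1%:R) @[n --> \oo] --> 2 * e / (e ^+ 2 + v ^+ 2).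
  exact: (cvg_unique _ h1 h2).
under eq_fun do rewrite FE.
suff h3 : A n.+1%:R @[n --> \oo] --> 0.
  pose c := 2 * e / (e ^+ 2 + v ^+ 2).
  have : (fun n => c + 2 * A n.+1%:R) n @[n --> \oo] --> c + 2 * 0.
    by apply: cvgD; [exact: cvg_cst|apply: cvgMr; exact: h3].
  by rewrite mulr0 addr0.
pose K := (`|v| + e) / (e ^+ 2 + v ^+ 2).
apply: norm_cvg0.
apply: (@squeeze_cvgr _ _ _ _ (fun=> 0) (fun n => K * expR (- (e * n.+1%:R)))).
- apply: nearW => n; rewrite normr_ge0 /= /A /K !normrM normfV (ger0_norm (expR_ge0 _)) (gtr0_norm D0).
  rewrite -mulrA mulrC ler_wpM2r ?expR_ge0// ler_wpM2r ?invr_ge0 ?(ltW D0)//.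
  apply: le_trans (ler_normB _ _) _; rewrite !normrM (gtr0_norm e0); apply: lerD.
    by rewrite ler_piMr// norm_sin_le1.
  by rewrite ler_piMr ?(ltW e0)// norm_cos_le1.
- exact: cvg_cst.
- exact: exp_lim.
Qed.

Lemma abel_sin v : RI (fun x => abel e x * sin (v * x)) = 0.
Proof.
have D0 : 0 < e ^+ 2 + v ^+ 2 by rewrite ltr_pwDl ?exprn_gt0// sqr_ge0.
have Dn := lt0r_neq0 D0.
have ch : continuous (fun x => abel e x * sin (v * x)).
  by move=> x; apply: cvgM; [exact: c_abel|exact: c_sin].
have ih := Rint_abel_mul (cont_meas (c_sin (k := v))) (fun x => norm_sin_le1 (v * x)).
have [F [_ dF]] := continuous_primitive ch.
pose A x := - (expR (- (e * x)) * (e * sin (v * x) + v * cos (v * x)) / (e ^+ 2 + v ^+ 2)).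
pose B x := expR (e * x) * (e * sin (v * x) - v * cos (v * x)) / (e ^+ 2 + v ^+ 2).
have dl (k x : R) : is_derive x (1:R) (fun x => k * x) k by eapply rD_eq; [rD|ring].
have dA x : is_derive x (1:R) A (expR (- (e * x)) * sin (v * x)).
  have h1 := rD_sin (dl v x); have h2 := rD_cos (dl v x).
  by rewrite /A; eapply rD_eq; [rD|field].
have dB x : is_derive x (1:R) B (expR (e * x) * sin (v * x)).
  have h1 := rD_sin (dl v x); have h2 := rD_cos (dl v x).
  by rewrite /B; eapply rD_eq; [rD|field].
have eA x : 0 <= x -> abel e x * sin (v * x) = expR (- (e * x)) * sin (v * x).
  by move=> x0; rewrite abel_pos.
have eB x : x <= 0 -> abel e x * sin (v * x) = expR (e * x) * sin (v * x).
  by move=> x0; rewrite abel_neg.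
have FE n : F n.+1%:R - F (- n.+1%:R) = 0.
  rewrite (primitive_split dF dA dB eA eB)// /A /B !mulr0 !mulrN oppr0 expR0 sin0 cos0 sinN cosN.
  by field.
have h1 := cvg_primitive ch ih dF natS_cofinal.
suff h2 : F n.+1%:R - F (- n.+1%:R) @[n --> \oo] --> 0 by exact: (cvg_unique _ h1 h2).
under eq_fun do rewrite FE.
exact: cvg_cst.
Qed.
End Transform.
End Abel.

(** * Abel means of the Fourier transform *)

Section RealFourier.
Context {R : realType}.
Local Notation mT := (measurable_fun [set: R * R]).

Lemma mfst : mT (fun p : R * R => p.1).
Proof. exact: measurable_fst. Qed.
Lemma msnd : mT (fun p : R * R => p.2).
Proof. exact: measurable_snd. Qed.
Lemma mcomp (g : R -> R) (h : R * R -> R) : measurable_fun [set: R] g -> mT h ->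
  mT (fun p => g (h p)).
Proof. by move=> mg mh; apply: (measurableT_comp mg mh). Qed.
Lemma mcos (h : R * R -> R) : mT h -> mT (fun p => cos (h p)).
Proof. by apply: mcomp; apply: cont_meas; exact: continuous_cos. Qed.
Lemma msin (h : R * R -> R) : mT h -> mT (fun p => sin (h p)).
Proof. by apply: mcomp; apply: cont_meas; exact: continuous_sin. Qed.
Lemma mmul (g h : R * R -> R) : mT g -> mT h -> mT (fun p => g p * h p).
Proof. exact: measurable_funM. Qed.
Lemma madd (g h : R * R -> R) : mT g -> mT h -> mT (fun p => g p + h p).
Proof. exact: measurable_funD. Qed.
Lemma msub (g h : R * R -> R) : mT g -> mT h -> mT (fun p => g p - h p).
Proof. exact: measurable_funB. Qed.

(** Up to the factor [(2 pi)^(-1/2)], the real and imaginary parts of the Fourier integral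
    of [u + i v] are [ft u v] and [ft v (- u)]. *)
Definition ft (u v : R -> R) (eta : R) : R :=
  RI (fun x => u x * cos (eta * x) + v x * sin (eta * x)).

Section Pair.
Variables (u v : R -> R) (K : R).
Hypotheses (cu : continuous u) (cv : continuous v) (K0 : 0 <= K).
Hypotheses (bu : forall x, `|u x| <= K * wt x) (bv : forall x, `|v x| <= K * wt x).

Let mu := cont_meas cu.
Let mv := cont_meas cv.

Let trig_le (a b c d : R) (x : R) : `|a| <= K * wt x -> `|b| <= K * wt x ->
  `|c| <= 1 -> `|d| <= 1 -> `|a * c + b * d| <= 2 * K * wt x.
Proof.
move=> h1 h2 h3 h4; apply: le_trans (ler_normD _ _) _; rewrite !normrM.
have : `|a| * `|c| <= K * wt x * 1 by apply: ler_pM.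
have : `|b| * `|d| <= K * wt x * 1 by apply: ler_pM.
lra.
Qed.

Lemma Rint_ft eta : Rint (fun x => u x * cos (eta * x) + v x * sin (eta * x)).
Proof.
apply: (Rint_dom _ (RintZ (2 * K) Rint_wt)).
  apply: measurable_funD; apply: measurable_funM => //; apply: cont_meas; [exact: c_cos|exact: c_sin].
by move=> x; apply: trig_le; rewrite ?norm_cos_le1 ?norm_sin_le1.
Qed.

Lemma ft_bound eta : `|ft u v eta| <= 2 * K * pi.
Proof.
apply: le_trans (RI_norm_le (Rint_ft eta)) _.
rewrite -RI_wt -RIZ; last exact: Rint_wt.
apply: RI_le; [exact: (integrable_norm (Rint_ft eta))|exact: RintZ Rint_wt|].
by move=> x; apply: trig_le; rewrite ?norm_cos_le1 ?norm_sin_le1.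
Qed.

(** The factor [wt eta] makes the double integral absolutely convergent, so that
    measurability is part of the theorem of Fubini. *)
Lemma ft_meas : measurable_fun [set: R] (ft u v).
Proof.
have [||||||_ _ h _ _] := @RI_fubini R
  (fun eta x => wt eta * (u x * cos (eta * x) + v x * sin (eta * x))) (@wt R) (fun x => 2 * K * wt x).
- apply: mmul; first by apply: mcomp; [apply: cont_meas; exact: cwt|exact: mfst].
  by apply: madd; apply: mmul; [apply: (mcomp mu); exact: msnd|apply: mcos; apply: mmul; [exact: mfst|exact: msnd]
   |apply: (mcomp mv); exact: msnd|apply: msin; apply: mmul; [exact: mfst|exact: msnd]].
- exact: Rint_wt.
- exact: (RintZ (2 * K) Rint_wt).
- by move=> x; exact: ltW (wt_gt0 x).
- by move=> x; rewrite !mulr_ge0// ltW// wt_gt0.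
- move=> eta x; rewrite normrM ger0_norm ?(ltW (wt_gt0 eta))// ler_wpM2l ?(ltW (wt_gt0 eta))//.
  by apply: trig_le; rewrite ?norm_cos_le1 ?norm_sin_le1.
rewrite (_ : ft u v = (fun eta => (1 + eta ^+ 2) * RI (fun x => wt eta * (u x * cos (eta * x) + v x * sin (eta * x))))).
  apply: measurable_funM; last exact: Rint_meas h.
  have h1 (x : R) : is_derive x (1:R) (fun x : R => 1 + x ^+ 2) (2 * x).
    by eapply rD_eq; [rD|ring].
  by apply: cont_meas => x; exact: (rD_continuous (h1 x)).
apply/funext => eta; rewrite (RIZ (wt eta) (Rint_ft eta)) mulrA /wt divff ?mul1r//.
exact: lt0r_neq0 (wt_den eta).
Qed.
End Pair.

Section Poisson.
Variables (u v : R -> R) (K : R).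
Hypotheses (cu : continuous u) (cv : continuous v) (K0 : 0 <= K).
Hypotheses (bu : forall x, `|u x| <= K * wt x) (bv : forall x, `|v x| <= K * wt x).
Variable e : R.
Hypothesis e0 : 0 < e.
Let mu := cont_meas cu.
Let mv := cont_meas cv.
Let bvN x : `|- v x| <= K * wt x. Proof. by rewrite normrN. Qed.
Let buN x : `|- u x| <= K * wt x. Proof. by rewrite normrN. Qed.
Let cvN : continuous (fun x => - v x).
Proof. by move=> x; apply: cvgN; exact: cv. Qed.
Let cuN : continuous (fun x => - u x).
Proof. by move=> x; apply: cvgN; exact: cu. Qed.

Let trigB y t : `|u y * cos t - v y * sin t| <= 2 * K * wt y.
Proof.
apply: le_trans (ler_normB _ _) _; rewrite !normrM.
have h1 := ler_pM (normr_ge0 _) (normr_ge0 _) (bu y) (norm_cos_le1 t).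
have h2 := ler_pM (normr_ge0 _) (normr_ge0 _) (bv y) (norm_sin_le1 t).
lra.
Qed.

(** The Abel means of the inverse transform are Poisson integrals, by [abel_cos]. *)
Lemma abel_inversion x :
  RI (fun eta => abel e eta * (cos (eta * x) * ft u v eta - sin (eta * x) * ft v (fun x => - u x) eta))
  = RI (fun y => u y * (2 * e / (e ^+ 2 + (x - y) ^+ 2))).
Proof.
have inner eta : cos (eta * x) * ft u v eta - sin (eta * x) * ft v (fun x => - u x) eta =
    RI (fun y => u y * cos ((x - y) * eta) - v y * sin ((x - y) * eta)).
  have i1 := Rint_ft cu cv bu bv eta; have i2 := Rint_ft cv cuN bv buN eta.
  rewrite /ft -(RIZ _ i1) -(RIZ _ i2) -RIB; [|exact: RintZ|exact: RintZ].
  congr RI; apply/funext => y.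
  have -> : (x - y) * eta = eta * x - eta * y by ring.
  by rewrite cosB sinB; ring.
under [in LHS]eq_fun do rewrite inner.
have [||||||i1 i2 j1 j2 E] := @RI_fubini R
  (fun eta y => abel e eta * (u y * cos ((x - y) * eta) - v y * sin ((x - y) * eta)))
  (abel e) (fun y => 2 * K * wt y).
- apply: mmul; first by apply: mcomp; [apply: cont_meas; exact: c_abel|exact: mfst].
  have mxy : mT (fun p : R * R => (x - p.2) * p.1).
    by apply: mmul; [apply: msub; [exact: measurable_cst|exact: msnd]|exact: mfst].
  by apply: msub; apply: mmul; [apply: (mcomp mu); exact: msnd|exact: mcos
   |apply: (mcomp mv); exact: msnd|exact: msin].
- exact: Rint_abel.
- exact: (RintZ (2 * K) Rint_wt).
- by move=> y; exact: ltW (abel_gt0 e y).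
- by move=> y; rewrite !mulr_ge0// ltW// wt_gt0.
- move=> eta y; rewrite normrM ger0_norm ?(ltW (abel_gt0 e eta))//.
  by apply: ler_wpM2l; [exact: ltW (abel_gt0 e eta)|exact: trigB].
have E1 : (fun eta => RI (fun y => abel e eta * (u y * cos ((x - y) * eta) - v y * sin ((x - y) * eta)))) =
   (fun eta => abel e eta * RI (fun y => u y * cos ((x - y) * eta) - v y * sin ((x - y) * eta))).
  apply/funext => eta; apply: RIZ.
  apply: (Rint_dom _ (RintZ (2 * K) Rint_wt)) => [|y]; last exact: trigB.
    have ml : measurable_fun [set: R] (fun y => (x - y) * eta).
      have h1 (y : R) : is_derive y (1:R) (fun y : R => (x - y) * eta) (- eta).
        by eapply rD_eq; [rD|ring].
      by apply: cont_meas => y; exact: (rD_continuous (h1 y)).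
    have mc : measurable_fun [set: R] (fun y => cos ((x - y) * eta)).
      by apply: (measurableT_comp _ ml); apply: cont_meas; exact: continuous_cos.
    have ms : measurable_fun [set: R] (fun y => sin ((x - y) * eta)).
      by apply: (measurableT_comp _ ml); apply: cont_meas; exact: continuous_sin.
    exact: measurable_funB (measurable_funM mu mc) (measurable_funM mv ms).
rewrite -E1 E; congr RI; apply/funext => y.
have k1 := Rint_abel_mul e0 (cont_meas (c_cos (k := x - y))) (fun z => norm_cos_le1 ((x - y) * z)).
have k2 := Rint_abel_mul e0 (cont_meas (c_sin (k := x - y))) (fun z => norm_sin_le1 ((x - y) * z)).
have -> : (fun eta => abel e eta * (u y * cos ((x - y) * eta) - v y * sin ((x - y) * eta))) =
   (fun eta => u y * (abel e eta * cos ((x - y) * eta)) - v y * (abel e eta * sin ((x - y) * eta))).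
  by apply/funext => eta; ring.
rewrite (RIB (RintZ (u y) k1) (RintZ (v y) k2)) (RIZ _ k1) (RIZ _ k2).
by rewrite (abel_cos e0) (abel_sin e0) mulr0 subr0.
Qed.

Lemma poisson_scaled x :
  RI (fun y => u y * (2 * e / (e ^+ 2 + (x - y) ^+ 2))) = RI (fun s => u (x + e * s) * (2 * wt s)).
Proof.
have D0 y : 0 < e ^+ 2 + (x - y) ^+ 2 by rewrite ltr_pwDl ?exprn_gt0// sqr_ge0.
have dden y : is_derive y (1:R) (fun y => e ^+ 2 + (x - y) ^+ 2) (- (2 * (x - y))).
  by eapply rD_eq; [rD|ring].
have cker : continuous (fun y => u y * (2 * e / (e ^+ 2 + (x - y) ^+ 2))).
  move=> y; apply: cvgM; first exact: cu.
  apply: cvgM; first exact: cvg_cst.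
  apply: (@rD_continuous R (fun y => (e ^+ 2 + (x - y) ^+ 2)^-1) y _).
  exact: (@rD_inv R (fun y => e ^+ 2 + (x - y) ^+ 2) y _ (lt0r_neq0 (D0 y)) (dden y)).
have scale s : e * (u (x + e * s) * (2 * e / (e ^+ 2 + (x - (x + e * s)) ^+ 2))) = u (x + e * s) * (2 * wt s).
  have wn := lt0r_neq0 (wt_den s); have en := lt0r_neq0 e0.
  have -> : e ^+ 2 + (x - (x + e * s)) ^+ 2 = e ^+ 2 * (1 + s ^+ 2) by ring.
  by rewrite /wt; field; rewrite en wn.
have caff : continuous (fun s => x + e * s).
  have h1 (s : R) : is_derive s (1:R) (fun s => x + e * s) e by eapply rD_eq; [rD|ring].
  by move=> s; exact: (rD_continuous (h1 s)).
have cuw : continuous (fun s => u (x + e * s) * (2 * wt s)).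
  move=> s; apply: cvgM.
    by apply: (@continuous_comp _ _ _ (fun s => x + e * s) u); [exact: caff|exact: cu].
  by apply: cvgM; [exact: cvg_cst|exact: cwt].
have iuw : Rint (fun s => u (x + e * s) * (2 * wt s)).
  apply: (Rint_dom (cont_meas cuw) (RintZ (2 * K) Rint_wt)) => s.
  rewrite normrM [X in _ * X]ger0_norm; last by rewrite mulr_ge0// ltW// wt_gt0.
  have -> : 2 * K * wt s = K * (2 * wt s) by ring.
  rewrite ler_wpM2r//; first by rewrite mulr_ge0// ltW// wt_gt0.
  by apply: le_trans (bu _) _; rewrite ler_piMr// wt_le1.
have isc : Rint (fun s => u (x + e * s) * (2 * e / (e ^+ 2 + (x - (x + e * s)) ^+ 2))).
  rewrite (_ : (fun s => _) = (fun s => e^-1 * (u (x + e * s) * (2 * wt s)))); first exact: RintZ.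
  by apply/funext => s; rewrite -scale mulKf// lt0r_neq0.
have iker : Rint (fun y => u y * (2 * e / (e ^+ 2 + (x - y) ^+ 2))).
  apply: (Rint_dom (cont_meas cker) (RintZ (2 / e * K) Rint_wt)) => y.
  have d0 : 0 <= 2 * e / (e ^+ 2 + (x - y) ^+ 2).
    by rewrite divr_ge0 ?(ltW (D0 y))// mulr_ge0// ltW.
  rewrite normrM [X in _ * X]ger0_norm//.
  have h : 2 * e / (e ^+ 2 + (x - y) ^+ 2) <= 2 / e.
    rewrite ler_pdivrMr// mulrDr.
    have -> : 2 / e * e ^+ 2 = 2 * e by field; exact: lt0r_neq0.
    by rewrite lerDl mulr_ge0 ?sqr_ge0// divr_ge0// ltW.
  have -> : 2 / e * K * wt y = K * wt y * (2 / e) by ring.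
  by apply: ler_pM.
rewrite (@RI_affine R _ x e e0 cker iker isc) -RIZ//.
by congr RI; apply/funext => s; exact: scale.
Qed.
End Poisson.
End RealFourier.

(** * Plancherel's identity *)

Section Plancherel.
Context {R : realType}.
Local Notation C := R[i].
Local Notation Re := (@complex.Re R).
Local Notation Im := (@complex.Im R).
Local Notation mT := (measurable_fun [set: R * R]).

Lemma Rint_abel_pair (e : R) (c d f g : R -> R) (B : R) : 0 < e ->
  measurable_fun [set: R] c -> measurable_fun [set: R] d ->
  measurable_fun [set: R] f -> measurable_fun [set: R] g ->
  (forall t, `|c t| <= 1) -> (forall t, `|d t| <= 1) ->
  (forall t, `|f t| <= B) -> (forall t, `|g t| <= B) ->
  Rint (fun eta => abel e eta * (c eta * f eta - d eta * g eta)).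
Proof.
move=> e0 mc md mf mg hc hd hf hg.
apply: (Rint_dom _ (RintZ (2 * B) (Rint_abel e0))).
  apply: measurable_funM; first by apply: cont_meas; exact: c_abel.
  by apply: measurable_funB; exact: measurable_funM.
move=> t; rewrite normrM (gtr0_norm (abel_gt0 e t)) [leRHS]mulrC (ler_pM2l (abel_gt0 e t)).
apply: le_trans (ler_normB _ _) _; rewrite !normrM.
have g1 := ler_pM (normr_ge0 _) (normr_ge0 _) (hc t) (hf t).
have g2 := ler_pM (normr_ge0 _) (normr_ge0 _) (hd t) (hg t).
lra.
Qed.

Section Pair.
Variables (u v : R -> R) (K : R).
Hypotheses (cu : continuous u) (cv : continuous v) (K0 : 0 <= K).
Hypotheses (bu : forall x, `|u x| <= K * wt x) (bv : forall x, `|v x| <= K * wt x).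
Let mu := cont_meas cu.
Let mv := cont_meas cv.
Let bvN x : `|- v x| <= K * wt x. Proof. by rewrite normrN. Qed.
Let buN x : `|- u x| <= K * wt x. Proof. by rewrite normrN. Qed.
Let cvN : continuous (fun x => - v x).
Proof. by move=> x; apply: cvgN; exact: cv. Qed.
Let cuN : continuous (fun x => - u x).
Proof. by move=> x; apply: cvgN; exact: cu. Qed.

Let F1 := ft u v.
Let F2 := ft v (fun x => - u x).
Let poisson (w : R -> R) (e x : R) := RI (fun s => w (x + e * s) * (2 * wt s)).

Lemma ftN eta : ft (fun x => - u x) (fun x => - v x) eta = - ft u v eta.
Proof.
rewrite /ft -[RHS]mulN1r -RIZ; last exact: (Rint_ft cu cv bu bv).
by congr RI; apply/funext => x; ring.
Qed.

(** In each square one of the two transforms is expanded, and the order of integration is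
    exchanged. *)
Lemma abel_plancherel (e : R) : 0 < e ->
  [/\ Rint (fun eta => abel e eta * (F1 eta ^+ 2 + F2 eta ^+ 2)),
      Rint (fun x => u x * poisson u e x + v x * poisson v e x)
    & RI (fun eta => abel e eta * (F1 eta ^+ 2 + F2 eta ^+ 2)) =
      RI (fun x => u x * poisson u e x + v x * poisson v e x)].
Proof.
move=> e0.
pose h (eta x : R) := abel e eta * ((u x * cos (eta * x) + v x * sin (eta * x)) * F1 eta
   + (v x * cos (eta * x) - u x * sin (eta * x)) * F2 eta).
have mF1 : measurable_fun [set: R] F1 := ft_meas cu cv K0 bu bv.
have mF2 : measurable_fun [set: R] F2 := ft_meas cv cuN K0 bv buN.
have bF1 eta : `|F1 eta| <= 2 * K * pi := ft_bound cu cv bu bv eta.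
have bF2 eta : `|F2 eta| <= 2 * K * pi := ft_bound cv cuN bv buN eta.
have mh : mT (fun p : R * R => h p.1 p.2).
  have mxy : mT (fun p : R * R => p.1 * p.2) by apply: mmul; [exact: mfst|exact: msnd].
  have mux : mT (fun p : R * R => u p.2) by apply: (mcomp mu); exact: msnd.
  have mvx : mT (fun p : R * R => v p.2) by apply: (mcomp mv); exact: msnd.
  have m1 : mT (fun p : R * R => F1 p.1) by apply: (mcomp mF1); exact: mfst.
  have m2 : mT (fun p : R * R => F2 p.1) by apply: (mcomp mF2); exact: mfst.
  have ma : mT (fun p : R * R => abel e p.1).
    by apply: mcomp; [apply: cont_meas; exact: c_abel|exact: mfst].
  have mc := mcos mxy; have ms := msin mxy.
  apply: (mmul ma); apply: madd; apply: mmul => //.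
    by apply: madd; exact: mmul.
  by apply: msub; exact: mmul.
have trig (a b c d x : R) : `|a| <= K * wt x -> `|b| <= K * wt x ->
    `|c| <= 1 -> `|d| <= 1 -> `|a * c + b * d| <= 2 * K * wt x.
  move=> h1 h2 h3 h4; apply: le_trans (ler_normD _ _) _; rewrite !normrM.
  have g1 : `|a| * `|c| <= K * wt x * 1 by apply: ler_pM.
  have g2 : `|b| * `|d| <= K * wt x * 1 by apply: ler_pM.
  lra.
have bh eta x : `|h eta x| <= abel e eta * (8 * K ^+ 2 * pi * wt x).
  rewrite /h normrM (gtr0_norm (abel_gt0 e eta)) (ler_pM2l (abel_gt0 e eta)).
  apply: le_trans (ler_normD _ _) _; rewrite !normrM.
  have t1 : `|u x * cos (eta * x) + v x * sin (eta * x)| <= 2 * K * wt x.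
    by apply: trig => //; [exact: norm_cos_le1|exact: norm_sin_le1].
  have t2 : `|v x * cos (eta * x) - u x * sin (eta * x)| <= 2 * K * wt x.
    by rewrite -mulNr; apply: trig => //; [exact: norm_cos_le1|exact: norm_sin_le1].
  have g1 := ler_pM (normr_ge0 _) (normr_ge0 _) t1 (bF1 eta).
  have g2 := ler_pM (normr_ge0 _) (normr_ge0 _) t2 (bF2 eta).
  apply: le_trans (lerD g1 g2) _.
  by rewrite le_eqVlt; apply/orP; left; apply/eqP; ring.
have b0 x : 0 <= 8 * K ^+ 2 * pi * wt x.
  by rewrite !mulr_ge0 ?sqr_ge0 ?pi_ge0// ltW// wt_gt0.
have [ix ie i1 i2 E] := RI_fubini mh (Rint_abel e0) (RintZ (8 * K ^+ 2 * pi) Rint_wt)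
   (fun eta => ltW (abel_gt0 e eta)) b0 bh.
have E1 : (fun eta => RI (h eta)) = (fun eta => abel e eta * (F1 eta ^+ 2 + F2 eta ^+ 2)).
  apply/funext => eta.
  have j1 := Rint_ft cu cv bu bv eta; have j2 := Rint_ft cv cuN bv buN eta.
  rewrite (_ : h eta = (fun x => abel e eta * (F1 eta * (u x * cos (eta * x) + v x * sin (eta * x))
     + F2 eta * (v x * cos (eta * x) + - u x * sin (eta * x))))); last first.
    by apply/funext => x; rewrite /h; ring.
  have k1 := RintZ (F1 eta) j1; have k2 := RintZ (F2 eta) j2.
  rewrite (RIZ _ (RintD k1 k2)) (RID k1 k2) (RIZ _ j1) (RIZ _ j2).
  by rewrite -/(ft u v eta) -/(ft v (fun x => - u x) eta) -/(F1 eta) -/(F2 eta) !expr2.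
have E2 : (fun x => RI (h^~ x)) = (fun x => u x * poisson u e x + v x * poisson v e x).
  apply/funext => x.
  have mlin : measurable_fun [set: R] (fun eta : R => eta * x).
    have d1 (y : R) : is_derive y (1:R) (fun y : R => y * x) x by eapply rD_eq; [rD|ring].
    by apply: cont_meas => y; exact: (rD_continuous (d1 y)).
  have mcx : measurable_fun [set: R] (fun eta : R => cos (eta * x)).
    by apply: (measurableT_comp _ mlin); apply: cont_meas; exact: continuous_cos.
  have msx : measurable_fun [set: R] (fun eta : R => sin (eta * x)).
    by apply: (measurableT_comp _ mlin); apply: cont_meas; exact: continuous_sin.
  have F2' t : ft (fun x => - u x) (fun x => - v x) t = - F1 t by exact: ftN.
  have mF1' : measurable_fun [set: R] (ft (fun x => - u x) (fun x => - v x)).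
    exact: (ft_meas cuN cvN K0 buN bvN).
  have j1 := Rint_abel_pair e0 mcx msx mF1 mF2 (fun t => norm_cos_le1 _) (fun t => norm_sin_le1 _) bF1 bF2.
  have bF1' eta : `|ft (fun x => - u x) (fun x => - v x) eta| <= 2 * K * pi := ft_bound cuN cvN buN bvN eta.
  have j2 := Rint_abel_pair e0 mcx msx mF2 mF1' (fun t => norm_cos_le1 _) (fun t => norm_sin_le1 _) bF2 bF1'.
  rewrite /poisson -(poisson_scaled cu K0 bu e0 x) -(poisson_scaled cv K0 bv e0 x).
  rewrite -(abel_inversion cu cv K0 bu bv e0 x) -(abel_inversion cv cuN K0 bv buN e0 x).
  rewrite -(RIZ (u x) j1) -(RIZ (v x) j2) -(RID (RintZ (u x) j1) (RintZ (v x) j2)).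
  by congr RI; apply/funext => eta; rewrite /h F2'; ring.
split; [exact: (eq_ind _ (fun g => Rint g) i1 _ E1)|exact: (eq_ind _ (fun g => Rint g) i2 _ E2)|].
exact: (etrans (congr1 RI (esym E1)) (etrans E (congr1 RI E2))).
Qed.

Let epsn (n : nat) : R := n.+1%:R^-1.
Let epsn0 n : 0 < epsn n. Proof. by rewrite invr_gt0 ltr0Sn. Qed.
Let cvg_epsn : epsn n @[n --> \oo] --> 0. Proof. exact: cvg_harmonic. Qed.

Lemma poisson_bound (w : R -> R) (e x : R) : continuous w -> (forall x, `|w x| <= K * wt x) ->
  Rint (fun s => w (x + e * s) * (2 * wt s)) /\ `|poisson w e x| <= 2 * K * pi.
Proof.
move=> cw bw.
have caff : continuous (fun s => x + e * s).
  have h1 (s : R) : is_derive s (1:R) (fun s => x + e * s) e by eapply rD_eq; [rD|ring].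
  by move=> s; exact: (rD_continuous (h1 s)).
have cuw : continuous (fun s => w (x + e * s) * (2 * wt s)).
  move=> s; apply: cvgM.
    by apply: (@continuous_comp _ _ _ (fun s => x + e * s) w); [exact: caff|exact: cw].
  by apply: cvgM; [exact: cvg_cst|exact: cwt].
have dom s : `|w (x + e * s) * (2 * wt s)| <= 2 * K * wt s.
  rewrite normrM [X in _ * X]ger0_norm; last by rewrite mulr_ge0// ltW// wt_gt0.
  have -> : 2 * K * wt s = K * (2 * wt s) by ring.
  rewrite ler_wpM2r//; first by rewrite mulr_ge0// ltW// wt_gt0.
  by apply: le_trans (bw _) _; rewrite ler_piMr// wt_le1.
have iw := Rint_dom (cont_meas cuw) (RintZ (2 * K) Rint_wt) dom.
split => //; apply: le_trans (RI_norm_le iw) _; rewrite -RI_wt -RIZ; last exact: Rint_wt.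
by apply: RI_le => //; [exact: (integrable_norm iw)|exact: RintZ Rint_wt].
Qed.

Lemma poisson_lim (w : R -> R) (x : R) : continuous w -> (forall x, `|w x| <= K * wt x) ->
  poisson w (epsn n) x @[n --> \oo] --> 2 * pi * w x.
Proof.
move=> cw bw.
have iu n := (poisson_bound (epsn n) x cw bw).1.
have -> : 2 * pi * w x = RI (fun s => 2 * w x * wt s).
  by rewrite RIZ; [rewrite RI_wt; ring|exact: Rint_wt].
have lim s : w (x + epsn n * s) * (2 * wt s) @[n --> \oo] --> 2 * w x * wt s.
  have -> : 2 * w x * wt s = w x * (2 * wt s) by ring.
  apply: cvgMl.
  have h : x + epsn n * s @[n --> \oo] --> x.
    rewrite -[X in _ --> X]addr0 -[X in _ --> _ + X](mul0r s).
    by apply: cvgD; [exact: cvg_cst|apply: cvgMl; exact: cvg_epsn].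
  exact: (@continuous_cvg _ _ _ _ _ (fun n => x + epsn n * s) w x (cw x) h).
apply: (RI_dct (g := fun s => 2 * K * wt s) _ _ _ _ lim).2.
- by move=> n; exact: Rint_meas (iu n).
- by apply: cont_meas => s; apply: cvgM; [exact: cvg_cst|exact: cwt].
- exact: RintZ Rint_wt.
- move=> n s; rewrite normrM [X in _ * X]ger0_norm; last by rewrite mulr_ge0// ltW// wt_gt0.
  have -> : 2 * K * wt s = K * (2 * wt s) by ring.
  rewrite ler_wpM2r//; first by rewrite mulr_ge0// ltW// wt_gt0.
  by apply: le_trans (bw _) _; rewrite ler_piMr// wt_le1.
Qed.

(** As [e] decreases to 0 the Abel means increase to the spectral integral, while the
    Poisson integrals of [u] and [v] tend to [2 pi u] and [2 pi v] boundedly. *)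
Lemma plancherel_ft : Rint (fun eta => F1 eta ^+ 2 + F2 eta ^+ 2) /\
  RI (fun eta => F1 eta ^+ 2 + F2 eta ^+ 2) = 2 * pi * RI (fun x => u x ^+ 2 + v x ^+ 2).
Proof.
have AP n := abel_plancherel (epsn0 n).
have sq (w : R -> R) x : (forall x, `|w x| <= K * wt x) -> w x ^+ 2 <= K ^+ 2 * wt x.
  move=> bw; rewrite -real_normK ?num_real//.
  apply: (@le_trans _ _ ((K * wt x) ^+ 2)); first by rewrite ler_sqr ?nnegrE ?mulr_ge0// ltW// wt_gt0.
  by rewrite exprMn ler_wpM2l ?sqr_ge0// expr2 ler_piMl ?wt_le1// ltW// wt_gt0.
have c2 : continuous (fun x => u x ^+ 2 + v x ^+ 2).
  move=> x; rewrite (_ : (fun x => _) = (fun x => u x * u x + v x * v x)); last first.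
    by apply/funext => y; rewrite !expr2.
  by apply: cvgD; apply: cvgM; [exact: cu|exact: cu|exact: cv|exact: cv].
have i2 : Rint (fun x => u x ^+ 2 + v x ^+ 2).
  apply: (Rint_dom (cont_meas c2) (RintZ (2 * K ^+ 2) Rint_wt)) => x.
  rewrite ger0_norm ?addr_ge0 ?sqr_ge0//.
  have := sq u x bu; have := sq v x bv; lra.
rewrite -RIZ//.
apply: (@RI_mct R (fun n eta => abel (epsn n) eta * (F1 eta ^+ 2 + F2 eta ^+ 2))).
- by move=> n eta; rewrite mulr_ge0 ?addr_ge0 ?sqr_ge0// ltW// abel_gt0.
- move=> eta; apply/nondecreasing_seqP => n; rewrite ler_wpM2r ?addr_ge0 ?sqr_ge0//.
  by rewrite /abel ler_expR lerN2 ler_wpM2r// /epsn lef_pV2 ?posrE ?ltr0Sn// ler_nat.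
- apply: measurable_funD.
    by apply: measurable_funX; exact: (ft_meas cu cv K0 bu bv).
  by apply: measurable_funX; exact: (ft_meas cv cuN K0 bv buN).
- by move=> n; case: (AP n).
- move=> eta; rewrite -[X in _ --> X]mul1r; apply: cvgMl.
  rewrite /abel -[X in _ --> X]expR0.
  have h : - (epsn n * `|eta|) @[n --> \oo] --> 0.
    by rewrite -oppr0 -(mul0r `|eta|); apply: cvgN; apply: cvgMl; exact: cvg_epsn.
  exact: (@continuous_cvg _ _ _ _ _ (fun n => - (epsn n * `|eta|)) expR 0 (@continuous_expR R 0) h).
rewrite (_ : (fun n => _) = (fun n => RI (fun x => u x * poisson u (epsn n) x + v x * poisson v (epsn n) x))); last first.
  by apply/funext => n; case: (AP n).
have lim x : u x * poisson u (epsn n) x + v x * poisson v (epsn n) x @[n --> \oo] -->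
   2 * pi * (u x ^+ 2 + v x ^+ 2).
  have -> : 2 * pi * (u x ^+ 2 + v x ^+ 2) = u x * (2 * pi * u x) + v x * (2 * pi * v x) by ring.
  by apply: cvgD; apply: cvgMr; exact: poisson_lim.
apply: (RI_dct (g := fun x => 4 * K ^+ 2 * pi * wt x) _ _ _ _ lim).2.
- by move=> n; case: (AP n) => _ h _; exact: Rint_meas h.
- exact: Rint_meas (RintZ (2 * pi) i2).
- exact: RintZ Rint_wt.
- move=> n x; apply: le_trans (ler_normD _ _) _; rewrite !normrM.
  have g1 := ler_pM (normr_ge0 _) (normr_ge0 _) (bu x) (poisson_bound (epsn n) x cu bu).2.
  have g2 := ler_pM (normr_ge0 _) (normr_ge0 _) (bv x) (poisson_bound (epsn n) x cv bv).2.
  apply: le_trans (lerD g1 g2) _.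
  by rewrite le_eqVlt; apply/orP; left; apply/eqP; ring.
Qed.
End Pair.

Lemma Re_fourier (f : R -> C) eta : Re (fourier_integral f eta) =
  (Num.sqrt (2 * pi))^-1 * ft (fun x => Re (f x)) (fun x => Im (f x)) eta.
Proof.
rewrite /fourier_integral !cE /= mul0r subr0; congr (_ * RI _); apply/funext => x.
by rewrite !cE /= cosN sinN; ring.
Qed.

Lemma Im_fourier (f : R -> C) eta : Im (fourier_integral f eta) =
  (Num.sqrt (2 * pi))^-1 * ft (fun x => Im (f x)) (fun x => - Re (f x)) eta.
Proof.
rewrite /fourier_integral !cE /= mul0r addr0; congr (_ * RI _); apply/funext => x.
by rewrite !cE /= cosN sinN; ring.
Qed.

Theorem plancherel (f : R -> C) : decaying f ->
  Rint (fun eta => nsq (fourier_integral f eta)) /\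
  RI (fun eta => nsq (fourier_integral f eta)) = mass f.
Proof.
move=> [[c1 c2] [K K0 hK]].
have [i E] := plancherel_ft c1 c2 K0 (fun x => (hK x).1) (fun x => (hK x).2).
have p0 : 0 < 2 * pi :> R by rewrite mulr_gt0// pi_gt0.
rewrite (_ : (fun eta => _) = (fun eta => (2 * pi)^-1 * (ft (fun x => Re (f x)) (fun x => Im (f x)) eta ^+ 2
   + ft (fun x => Im (f x)) (fun x => - Re (f x)) eta ^+ 2))).
  split; first exact: RintZ.
  by rewrite RIZ// E mulrA mulVf ?mul1r// lt0r_neq0.
apply/funext => eta; rewrite /nsq Re_fourier Im_fourier !exprMn exprVn sqr_sqrtr ?(ltW p0)//.
by ring.
Qed.

End Plancherel.

(** * Lower semicontinuous functions that are constant where they are bounded *)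

Section LocallyBounded.
Context {R : realType}.
Implicit Types (M : R -> R).

Definition lsc M := forall t c, c < M t ->
  exists2 d, 0 < d & forall s, `|s - t| < d -> c < M s.

(** The form in which a conservation law is available when its proof needs an a priori bound. *)
Definition rigid M := forall t1 t2 m, t1 <= t2 ->
  (forall t, t1 <= t <= t2 -> M t <= m) -> M t1 = M t2.

Definition tame M t := exists m d, 0 < d /\ forall s, `|s - t| < d -> M s <= m.

Lemma tame_derive M t : rigid M -> tame M t -> is_derive t (1:R) M 0.
Proof.
move=> rg [m [d [d0 h]]].
have loc s : `|s - t| < d -> M s = M t.
  move=> sd; have [st|/ltW ts] := leP s t.
    apply: (rg _ _ m st) => u /andP[u1 u2]; apply: h.
    move: sd; rewrite !ltr_norml => /andP[? ?]; apply/andP; split; lra.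
  apply/esym; apply: (rg _ _ m ts) => u /andP[u1 u2]; apply: h.
  move: sd; rewrite !ltr_norml => /andP[? ?]; apply/andP; split; lra.
apply: is_derive_of_littleo => e e0.
exists d => //= s /= sd; rewrite (loc s); last by rewrite distrC.
by rewrite subrr mulr0 subr0 normr0 mulr_ge0// ltW.
Qed.

Lemma tame_constant M a b : rigid M -> a <= b ->
  (forall t, a <= t <= b -> tame M t) -> M a = M b.
Proof.
move=> rg ab tm.
have d t : a <= t <= b -> is_derive t (1:R) M 0 by move=> /tm; exact: tame_derive.
apply/eqP; rewrite eq_le; apply/andP; split.
  by apply: (ler_of_derive ab d).
by apply: (ger_of_derive ab d).
Qed.

Lemma nested_intervals (a b : nat -> R) :
  (forall n, a n < a n.+1) -> (forall n, b n.+1 < b n) -> (forall n, a n < b n) ->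
  exists x, forall n, a n < x < b n.
Proof.
move=> ha hb hab.
have am n m : (n <= m)%N -> a n <= a m.
  move=> /subnKC <-; elim: (m - n)%N => [|k IH]; first by rewrite addn0.
  by rewrite addnS; apply: le_trans IH (ltW (ha _)).
have bm n m : (n <= m)%N -> b m <= b n.
  move=> /subnKC <-; elim: (m - n)%N => [|k IH]; first by rewrite addn0.
  by rewrite addnS; apply: le_trans (ltW (hb _)) IH.
have anbm n m : a n <= b m.
  have [nm|/ltnW mn] := leqP n m; first by apply: le_trans (am _ _ nm) (ltW (hab m)).
  exact: le_trans (ltW (hab n)) (bm _ _ mn).
have hs : has_sup (range a).
  by split; [exists (a 0%N), 0%N|exists (b 0%N) => _ [n _ <-]].
exists (sup (range a)) => n; apply/andP; split.
  apply: lt_le_trans (ha n) _; apply: ub_le_sup; [by case: hs|by exists n.+1].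
apply: le_lt_trans (hb n); apply: ge_sup; first by case: hs.
by move=> _ [m _ <-].
Qed.

(** Otherwise intervals centred in [Z] can be nested so that [M] exceeds [n] on the [n]-th
    one, and their common point has no finite value. *)
Lemma baire_bounded M (Z : set R) : lsc M -> Z !=set0 ->
  exists z n d : R, [/\ Z z, 0 < d & forall s, Z s -> `|s - z| < d -> M s <= n].
Proof.
move=> lM [z0 Zz0]; apply: contrapT => H.
have H' (z n d : R) : Z z -> 0 < d -> exists s, [/\ Z s, `|s - z| < d & n < M s].
  move=> Zz d0; apply: contrapT => H2; apply: H; exists z, n, d; split => // s Zs sd.
  by have [//|h] := leP (M s) n; case: H2; exists s.
(* a state is (centre, radius) of an interval centred in Z *)
pose P (p : R * R) := Z p.1 /\ 0 < p.2.
pose step (n : nat) (p p' : R * R) :=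
  [/\ P p', p.1 - p.2 < p'.1 - p'.2, p'.1 + p'.2 < p.1 + p.2 &
      forall s, `|s - p'.1| < p'.2 -> n%:R < M s].
have ex (n : nat) (p : {p | P p}) : exists p' : {p | P p}, step n (sval p) (sval p').
  case: p => -[z d] [/= Zz d0].
  have [s [Zs sz ns]] := H' z n%:R d Zz d0.
  have [r r0 hr] := lM s n%:R ns.
  move: sz; rewrite ltr_norml => /andP[s1 s2].
  pose r' := Num.min r (Num.min (s - (z - d)) (z + d - s)) / 2.
  have mn : 0 < Num.min r (Num.min (s - (z - d)) (z + d - s)).
    by rewrite !lt_min r0 /=; apply/andP; split; lra.
  have r'0 : 0 < r' by rewrite divr_gt0.
  have [m1 [m2 m3]] : r' < r /\ r' < s - (z - d) /\ r' < z + d - s.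
    have : r' < Num.min r (Num.min (s - (z - d)) (z + d - s)) by rewrite /r'; lra.
    by rewrite !lt_min => /andP[-> /andP[-> ->]].
  have Pp : P (s, r') by [].
  exists (exist _ (s, r') Pp); split => //=; [lra|lra|].
  by move=> u hu; apply: hr; apply: lt_trans hu m1.
have [f fE] := @choice _ _ (fun np (p' : {p | P p}) => step np.1 (sval np.2) (sval p'))
  (fun np : nat * {p | P p} => ex np.1 np.2).
have P0 : P (z0, 1) by [].
pose st := fix st (n : nat) : {p | P p} := if n is k.+1 then f (k, st k) else exist _ (z0, 1) P0.
have stE n : step n (sval (st n)) (sval (st n.+1)) := fE (n, st n).
pose a n := (sval (st n)).1 - (sval (st n)).2.
pose b n := (sval (st n)).1 + (sval (st n)).2.
have [||n|x hx] := @nested_intervals a b.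
- by move=> n; case: (stE n).
- by move=> n; case: (stE n).
- by rewrite /a /b; case: (st n) => -[c d] [/= _ d0]; lra.
have big (n : nat) : n%:R < M x.
  have [_ _ _ h] := stE n; apply: h.
  have /andP[h1 h2] := hx n.+1; rewrite /a /b in h1 h2.
  by rewrite ltr_norml; apply/andP; split; lra.
have /andP[_ h] := truncn_itv (normr_ge0 (M x)).
by have h1 := big (Num.truncn `|M x|).+1; have h2 := ler_norm (M x); move: h h1 h2 => /=; lra.
Qed.

Lemma tame_near M t : tame M t -> exists2 d, 0 < d & forall s, `|s - t| < d -> tame M s.
Proof.
move=> [m [d [d0 h]]]; exists d => // s sd.
exists m, (d - `|s - t|); split; first by rewrite subr_gt0.
move=> u ud; apply: h; have := ler_normD (u - s) (s - t).
have -> : u - s + (s - t) = u - t by ring.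
lra.
Qed.

(** Let [e] be the first point from [t] on that is not tame. Then [M] is constant on [[t, e[],
    hence bounded on [[t, e]], hence equal at [t] and [e]. *)
Lemma bounded_before M (t z n : R) : rigid M -> t < z -> ~ tame M z ->
  (forall e, t <= e <= z -> ~ tame M e -> M e <= n) -> M t <= n.
Proof.
move=> rg tz nz hn.
pose S := [set e | t <= e /\ ~ tame M e].
have Sz : S z by split => //; exact: ltW.
have lS : lbound S t by move=> e [].
have hS : has_inf S by split; [exists z|exists t].
pose e := inf S.
have te : t <= e by apply: lb_le_inf => //; exists z.
have ez : e <= z by apply: ge_inf => //; exists t.
have ne : ~ tame M e.
  move=> /tame_near[d d0 hd].
  have [s Ss se] := inf_adherent d0 hS.
  have es : e <= s by apply: ge_inf => //; exists t.
  by case: Ss => _; apply; apply: hd; rewrite ger0_norm ?subr_ge0// ltrBlDl.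
have tm u : t <= u -> u < e -> tame M u.
  move=> tu ue; apply: contrapT => nu.
  have : e <= u by apply: ge_inf => //; exists t.
  by rewrite leNgt ue.
rewrite (rg t e (Num.max (M t) (M e)) te); first by apply: hn => //; rewrite te.
move=> u /andP[tu]; rewrite le_eqVlt => /orP[/eqP->|ue]; first by rewrite le_max lexx orbT.
rewrite (_ : M u = M t) ?le_max ?lexx//; apply/esym; apply: tame_constant => // v /andP[tv vu].
by apply: tm => //; exact: le_lt_trans vu ue.
Qed.

Lemma rigid_flip M : rigid M -> rigid (fun t => M (- t)).
Proof.
move=> rg t1 t2 m t12 h; apply/esym; apply: (rg _ _ m); first by rewrite lerN2.
move=> t /andP[h1 h2]; have := h (- t); rewrite opprK; apply.
by rewrite lerNr h2 lerNl h1.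
Qed.

Lemma tame_flip M t : tame (fun t => M (- t)) (- t) -> tame M t.
Proof.
move=> [m [d [d0 h]]]; exists m, d; split => // s sd.
rewrite -[s]opprK; apply: h.
by rewrite -opprD normrN.
Qed.

(** If some point is not tame, [baire_bounded] bounds [M] on the points of some interval
    that are not tame, and [bounded_before], applied from both sides, extends the bound to
    the whole interval. So all points are tame, and [M] is locally constant. *)
Theorem lsc_rigid_constant M t : lsc M -> rigid M -> M t = M 0.
Proof.
move=> lM rg.
suff tm s : tame M s.
  have [t0|/ltW t0] := leP 0 t; first by apply/esym; exact: tame_constant.
  exact: tame_constant.
apply: contrapT => ns.
have [|z [n [d [nz d0 hd]]]] := @baire_bounded M [set s | ~ tame M s] lM; first by exists s.
apply: (nz); exists n, d; split => // u ud.
have [tu|nu] := pselect (tame M u); last exact: hd.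
have : u != z by apply/eqP => uz; apply: nz; rewrite -uz.
rewrite neq_lt => /orP[uz|zu].
  apply: (bounded_before rg uz nz) => e /andP[ue ez] ne; apply: hd => //.
  move: ud; rewrite !ltr_norml => /andP[? ?]; apply/andP; split; lra.
rewrite -[u]opprK; apply: (@bounded_before (fun t => M (- t)) (- u) (- z) n (rigid_flip rg)).
- by rewrite ltrN2.
- by move=> /tame_flip.
- move=> e /andP[ue ez] ne; apply: hd.
    by move=> h; apply: ne; apply: tame_flip; rewrite (_ : (fun _ => _) = M)//; apply/funext => v; rewrite opprK.
  move: ud; rewrite !ltr_norml => /andP[? ?]; apply/andP; split; lra.
Qed.
End LocallyBounded.

(** * Conservation of mass *)

Section ResolventEnergy.
Context {R : realType}.
Local Notation C := R[i].
Local Notation Re := (@complex.Re R).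
Local Notation Im := (@complex.Im R).

(** Integration by parts. *)
Lemma ft_resolvent (a b u v : R -> R) (kap K eta : R) :
  continuous u -> continuous v ->
  (forall x, `|a x| <= K * wt x) -> (forall x, `|b x| <= K * wt x) ->
  (forall x, `|u x| <= K * wt x) -> (forall x, `|v x| <= K * wt x) ->
  (forall x, is_derive x (1:R) a (u x - kap * a x)) ->
  (forall x, is_derive x (1:R) b (v x - kap * b x)) ->
  ft u v eta = kap * ft a b eta - eta * ft b (fun x => - a x) eta.
Proof.
move=> cu cv ba bb bu bv da db.
have ca : continuous a by move=> x; exact: rD_continuous (da x).
have cb : continuous b by move=> x; exact: rD_continuous (db x).
have caN : continuous (fun x => - a x) by move=> x; apply: cvgN; exact: ca.
have baN x : `|- a x| <= K * wt x by rewrite normrN.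
have i1 := Rint_ft cu cv bu bv eta.
have i2 := RintZ kap (Rint_ft ca cb ba bb eta).
have i3 := RintZ eta (Rint_ft cb caN bb baN eta).
pose F x := a x * cos (eta * x) + b x * sin (eta * x).
pose f x := u x * cos (eta * x) + v x * sin (eta * x) -
  (kap * (a x * cos (eta * x) + b x * sin (eta * x)) -
   eta * (b x * cos (eta * x) + - a x * sin (eta * x))).
have dl (x : R) : is_derive x (1:R) (fun x => eta * x) eta by eapply rD_eq; [rD|ring].
have dF x : is_derive x (1:R) F (f x).
  have h1 := rD_cos (dl x); have h2 := rD_sin (dl x); have h3 := da x; have h4 := db x.
  by rewrite /F /f; eapply rD_eq; [rD|ring].
have ci (g h : R -> R) : continuous g -> continuous h ->
    continuous (fun x => g x * cos (eta * x) + h x * sin (eta * x)).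
  by move=> cg ch x; apply: cvgD; apply: cvgM; [exact: cg|exact: c_cos|exact: ch|exact: c_sin].
have cf : continuous f.
  move=> x; rewrite /f; apply: cvgB; first exact: ci.
  by apply: cvgB; apply: cvgMr; exact: ci.
have If : Rint f by apply: RintB => //; exact: RintB.
have bF x : `|F x| <= 2 * K * wt x.
  apply: le_trans (ler_normD _ _) _; rewrite !normrM.
  have g1 := ler_pM (normr_ge0 _) (normr_ge0 _) (ba x) (norm_cos_le1 (eta * x)).
  have g2 := ler_pM (normr_ge0 _) (normr_ge0 _) (bb x) (norm_sin_le1 (eta * x)).
  lra.
have lim (s : nat -> R) : (forall n, wt (s n) = wt n.+1%:R) -> F (s n) @[n --> \oo] --> 0.
  move=> hs; apply: norm_cvg0.
  apply: (@squeeze_cvgr _ _ _ _ (fun=> 0) (fun n => 2 * K * wt n.+1%:R)).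
  - by apply: nearW => n; rewrite normr_ge0 -hs bF.
  - exact: cvg_cst.
  - exact: wt_lim.
have E := @improper_FTC R f F 0 0 cf If dF (lim _ (fun n => erefl)) (lim (fun n => - n.+1%:R) _).
have {}E : RI f = 0 by rewrite E ?subrr// => n; rewrite /wt sqrrN.
move: E; rewrite /f (RIB i1 (RintB i2 i3)) (RIB i2 i3).
rewrite (RIZ _ (Rint_ft ca cb ba bb eta)) (RIZ _ (Rint_ft cb caN bb baN eta)).
by move=> /eqP; rewrite subr_eq0 => /eqP.
Qed.

(** The squared norm of [f] in the Sobolev space of order -1, at scale [kap]. *)
Definition energy (kap : R) (f : R -> C) : R :=
  RI (fun eta => nsq (fourier_integral f eta) / (kap ^+ 2 + eta ^+ 2)).

(** The transform of [w] is that of [f] divided by [kap + i eta]; then use Plancherel's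
    identity. *)
Lemma resolvent_energy (f w : R -> C) (kap : R) : 0 < kap -> decaying f -> decaying w ->
  (forall x, cD w x (f x - kap%:C * w x)) -> mass w = energy kap f.
Proof.
move=> k0 [[fc1 fc2] [K1 K10 h1]] nw dw; have [[wc1 wc2] [K2 K20 h2]] := nw.
rewrite -(plancherel nw).2; congr RI; apply/funext => eta.
have D0 : 0 < kap ^+ 2 + eta ^+ 2 by rewrite ltr_pwDl ?exprn_gt0// sqr_ge0.
have up x : (K1 * wt x <= (K1 + K2) * wt x) /\ (K2 * wt x <= (K1 + K2) * wt x).
  by have := ltW (wt_gt0 x); split; rewrite ler_wpM2r ?lerDl ?lerDr.
have bfR x : `|Re (f x)| <= (K1 + K2) * wt x := le_trans (h1 x).1 (up x).1.
have bfI x : `|Im (f x)| <= (K1 + K2) * wt x := le_trans (h1 x).2 (up x).1.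
have bwR x : `|Re (w x)| <= (K1 + K2) * wt x := le_trans (h2 x).1 (up x).2.
have bwI x : `|Im (w x)| <= (K1 + K2) * wt x := le_trans (h2 x).2 (up x).2.
have bfRN x : `|- Re (f x)| <= (K1 + K2) * wt x by rewrite normrN.
have bwRN x : `|- Re (w x)| <= (K1 + K2) * wt x by rewrite normrN.
have fc1N : continuous (fun x => - Re (f x)) by move=> x; apply: cvgN; exact: fc1.
have dR x : is_derive x (1:R) (fun x => Re (w x)) (Re (f x) - kap * Re (w x)).
  by have [d _] := dw x; apply: (rD_eq d); rewrite !cE; ring.
have dI x : is_derive x (1:R) (fun x => Im (w x)) (Im (f x) - kap * Im (w x)).
  by have [_ d] := dw x; apply: (rD_eq d); rewrite !cE; ring.
have dRN x : is_derive x (1:R) (fun x => - Re (w x)) (- Re (f x) - kap * - Re (w x)).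
  by apply: (rD_eq (rD_opp (dR x))); ring.
have E1 := ft_resolvent eta fc1 fc2 bwR bwI bfR bfI dR dI.
have E2 := ft_resolvent eta fc2 fc1N bwI bwRN bfI bfRN dI dRN.
rewrite /nsq !Re_fourier !Im_fourier E1 E2.
rewrite (ftN wc1 wc2 (fun x => (h2 x).1) (fun x => (h2 x).2)).
have sn : Num.sqrt (2 * pi) != 0 :> R.
  by apply: lt0r_neq0; rewrite sqrtr_gt0 mulr_gt0// pi_gt0.
by field; rewrite sn lt0r_neq0.
Qed.

Lemma energy_int (f : R -> C) (kap : R) : 1 <= kap -> decaying f ->
  Rint (fun eta => nsq (fourier_integral f eta) / (kap ^+ 2 + eta ^+ 2)).
Proof.
move=> k1 nf; have [i _] := plancherel nf.
have k0 : 0 < kap by apply: lt_le_trans k1.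
have D0 (eta : R) : 1 <= kap ^+ 2 + eta ^+ 2.
  by rewrite -[1]addr0 lerD ?sqr_ge0// exprn_ege1.
apply: (Rint_dom _ i).
  apply: measurable_funM; first exact: Rint_meas i.
  have d (eta : R) : is_derive eta (1:R) (fun eta => kap ^+ 2 + eta ^+ 2) (2 * eta).
    by eapply rD_eq; [rD|ring].
  apply: cont_meas => eta.
  have n0 : kap ^+ 2 + eta ^+ 2 != 0 by apply: lt0r_neq0; apply: lt_le_trans (D0 eta).
  exact: rD_continuous (@rD_inv R (fun eta => kap ^+ 2 + eta ^+ 2) eta _ n0 (d eta)).
move=> eta; have D := lt_le_trans ltr01 (D0 eta).
rewrite ger0_norm ?divr_ge0 ?nsq_ge0// ?(ltW D)//.
by rewrite ler_pdivrMr// ler_peMr ?nsq_ge0.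
Qed.

Lemma energy_lim (f : R -> C) : decaying f ->
  n.+2%:R ^+ 2 * energy n.+2%:R f @[n --> \oo] --> mass f.
Proof.
move=> nf; have [i E] := plancherel nf; rewrite -E.
have en (n : nat) : Rint (fun eta : R => nsq (fourier_integral f eta) / (n.+2%:R ^+ 2 + eta ^+ 2)).
  by apply: energy_int; rewrite ?ler1n.
rewrite (_ : (fun n => _) = (fun n => RI (fun eta => n.+2%:R ^+ 2 *
   (nsq (fourier_integral f eta) / (n.+2%:R ^+ 2 + eta ^+ 2))))); last first.
  by apply/funext => n; rewrite /energy (RIZ _ (en n)).
have D0 (n : nat) (eta : R) : 0 < n.+2%:R ^+ 2 + eta ^+ 2.
  by rewrite ltr_pwDl ?sqr_ge0// exprn_gt0.
apply: (RI_dct (g := fun eta => nsq (fourier_integral f eta)) _ _ i _ _).2.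
- by move=> n; apply: Rint_meas; apply: RintZ; exact: en.
- exact: Rint_meas i.
- move=> n eta; rewrite ger0_norm; last first.
    by rewrite mulr_ge0 ?sqr_ge0// divr_ge0 ?nsq_ge0// ltW.
  rewrite mulrCA ler_piMr ?nsq_ge0// ler_pdivrMr// mul1r lerDl sqr_ge0//.
move=> eta.
pose g (n : nat) := nsq (fourier_integral f eta) * (1 - eta ^+ 2 * wt n.+1%:R * ((1 + n.+1%:R ^+ 2) / (n.+2%:R ^+ 2 + eta ^+ 2))).
rewrite (_ : (fun n => _) = g); last first.
  apply/funext => n; rewrite /g /wt; move: (D0 n eta) (wt_den (n.+1%:R : R)).
  move: (n.+2%:R : R) (n.+1%:R : R) => a b /lt0r_neq0 h1 /lt0r_neq0 h2.
  by field; rewrite ?h1 ?h2.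
rewrite -[X in _ --> X]mulr1 /g; apply: cvgMr.
rewrite -[X in _ --> X]subr0; apply: cvgB; first exact: cvg_cst.
apply: (@squeeze_cvgr _ _ _ _ (fun=> 0) (fun n => eta ^+ 2 * wt n.+1%:R)).
- apply: nearW => n; have w0 := ltW (wt_gt0 (n.+1%:R : R)).
  have p0 : 0 <= (1 + n.+1%:R ^+ 2) / (n.+2%:R ^+ 2 + eta ^+ 2) by rewrite divr_ge0 ?(ltW (wt_den _))// ltW.
  have p1 : (1 + n.+1%:R ^+ 2) / (n.+2%:R ^+ 2 + eta ^+ 2) <= 1.
    rewrite ler_pdivrMr// mul1r; have g1 := sqr_ge0 eta; have g2 : 0 <= n.+1%:R :> R by [].
    have -> : n.+2%:R = n.+1%:R + 1 :> R by rewrite natr1.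
    move: (n.+1%:R : R) g2 => b g2; nra.
  have e2 := mulr_ge0 (sqr_ge0 eta) w0.
  by apply/andP; split; [exact: mulr_ge0|exact: ler_piMr].
- exact: cvg_cst.
- exact: wt_lim.
Qed.
End ResolventEnergy.

Section MassConservation.
Context {R : realType}.
Local Notation C := R[i].
Local Notation Re := (@complex.Re R).
Local Notation Im := (@complex.Im R).
Variables (q qt qx qxx : R -> R -> C).
Hypothesis fl : nls_flow q qt qx qxx.
Hypothesis decayingq : forall t, decaying (q^~ t).
Let M t := mass (q^~ t).

Lemma energy_compare (kap m t1 t2 s1 s2 : R) : 2 <= kap -> 0 < m -> 8 * m <= kap -> t1 <= t2 ->
  (forall t, t1 <= t <= t2 -> M t <= m) ->
  (s1 = t1 /\ s2 = t2) \/ (s1 = t2 /\ s2 = t1) ->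
  (1 - 2 * (2 * m / kap)) * energy kap (q^~ s1) <=
  (1 + 3 * (2 * m / kap)) * ((1 + 2 * m / kap) * energy kap (q^~ s2)).
Proof.
move=> k2 m0 mk t12 hm ss.
have k0 : 0 < kap by apply: lt_le_trans k2.
have [w1 n1 d1] := resolvent k2 (decayingq s1); have [w2 n2 d2] := resolvent k2 (decayingq s2).
rewrite -(resolvent_energy k0 (decayingq s1) n1 d1) -(resolvent_energy k0 (decayingq s2) n2 d2).
exact: (resolvent_mass_compare fl decayingq k2 m0 mk t12 hm ss n1 d1 n2 d2).
Qed.

(** Multiplied by [kap^2], the energies tend to the masses, and the factors in
    [energy_compare] tend to 1. *)
Lemma mass_rigid : rigid M.
Proof.
move=> t1 t2 m0 t12 hm0.
pose m := Num.max m0 1.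
have m1 : 1 <= m by rewrite le_max lexx orbT.
have m_gt0 : 0 < m by apply: lt_le_trans m1.
have hm t : t1 <= t <= t2 -> M t <= m by move=> /hm0 h; rewrite le_max h.
suff H s1 s2 : (s1 = t1 /\ s2 = t2) \/ (s1 = t2 /\ s2 = t1) -> M s1 <= M s2.
  by apply/eqP; rewrite eq_le; apply/andP; split; apply: H; [left|right].
move=> ss.
pose th (n : nat) : R := 2 * m / n.+2%:R.
have thl : th n @[n --> \oo] --> 0.
  rewrite -(mulr0 (2 * m)); apply: cvgMr.
  by have := @cvg_harmonic R; rewrite -cvg_shiftS.
have L1 : (1 - 2 * th n) * (n.+2%:R ^+ 2 * energy n.+2%:R (q^~ s1)) @[n --> \oo] --> (1 - 2 * 0) * M s1.
  apply: cvgM; last exact: energy_lim.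
  by apply: cvgB; [exact: cvg_cst|exact: cvgMr].
have L2 : (1 + 3 * th n) * ((1 + th n) * (n.+2%:R ^+ 2 * energy n.+2%:R (q^~ s2))) @[n --> \oo] -->
   (1 + 3 * 0) * ((1 + 0) * M s2).
  apply: cvgM; first by apply: cvgD; [exact: cvg_cst|exact: cvgMr].
  apply: cvgM; last exact: energy_lim.
  by apply: cvgD; [exact: cvg_cst|exact: thl].
rewrite !mulr0 subr0 !addr0 !mul1r in L1 L2.
rewrite -(cvg_lim _ L1)// -(cvg_lim _ L2)//.
apply: ler_lim; [exact: (cvgP _ L1)|exact: (cvgP _ L2)|].
exists (Num.truncn (8 * m)) => // n /= hn.
have nk : 8 * m <= n.+2%:R.
  have /andP[_ /ltW h] := truncn_itv (ltW (mulr_gt0 (ltr0Sn R 7) m_gt0)).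
  by apply: le_trans h _; rewrite ler_nat; apply: leq_trans hn _.
have n2 : 2 <= n.+2%:R :> R by rewrite ler_nat.
have h := energy_compare n2 m_gt0 nk t12 hm ss.
have p0 : 0 <= n.+2%:R ^+ 2 :> R by exact: sqr_ge0.
have {h} := ler_wpM2l p0 h; rewrite -/(th n).
by rewrite mulrCA [X in _ <= X -> _]mulrCA [X in _ <= _ * X -> _]mulrCA.
Qed.

(** The mass is the supremum of the masses on bounded windows, which are continuous in time. *)
Lemma mass_lsc : lsc M.
Proof.
move=> t c cM.
have prim s : exists P : R -> R, forall x, is_derive x (1:R) P (nsq (q x s)).
  by have [P [_ dP]] := continuous_primitive (cont_nsq (decayingq s).1); exists P.
have [P dP] := prim t.
pose e := (M t - c) / 4.
have e0 : 0 < e by rewrite divr_gt0// subr_gt0.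
have [L0 hL0] := mass_primitive_near (decayingq t) e0 dP.
pose L := Num.max L0 1.
have L1 : 1 <= L by rewrite le_max lexx orbT.
have hL := hL0 L; rewrite le_max lexx /= in hL; have {}hL := hL isT.
have cN : continuous (fun p : R * R => nsq (q p.1 p.2)).
  have [c1 c2] := flow_c fl; rewrite /nsq => p.
  rewrite (_ : (fun p => _) = (fun p : R * R => Re (q p.1 p.2) * Re (q p.1 p.2) + Im (q p.1 p.2) * Im (q p.1 p.2))); last first.
    by apply/funext => y; rewrite !expr2.
  by apply: cvgD; apply: cvgM; [exact: c1|exact: c1|exact: c2|exact: c2].
have e1 : 0 < e / L by rewrite divr_gt0// (lt_le_trans ltr01 L1).
have [d d0 hd] := @uniform_in_time R (fun x s => nsq (q x s)) L t (e / L) cN e1.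
exists d => // s sd; have [Q dQ] := prim s.
have LL : - L <= L by lra.
have hs : ball t d s by rewrite /ball /= distrC.
have dl (x : R) : is_derive x (1:R) (fun x => e / L * x) (e / L) by eapply rD_eq; [rD|ring].
have dd x : - L <= x <= L -> is_derive x (1:R) (fun x => Q x - P x + e / L * x) (nsq (q x s) - nsq (q x t) + e / L).
  by move=> _; exact: rD_add (rD_sub (dQ x) (dP x)) (dl x).
have lo x : - L <= x <= L -> 0 <= nsq (q x s) - nsq (q x t) + e / L.
  by rewrite -ler_norml => /(hd s hs x); rewrite ler_norml => /andP[? ?]; lra.
have h1 := ler_of_derive LL dd lo.
have h2 := mass_primitive_le (decayingq s) dQ (- L) L.
have h3 : e / L * (L - - L) = 2 * e by field; apply: lt0r_neq0; apply: lt_le_trans L1.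
rewrite -/(M t) in hL; rewrite -/(M s) in h2; rewrite /e in h1 h3 hL *.
move: h1 h2 h3 hL; lra.
Qed.

Theorem mass_conserved t : mass (q^~ t) = mass (q^~ 0).
Proof. exact: (lsc_rigid_constant t mass_lsc mass_rigid). Qed.
End MassConservation.

(** * From energies to Sobolev norms of negative order *)

Section Interpolation.
Context {R : realType}.
Local Notation C := R[i].
Local Notation Re := (@complex.Re R).
Local Notation Im := (@complex.Im R).
Local Notation mT := (measurable_fun [set: R * R]).

(** The kernel [lam^(- sg) / (1 + lam)] of Stieltjes, with its measure, in the variable
    [y = log lam]. *)
Definition mellin (sg y : R) : R := expR ((1 - sg) * y) / (1 + expR y).

Lemma mellin_gt0 sg y : 0 < mellin sg y.
Proof. by rewrite divr_gt0 ?addr_gt0 ?expR_gt0. Qed.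

Lemma c_mellin sg : continuous (mellin sg).
Proof.
move=> y; have n0 : 1 + expR y != 0 by rewrite lt0r_neq0// addr_gt0 ?expR_gt0.
have d1 : is_derive y (1:R) (fun y => (1 - sg) * y) (1 - sg) by eapply rD_eq; [rD|ring].
have d2 : is_derive y (1:R) (fun y => 1 + expR y) (expR y).
  by apply: (rD_eq (rD_add (rD_cst 1 y) (is_derive_expR y))); rewrite add0r.
exact: rD_continuous (rD_mul (rD_exp d1) (@rD_inv R (fun y => 1 + expR y) y _ n0 d2)).
Qed.

Lemma mellin_le sg y : 0 < sg -> sg < 1 -> mellin sg y <= abel (Num.min sg (1 - sg)) y.
Proof.
move=> s0 s1; rewrite /mellin ler_pdivrMr ?addr_gt0 ?expR_gt0// mulrDr mulr1.
have g0 : 0 <= abel (Num.min sg (1 - sg)) y := ltW (abel_gt0 _ _).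
have m1 : Num.min sg (1 - sg) <= sg by rewrite ge_min lexx.
have m2 : Num.min sg (1 - sg) <= 1 - sg by rewrite ge_min lexx orbT.
have [y0|/ltW y0] := leP 0 y.
  apply: (@le_trans _ _ (abel (Num.min sg (1 - sg)) y * expR y)); last by rewrite lerDr.
  by rewrite abel_pos// -expRD ler_expR; nra.
apply: (@le_trans _ _ (abel (Num.min sg (1 - sg)) y)); last first.
  by rewrite lerDl mulr_ge0// expR_ge0.
by rewrite abel_neg// ler_expR; nra.
Qed.

Lemma Rint_mellin sg : 0 < sg -> sg < 1 -> Rint (mellin sg).
Proof.
move=> s0 s1; have m0 : 0 < Num.min sg (1 - sg) by rewrite lt_min s0 subr_gt0.
apply: (Rint_dom (cont_meas (c_mellin (sg := sg))) (Rint_abel m0)) => y.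
by rewrite ger0_norm ?mellin_le// ltW// mellin_gt0.
Qed.

Lemma RI_mellin_gt0 sg : 0 < sg -> sg < 1 -> 0 < RI (mellin sg).
Proof.
move=> s0 s1; have i := Rint_mellin s0 s1.
have [F [_ dF]] := continuous_primitive (c_mellin (sg := sg)).
have mono (x y : R) : x <= y -> F x <= F y.
  by move=> xy; apply: (ler_of_derive xy (fun z _ => dF z)) => z _; exact: ltW (mellin_gt0 _ _).
have lim := cvg_primitive (c_mellin (sg := sg)) i dF natS_cofinal.
have : F 1 - F (-1) <= RI (mellin sg).
  rewrite -(cvg_lim _ lim)//; apply: limr_ge; first exact: (cvgP _ lim).
  by apply: nearW => n; apply: lerB; apply: mono; rewrite ?lerN2 ler1n.
apply: lt_le_trans.
pose K := expR (- (1 - sg)) / (1 + expR 1).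
have K0 : 0 < K by rewrite divr_gt0 ?addr_gt0 ?expR_gt0.
have dl (x : R) : is_derive x (1:R) (fun x => F x - K * x) (mellin sg x - K).
  have h := dF x; have h2 : is_derive x (1:R) (fun x => K * x) K by eapply rD_eq; [rD|ring].
  exact: rD_sub.
have le11 : (-1 : R) <= 1 by lra.
have := ler_of_derive le11 (fun z _ => dl z).
suff lo x : -1 <= x <= 1 -> 0 <= mellin sg x - K by move=> /(_ lo); lra.
move=> /andP[x1 x2]; rewrite subr_ge0 /mellin /K; apply: ler_pM.
- exact: expR_ge0.
- by rewrite invr_ge0 addr_ge0 ?expR_ge0.
- by rewrite ler_expR; nra.
- by rewrite lef_pV2 ?posrE ?addr_gt0 ?expR_gt0// lerD2l ler_expR.
Qed.

(** A dilation in [lam] is a translation in [y]. *)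
Lemma mellin_power sg x : 0 < sg -> sg < 1 -> 0 < x ->
  Rint (fun y => expR ((1 - sg) * y) / (expR y + x)) /\
  RI (fun y => expR ((1 - sg) * y) / (expR y + x)) = x `^ (- sg) * RI (mellin sg).
Proof.
move=> s0 s1 x0; have i := Rint_mellin s0 s1.
have E : (fun y => expR ((1 - sg) * y) / (expR y + x)) = (fun y => x `^ (- sg) * mellin sg (- ln x + 1 * y)).
  apply/funext => y; rewrite /powR gt_eqF// /mellin mul1r mulrDr !expRD.
  rewrite (_ : - sg * ln x = - ((1 - sg) * - ln x) - ln x); last by ring.
  rewrite expRD [expR (- ((1 - sg) * - ln x))]expRN expRN lnK ?posrE//.
  have h1 := lt0r_neq0 (expR_gt0 ((1 - sg) * - ln x)).
  have h2 := lt0r_neq0 x0.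
  have h3 : expR y + x != 0 by rewrite lt0r_neq0// addr_gt0// expR_gt0.
  by field; rewrite h1 h2 addrC h3.
have i2 : Rint (fun y => mellin sg (- ln x + 1 * y)).
  have m0 : 0 < Num.min sg (1 - sg) by rewrite lt_min s0 subr_gt0.
  pose a := Num.min sg (1 - sg).
  apply: (Rint_dom _ (RintZ (expR (a * `|ln x|)) (Rint_abel m0))).
    apply: cont_meas => /= y; have dl : is_derive y (1:R) (fun y => - ln x + 1 * y) 1.
      by eapply rD_eq; [rD|ring].
    exact: (@continuous_comp R R R (fun y => - ln x + 1 * y) (mellin sg) y (rD_continuous dl) (@c_mellin sg _)).
  move=> y; rewrite ger0_norm; last by rewrite ltW// mellin_gt0.
  apply: le_trans (mellin_le _ s0 s1) _; rewrite -/a /abel -expRD ler_expR mul1r.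
  have := ler_normD (- ln x + y) (ln x).
  have -> : - ln x + y + ln x = y by ring.
  have a0 : 0 < a by [].
  nra.
rewrite E; split; first exact: RintZ.
rewrite (RIZ _ i2); congr (_ * _).
by rewrite (RI_affine ltr01 (c_mellin (sg := sg)) i i2) mul1r.
Qed.

(** The identity [mellin_power] integrated against the spectral density [N]. *)
Lemma stieltjes (N : R -> R) (k sg : R) : 0 < sg -> sg < 1 -> 1 <= k ->
  (forall eta, 0 <= N eta) -> Rint N ->
  Rint (fun y => expR ((1 - sg) * y) * RI (fun eta => N eta / (expR y + (k ^+ 2 + eta ^+ 2)))) /\
  RI (mellin sg) * RI (fun eta => N eta * (k ^+ 2 + eta ^+ 2) `^ (- sg)) =
  RI (fun y => expR ((1 - sg) * y) * RI (fun eta => N eta / (expR y + (k ^+ 2 + eta ^+ 2)))).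
Proof.
move=> s0 s1 k1 N0 iN.
have X1 eta : 1 <= k ^+ 2 + eta ^+ 2 by rewrite -[1]addr0 lerD ?sqr_ge0// exprn_ege1.
have X0 eta : 0 < k ^+ 2 + eta ^+ 2 by exact: lt_le_trans (X1 eta).
have D0 y eta : 0 < expR y + (k ^+ 2 + eta ^+ 2) by rewrite addr_gt0// expR_gt0.
pose h y eta := N eta * (expR ((1 - sg) * y) / (expR y + (k ^+ 2 + eta ^+ 2))).
have mh : mT (fun p : R * R => h p.1 p.2).
  have mN : mT (fun p : R * R => N p.2) by apply: (mcomp (Rint_meas iN)); exact: msnd.
  apply: (mmul mN); apply: mmul.
    apply: mcomp; first by apply: cont_meas; exact: continuous_expR.
    by apply: mmul; [exact: measurable_cst|exact: mfst].
  rewrite (_ : (fun p => _) = (fun p : R * R => expR (- ln (expR p.1 + (k ^+ 2 + p.2 ^+ 2))))); last first.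
    by apply/funext => p; rewrite expRN lnK ?posrE.
  apply: mcomp; first by apply: cont_meas; exact: continuous_expR.
  apply: measurableT_comp; first exact: oppr_measurable.
  apply: mcomp; first exact: measurable_ln.
  apply: madd; first by apply: mcomp; [apply: cont_meas; exact: continuous_expR|exact: mfst].
  by apply: madd; [exact: measurable_cst|apply: measurable_funX; exact: msnd].
have bh y eta : `|h y eta| <= mellin sg y * N eta.
  rewrite ger0_norm; last by rewrite mulr_ge0// divr_ge0 ?expR_ge0// ltW.
  rewrite /h mulrC ler_wpM2r// /mellin ler_wpM2l ?expR_ge0//.
  have p1 : 0 < 1 + expR y by rewrite addr_gt0 ?expR_gt0.
  have p2 := D0 y eta.
  by rewrite lef_pV2 ?posrE// [leLHS]addrC lerD2l.
have [ia ib ja jb E] := RI_fubini mh (Rint_mellin s0 s1) iN (fun y => ltW (mellin_gt0 sg y)) N0 bh.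
have i2 y : Rint (fun eta => N eta / (expR y + (k ^+ 2 + eta ^+ 2))).
  apply: (eq_ind _ (fun g => Rint g) (RintZ (expR (- ((1 - sg) * y))) (ia y))).
  apply/funext => eta; rewrite /h expRN.
  have h1 := lt0r_neq0 (expR_gt0 ((1 - sg) * y)); have h2 := lt0r_neq0 (D0 y eta).
  by field; rewrite h1 h2.
have E1 : (fun y => RI (h y)) =
    (fun y => expR ((1 - sg) * y) * RI (fun eta => N eta / (expR y + (k ^+ 2 + eta ^+ 2)))).
  apply/funext => y; rewrite -(RIZ _ (i2 y)); congr RI; apply/funext => eta.
  by rewrite /h mulrCA.
have E2 : (fun eta => RI (h^~ eta)) = (fun eta => RI (mellin sg) * (N eta * (k ^+ 2 + eta ^+ 2) `^ (- sg))).
  apply/funext => eta; have [j1 j2] := mellin_power s0 s1 (X0 eta).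
  by rewrite /h (RIZ (N eta) j1) j2; ring.
have c0 := RI_mellin_gt0 s0 s1.
have i3 : Rint (fun eta => N eta * (k ^+ 2 + eta ^+ 2) `^ (- sg)).
  apply: (eq_ind _ (fun g => Rint g) (RintZ (RI (mellin sg))^-1 (eq_ind _ (fun g => Rint g) jb _ E2))).
  by apply/funext => eta; rewrite (mulKf (lt0r_neq0 c0)).
split; first exact: (eq_ind _ (fun g => Rint g) ja _ E1).
rewrite -(RIZ _ i3).
exact: (etrans (congr1 RI (esym E2)) (etrans (esym E) (congr1 RI E1))).
Qed.

(** The endpoints [s = 0] and [s = -1] are the mass and the energy at [kap = k]; in between,
    the comparison is integrated over [kap^2 = exp y + k^2]. *)
Lemma energy_interpolation (f g : R -> C) (k B s : R) : 1 <= k -> 0 <= B -> -1 <= s <= 0 ->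
  decaying f -> decaying g -> mass f <= B * mass g ->
  (forall kap, k <= kap -> energy kap f <= B * energy kap g) ->
  RI (fun eta => nsq (fourier_integral f eta) * (k ^+ 2 + eta ^+ 2) `^ s) <=
  B * RI (fun eta => nsq (fourier_integral g eta) * (k ^+ 2 + eta ^+ 2) `^ s).
Proof.
move=> k1 B0 /andP[s1 s0] nf ng mfg efg.
have X0 eta : 0 < k ^+ 2 + eta ^+ 2.
  by apply: (lt_le_trans ltr01); rewrite -[1]addr0 lerD ?sqr_ge0// exprn_ege1.
have [if_ Ef] := plancherel nf; have [ig Eg] := plancherel ng.
have [->|sn0] := eqVneq s 0.
  have E (h : R -> C) : (fun eta => nsq (fourier_integral h eta) * (k ^+ 2 + eta ^+ 2) `^ 0) =
      (fun eta => nsq (fourier_integral h eta)).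
    by apply/funext => eta; rewrite powRr0 mulr1.
  by rewrite !E Ef Eg.
have [->|sn1] := eqVneq s (-1).
  have E (h : R -> C) : (fun eta => nsq (fourier_integral h eta) * (k ^+ 2 + eta ^+ 2) `^ (-1)) =
      (fun eta => nsq (fourier_integral h eta) / (k ^+ 2 + eta ^+ 2)).
    by apply/funext => eta; rewrite powR_inv1// ltW.
  by rewrite !E; exact: efg.
have sg0 : 0 < - s by rewrite oppr_gt0 lt_neqAle sn0.
have sg1 : - s < 1 by rewrite ltrNl lt_neqAle eq_sym sn1.
rewrite -(opprK s); move: (- s) sg0 sg1 => sg sg0 sg1.
have [i1 E1] := stieltjes sg0 sg1 k1 (fun eta => nsq_ge0 (fourier_integral f eta)) if_.
have [i2 E2] := stieltjes sg0 sg1 k1 (fun eta => nsq_ge0 (fourier_integral g eta)) ig.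
have c0 := RI_mellin_gt0 sg0 sg1.
have cancel_c (c a b x y : R) : 0 < c -> c * a = x -> c * b = y -> x <= B * y -> a <= B * b.
  by move=> cc ca cb xy; rewrite -(ler_pM2l cc) mulrCA ca cb.
apply: (cancel_c _ _ _ _ _ c0 E1 E2).
apply: le_trans (eq_ind _ (fun z => _ <= z) (RI_le i1 (RintZ B i2) _) _ (RIZ B i2)) (lexx _) => y.
rewrite [leRHS]mulrCA; apply: ler_wpM2l; first exact: expR_ge0.
have kk : k <= Num.sqrt (expR y + k ^+ 2).
  have k0 : 0 <= k := le_trans ler01 k1.
  rewrite -[leLHS](ger0_norm k0) -sqrtr_sqr ler_sqrt ?addr_ge0 ?expR_ge0 ?sqr_ge0//.
  by rewrite lerDr expR_ge0.
have := efg _ kk; rewrite /energy sqr_sqrtr ?addr_ge0 ?expR_ge0 ?sqr_ge0//.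
have E (h : R -> C) : (fun eta => nsq (fourier_integral h eta) / (expR y + k ^+ 2 + eta ^+ 2)) =
      (fun eta => nsq (fourier_integral h eta) / (expR y + (k ^+ 2 + eta ^+ 2))).
  by apply/funext => eta; rewrite addrA.
by rewrite !E.
Qed.
End Interpolation.

(** * The space of square integrable functions *)

Section L2.
Context {R : realType}.
Local Notation C := R[i].
Local Notation Re := (@complex.Re R).
Local Notation Im := (@complex.Im R).
Local Notation mu := (@lebesgue_measure R).
Implicit Types (f g : R -> C).

Definition sqint f : Prop := cmeasurable f /\ Rint (fun x => nsq (f x)).

Lemma nsq_meas f : cmeasurable f -> measurable_fun [set: R] (fun x => nsq (f x)).
Proof. by move=> [m1 m2]; apply: measurable_funD; exact: measurable_funX. Qed.

Lemma cmeasurableB f g : cmeasurable f -> cmeasurable g -> cmeasurable (fun x => f x - g x).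
Proof.
move=> [m1 m2] [n1 n2]; split.
  by under eq_fun do rewrite ReD ReN; exact: measurable_funB.
by under eq_fun do rewrite ImD ImN; exact: measurable_funB.
Qed.

Lemma nsq_parallelogram (z w : C) : nsq (z - w) <= 2 * nsq z + 2 * nsq w.
Proof. by have := @nsqD R 1 z (- w) ltr01; rewrite nsqN invr1; lra. Qed.

Lemma nsqBC (z w : C) : nsq (z - w) = nsq (w - z).
Proof. by rewrite -nsqN opprB. Qed.

Lemma sqintB f g : sqint f -> sqint g -> sqint (fun x => f x - g x).
Proof.
move=> [m1 i1] [m2 i2]; split; first exact: cmeasurableB.
apply: (Rint_dom (nsq_meas (cmeasurableB m1 m2)) (RintD (RintZ 2 i1) (RintZ 2 i2))) => x.
by rewrite ger0_norm ?nsq_ge0//; exact: nsq_parallelogram.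
Qed.

Lemma mass_ge0 f : 0 <= mass f.
Proof. by apply: RI_ge0 => x; exact: nsq_ge0. Qed.

Lemma mass_parallelogram f g : sqint f -> sqint g ->
  mass (fun x => f x - g x) <= 2 * mass f + 2 * mass g.
Proof.
move=> hf hg; rewrite /mass -(RIZ 2 hf.2) -(RIZ 2 hg.2) -(RID (RintZ 2 hf.2) (RintZ 2 hg.2)).
apply: (RI_le (sqintB hf hg).2 (RintD (RintZ 2 hf.2) (RintZ 2 hg.2))) => x.
exact: nsq_parallelogram.
Qed.

Lemma mass_triangle f g h : sqint f -> sqint g -> sqint h ->
  mass (fun x => f x - h x) <= 2 * mass (fun x => f x - g x) + 2 * mass (fun x => g x - h x).
Proof.
move=> hf hg hh; have := mass_parallelogram (sqintB hf hg) (sqintB hh hg).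
rewrite (_ : (fun x => f x - g x - (h x - g x)) = (fun x => f x - h x)); last first.
  by apply/funext => x; ring.
rewrite (_ : mass (fun x => h x - g x) = mass (fun x => g x - h x))//.
by congr RI; apply/funext => x; rewrite nsqBC.
Qed.

Lemma L2norm_eq f : cmeasurable f ->
  L2norm f = ((\int[mu]_x (nsq (f x))%:E) `^ 2^-1)%E.
Proof.
move=> mf; rewrite /L2norm unlock; congr (_ `^ _)%E; apply: eq_integral => x _ /=.
rewrite ger0_norm; last by rewrite normcE' sqrtr_ge0.
by rewrite powR_mulrn ?normc_nsq// normcE' sqrtr_ge0.
Qed.

Lemma L2norm_sqint f : sqint f -> L2norm f = (Num.sqrt (mass f))%:E.
Proof.
move=> [mf i]; rewrite (L2norm_eq mf) (RI_EFin i) poweR_EFin powR12_sqrt//.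
exact: mass_ge0.
Qed.

Lemma in_L2P f : in_L2 f <-> sqint f.
Proof.
split=> [[mf]|h]; last first.
  by split; [case: h|rewrite L2norm_sqint// ltry].
rewrite (L2norm_eq mf) => h; split => //; apply/integrableP; split.
  by apply/measurable_EFinP; exact: nsq_meas.
rewrite (_ : (\int[mu]_x `|_|)%E = (\int[mu]_x (nsq (f x))%:E)%E); last first.
  by apply: eq_integral => x _; rewrite /= ger0_norm ?nsq_ge0.
by apply: lty_poweRy h; rewrite invr_eq0.
Qed.

Lemma cvg_L2P (fn : nat -> R -> C) f : (forall n, sqint (fn n)) -> sqint f ->
  cvg_L2 fn f <-> mass (fun x => fn n x - f x) @[n --> \oo] --> 0.
Proof.
move=> hn hf.
have E : (fun n => L2norm (fun x => fn n x - f x)) = (fun n => (Num.sqrt (mass (fun x => fn n x - f x)))%:E).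
  by apply/funext => n; rewrite L2norm_sqint//; exact: sqintB.
rewrite /cvg_L2 E; split=> h.
  have h2 : Num.sqrt (mass (fun x => fn n x - f x)) @[n --> \oo] --> 0 by exact: fine_cvg h.
  rewrite (_ : (fun n => _) = (fun n => Num.sqrt (mass (fun x => fn n x - f x)) *
      Num.sqrt (mass (fun x => fn n x - f x)))); last first.
    by apply/funext => n; rewrite -expr2 sqr_sqrtr// mass_ge0.
  by rewrite -[X in _ --> X](mulr0 0); exact: cvgM.
apply: cvg_EFin; first exact: nearW.
rewrite -[X in _ --> X]sqrtr0.
exact: (@continuous_cvg _ _ _ _ _ (fun n => mass (fun x => fn n x - f x)) Num.sqrt 0 (@sqrt_continuous R 0) h).
Qed.

Lemma RI_ae (f g : R -> R) : measurable_fun [set: R] f -> measurable_fun [set: R] g ->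
  {ae mu, forall x, f x = g x} -> RI f = RI g.
Proof.
move=> mf mg fg; congr fine; apply: ae_eq_integral => //; [exact/measurable_EFinP|exact/measurable_EFinP|].
by apply: (@filterS _ _ (ae_filter_ringOfSetsType mu) _ _ _ fg) => x /= -> _.
Qed.

(** The sum of the series has a finite integral, hence is finite almost everywhere. *)
Lemma beppo_levi (d : nat -> R -> R) (B : R) : (forall n x, 0 <= d n x) ->
  (forall n, Rint (d n)) -> (forall n, \sum_(k < n) RI (d k) <= B) ->
  exists (A : set R) (s : R -> R), [/\ measurable A, {ae mu, forall x, A x}, Rint s,
    (forall x, 0 <= s x) & forall x, A x -> forall n, \sum_(k < n) d k x <= s x].
Proof.
move=> d0 id hB.
pose S x := (\sum_(k <oo) (d k x)%:E)%E.
have S0 x : (0 <= S x)%E by apply: nneseries_ge0 => k _ _; rewrite lee_fin.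
have mS : measurable_fun [set: R] S.
  apply: (@ge0_emeasurable_sum _ _ R [set: R] (fun k x => (d k x)%:E) xpredT).
    by move=> k x _ _; rewrite lee_fin.
  by move=> k _; apply/measurable_EFinP; exact: Rint_meas.
have intS : (\int[mu]_x S x <= B%:E)%E.
  rewrite integral_nneseries//; last 2 first.
  - by move=> n; apply/measurable_EFinP; exact: Rint_meas.
  - by move=> n x _; rewrite lee_fin.
  apply: lime_le; first by apply: is_cvg_nneseries => n _ _; apply: integral_ge0 => x _; rewrite lee_fin.
  apply: nearW => n; rewrite big_mkord.
  under eq_bigr do rewrite (RI_EFin (id _)).
  by rewrite sumEFin lee_fin.
have iS : mu.-integrable [set: R] S.
  apply/integrableP; split => //.
  rewrite (_ : (\int[mu]_x `|S x|)%E = (\int[mu]_x S x)%E).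
    exact: le_lt_trans intS (ltry _).
  by apply: eq_integral => x _; rewrite gee0_abs.
pose s x := fine (S x).
have ms : measurable_fun [set: R] s by exact: (measurableT_comp (@fine_measurable R setT measurableT) mS).
exists [set x | S x \is a fin_num], s; split.
- by rewrite -[X in measurable X]setTI; exact: emeasurable_fin_num.
- apply: (@filterS _ _ (ae_filter_ringOfSetsType mu) _ _ _ (integrable_ae measurableT iS)) => x.
  exact.
- apply: (le_integrable _ _ _ iS) => //; first exact/measurable_EFinP.
  move=> x _ /=; rewrite /s; by case: (S x) => [r||] /=; rewrite ?normr0 ?leey.
- by move=> x; exact: fine_ge0.
- move=> x /= fx n; rewrite -lee_fin /s fineK// -sumEFin.
  rewrite /S -(big_mkord xpredT (fun k => (d k x)%:E)).
  by apply: nneseries_lim_ge => k _; rewrite lee_fin.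
Qed.

(** Against the weights [2^k] the squares of the increments control the squares of all later
    differences, at the cost of a factor 2. *)
Lemma telescope_nsq (a : nat -> C) (s : R) :
  (forall n, \sum_(k < n) 2 ^+ k * nsq (a k.+1 - a k) <= s) ->
  forall j m, nsq (a (j + m)%N - a j) <= 2 * (2 ^+ j)^-1 * s.
Proof.
move=> hs.
pose D k : R := 2 ^+ k * nsq (a k.+1 - a k).
have D0 k : 0 <= D k by rewrite mulr_ge0 ?nsq_ge0// exprn_ge0.
have main m : forall j, nsq (a (j + m)%N - a j) <= 2 * (2 ^+ j)^-1 * \sum_(j <= k < j + m) D k.
  elim: m => [|m IH] j.
    by rewrite addn0 subrr nsq0 big_geq// mulr0.
  have := @nsqD R 1 (a j.+1 - a j) (a (j + m.+1)%N - a j.+1) ltr01.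
  have -> : a j.+1 - a j + (a (j + m.+1)%N - a j.+1) = a (j + m.+1)%N - a j by ring.
  rewrite invr1 => h; apply: le_trans h _.
  have jm : (j < j + m.+1)%N by rewrite addnS ltnS leq_addr.
  rewrite (big_ltn jm).
  have := IH j.+1; rewrite addSnnS.
  set S := \sum_(j.+1 <= _ < _) _ => h.
  have E : 2 * (2 ^+ j)^-1 * D j = 2 * nsq (a j.+1 - a j).
    by rewrite /D mulrA -[2 * _ * _]mulrA mulVf ?mulr1// expf_neq0.
  have E2 : 2 * (2 ^+ j.+1)^-1 = (2 ^+ j)^-1 :> R.
    by rewrite exprS invfM mulrA divff ?mul1r.
  rewrite E2 in h.
  have E3 : 2 * (2 ^+ j)^-1 * (D j + S) = 2 * nsq (a j.+1 - a j) + 2 * ((2 ^+ j)^-1 * S).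
    by rewrite mulrDr E mulrA.
  rewrite E3.
  apply: lerD; first by rewrite (_ : 1 + 1 = 2 :> R).
  by rewrite (_ : 1 + 1 = 2 :> R)// ler_pM2l.
move=> j m; apply: le_trans (main m j) _.
apply: ler_wpM2l; first by rewrite mulr_ge0 ?invr_ge0 ?exprn_ge0.
apply: le_trans (hs (j + m)%N).
rewrite -(big_mkord xpredT D) (@big_cat_nat _ _ _ j 0%N (j + m)%N)//= ?leq_addr//.
by rewrite lerDr; apply: sumr_ge0 => k _.
Qed.

Lemma pow2_cvg0 (s : R) : 2 * (2 ^+ j)^-1 * s @[j --> \oo] --> 0.
Proof.
rewrite (_ : (fun j => _) = (fun j => 2 * s * (2^-1) ^+ j)); last first.
  by apply/funext => j; rewrite exprVn; ring.
rewrite -(mulr0 (2 * s)); apply: cvgMr; apply: cvg_expr.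
by rewrite ger0_norm ?invr_ge0// invf_lt1// ltr1n.
Qed.

Lemma telescope_cvg (a : nat -> C) (s : R) :
  (forall n, \sum_(k < n) 2 ^+ k * nsq (a k.+1 - a k) <= s) ->
  exists l : C, [/\ Re (a k) @[k --> \oo] --> Re l, Im (a k) @[k --> \oo] --> Im l &
    forall j, nsq (a j - l) <= 2 * (2 ^+ j)^-1 * s].
Proof.
move=> hs; have T := telescope_nsq hs.
have part (p : C -> R) : (forall z w, (p z - p w) ^+ 2 <= nsq (z - w)) ->
    exists l : R, p (a k) @[k --> \oo] --> l.
  move=> hp; suff h : cvg (p (a k) @[k --> \oo]) by exists (lim (p (a k) @[k --> \oo])); exact: h.
  apply: cauchy_cvg; apply: cauchy_exP => e e0.
  have e20 : 0 < e ^+ 2 by rewrite exprn_gt0.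
  have /(@cvgrPdist_lt _ R^o) /(_ _ e20) [j _ hj] := pow2_cvg0 s.
  exists (p (a j)); exists j => // n /= jn.
  have := hj j (leqnn j); rewrite /= sub0r normrN => h.
  rewrite /ball /= -(ltr_sqr (normr_ge0 _) (ltW e0)) real_normK ?num_real//.
  apply: le_lt_trans (hp _ _) _; rewrite nsqBC -(subnKC jn).
  by apply: le_lt_trans (T _ _) _; apply: le_lt_trans (ler_norm _) h.
have [l1 h1] : exists l : R, Re (a k) @[k --> \oo] --> l.
  by apply: part => z w; rewrite /nsq ReD ReN lerDl sqr_ge0.
have [l2 h2] : exists l : R, Im (a k) @[k --> \oo] --> l.
  by apply: part => z w; rewrite /nsq ImD ImN lerDr sqr_ge0.
exists (l1 +i* l2); split => // j.
have lim : (Re (a j) - Re (a n)) ^+ 2 + (Im (a j) - Im (a n)) ^+ 2 @[n --> \oo] -->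
   (Re (a j) - l1) ^+ 2 + (Im (a j) - l2) ^+ 2.
  rewrite (_ : (fun n => _) = (fun n => (Re (a j) - Re (a n)) * (Re (a j) - Re (a n)) +
     (Im (a j) - Im (a n)) * (Im (a j) - Im (a n)))); last by apply/funext => n; rewrite !expr2.
  rewrite !expr2; apply: cvgD; apply: cvgM; apply: cvgB => //; exact: cvg_cst.
rewrite /nsq ReD ReN ImD ImN /= -(cvg_lim _ lim)//; apply: limr_le; first exact: (cvgP _ lim).
exists j => // n /= jn; have := T j (n - j)%N; rewrite subnKC// nsqBC.
by rewrite /nsq ReD ReN ImD ImN.
Qed.

Lemma fast_subsequence (D : nat -> nat -> R) :
  (forall e, 0 < e -> exists N, forall n m, (N <= n)%N -> (N <= m)%N -> D n m <= e) ->
  exists phi : nat -> nat, [/\ forall k, (k <= phi k)%N, forall k, (phi k <= phi k.+1)%N &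
    forall k n, (phi k <= n)%N -> D n (phi k) <= (4 ^+ k)^-1].
Proof.
move=> hD.
have ex (k : nat) : exists N, forall n m, (N <= n)%N -> (N <= m)%N -> D n m <= (4 ^+ k)^-1.
  by apply: hD; rewrite invr_gt0 exprn_gt0.
have [N hN] := choice ex.
pose phi := fix phi k := if k is j.+1 then maxn (phi j).+1 (N k) else N 0%N.
have phiS k : (phi k < phi k.+1)%N by rewrite /= leq_max leqnn.
have Nphi k : (N k <= phi k)%N by case: k => //= k; rewrite leq_max leqnn orbT.
exists phi; split; last by move=> k n kn; apply: hN => //; exact: leq_trans kn.
  by elim=> // k IH; exact: leq_ltn_trans IH (phiS k).
by move=> k; exact: ltnW.
Qed.

(** A fast subsequence converges almost everywhere, and by [telescope_nsq] its squared
    distance to the limit is bounded by an integrable function. *)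
Theorem L2_complete (gn : nat -> R -> C) : (forall n, sqint (gn n)) ->
  (forall e, 0 < e -> exists N, forall n m, (N <= n)%N -> (N <= m)%N ->
     mass (fun x => gn n x - gn m x) <= e) ->
  exists2 g, sqint g & mass (fun x => gn n x - g x) @[n --> \oo] --> 0.
Proof.
move=> hg cauchy.
have [phi [phik phiS hphi]] := fast_subsequence cauchy.
pose d (k : nat) (x : R) : R := 2 ^+ k * nsq (gn (phi k.+1) x - gn (phi k) x).
have d0 k x : 0 <= d k x by rewrite mulr_ge0 ?nsq_ge0// exprn_ge0.
have id k : Rint (d k) := RintZ (2 ^+ k) (sqintB (hg (phi k.+1)) (hg (phi k))).2.
have RId k : RI (d k) <= (2 ^+ k)^-1.
  rewrite /d (RIZ _ (sqintB (hg (phi k.+1)) (hg (phi k))).2).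
  have := hphi k _ (phiS k); rewrite /mass => h.
  apply: le_trans (ler_wpM2l (exprn_ge0 k (ler0n R 2)) h) _.
  have -> : 4 = 2 * 2 :> R by rewrite -natrM.
  by rewrite exprMn invfM mulrA divff ?mul1r// expf_neq0.
have hB n : \sum_(k < n) RI (d k) <= 2.
  apply: (@le_trans _ _ (2 - 2 * (2 ^+ n)^-1)); last first.
    by rewrite lerBlDr lerDl mulr_ge0// invr_ge0 exprn_ge0.
  elim: n => [|n IH]; first by rewrite big_ord0 expr0 invr1 mulr1 subrr.
  rewrite big_ord_recr /=; apply: le_trans (lerD IH (RId n)) _.
  by rewrite exprS invfM mulrA divff ?mul1r//; lra.
have [A [s [mA aeA is_ s0 hA]]] := beppo_levi d0 id hB.
have ex x : exists l : C, (A x -> [/\ Re (gn (phi k) x) @[k --> \oo] --> Re l,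
     Im (gn (phi k) x) @[k --> \oo] --> Im l &
    forall j, nsq (gn (phi j) x - l) <= 2 * (2 ^+ j)^-1 * s x]) /\ (~ A x -> l = 0).
  have [Ax|nA] := pselect (A x); last by exists 0; split.
  have [l hl] := @telescope_cvg (fun k => gn (phi k) x) (s x) (hA x Ax).
  by exists l; split.
have [g hgl] := choice ex.
have m1A : measurable_fun [set: R] (\1_A : R -> R) by exact: measurable_indic.
have lim1 (p : C -> R) : p 0 = 0 -> (forall n, measurable_fun [set: R] (fun x => p (gn n x))) ->
   (forall x, A x -> p (gn (phi k) x) @[k --> \oo] --> p (g x)) -> measurable_fun [set: R] (fun x => p (g x)).
  move=> p0 mp hp.
  apply: (@measurable_fun_cvg _ _ R [set: R] (fun k x => p (gn (phi k) x) * \1_A x)).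
    by move=> k; exact: measurable_funM.
  move=> x _; have [Ax|nA] := pselect (A x).
    by rewrite indicE mem_set// mulr1n; under eq_fun do rewrite mulr1; exact: hp.
  rewrite (hgl x).2// p0 indicE memNset//; under eq_fun do rewrite mulr0.
  exact: cvg_cst.
have mg : cmeasurable g.
  split; apply: lim1 => //.
  - by move=> n; case: (hg n) => -[].
  - by move=> x Ax; have [/(_ Ax)[]] := hgl x.
  - by move=> n; case: (hg n) => -[].
  - by move=> x Ax; have [/(_ Ax)[]] := hgl x.
have bd j x : A x -> nsq (gn (phi j) x - g x) <= 2 * (2 ^+ j)^-1 * s x.
  by move=> Ax; have [/(_ Ax)[]] := hgl x.
have sg : sqint g.
  split => //; apply: (Rint_dom (nsq_meas mg) (RintD (RintZ 2 (hg (phi 0%N)).2) (RintZ 4 is_))) => x.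
  rewrite ger0_norm ?nsq_ge0//; have [Ax|nA] := pselect (A x); last first.
    rewrite (hgl x).2// nsq0; have := nsq_ge0 (gn (phi 0%N) x); have := s0 x; lra.
  have := bd 0%N x Ax; rewrite expr0 invr1 mulr1.
  have := nsq_parallelogram (gn (phi 0%N) x) (gn (phi 0%N) x - g x).
  have -> : gn (phi 0%N) x - (gn (phi 0%N) x - g x) = g x by ring.
  lra.
exists g => //.
have sub j : mass (fun x => gn (phi j) x - g x) <= 2 * (2 ^+ j)^-1 * RI s.
  have [mj ij] := sqintB (hg (phi j)) sg.
  have mj1 : measurable_fun [set: R] (fun x => nsq (gn (phi j) x - g x) * \1_A x).
    by apply: measurable_funM => //; exact: nsq_meas.
  have ae1 : {ae mu, forall x, nsq (gn (phi j) x - g x) = nsq (gn (phi j) x - g x) * \1_A x}.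
    apply: (@filterS _ _ (ae_filter_ringOfSetsType mu) _ _ _ aeA) => x /= Ax.
    by rewrite indicE mem_set// mulr1.
  rewrite /mass (RI_ae (nsq_meas mj) mj1 ae1).
  have le1 x : nsq (gn (phi j) x - g x) * \1_A x <= nsq (gn (phi j) x - g x).
    by rewrite indicE ler_piMr ?nsq_ge0// lern1 leq_b1.
  have i1 : Rint (fun x => nsq (gn (phi j) x - g x) * \1_A x).
    apply: (Rint_dom mj1 ij) => x; rewrite ger0_norm ?le1// mulr_ge0 ?nsq_ge0// indicE ler0n//.
  rewrite -(RIZ _ is_); apply: (RI_le i1 (RintZ _ is_)) => x.
  rewrite indicE; have [Ax|nA] := pselect (A x).
    by rewrite mem_set// mulr1; exact: bd.
  by rewrite memNset// mulr0 mulr_ge0// mulr_ge0// invr_ge0 exprn_ge0.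
apply/(@cvgrPdist_le _ R^o) => e e0.
have e4 : 0 < e / 4 by rewrite divr_gt0.
have [N hN] := cauchy _ e4.
have /(@cvgrPdist_le _ R^o) /(_ _ e4) [j0 _ hj] := pow2_cvg0 (RI s).
pose j := maxn j0 N.
have := hj j (leq_maxl _ _); rewrite /= sub0r normrN => /(le_trans (ler_norm _)) sj.
exists N => // n /= Nn; rewrite sub0r normrN ger0_norm ?mass_ge0//.
have t := mass_triangle (hg n) (hg (phi j)) sg.
have := hN n (phi j) Nn (leq_trans (leq_maxr _ _) (phik j)).
have := sub j; lra.
Qed.

Section Weighted.
Variable om : R -> R.
Hypotheses (mom : measurable_fun [set: R] om) (om0 : forall x, 0 <= om x) (om1 : forall x, om x <= 1).

Lemma Rint_weighted f : sqint f -> Rint (fun x => nsq (f x) * om x).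
Proof.
move=> [mf i]; apply: (Rint_dom _ i).
  by apply: measurable_funM => //; exact: nsq_meas.
by move=> x; rewrite ger0_norm ?mulr_ge0 ?nsq_ge0// ler_piMr ?nsq_ge0.
Qed.

Lemma weighted_le f g : sqint f -> sqint g ->
  RI (fun x => nsq (f x) * om x) <= 2 * RI (fun x => nsq (g x) * om x) + 2 * mass (fun x => g x - f x).
Proof.
move=> hf hg; have i1 := Rint_weighted hf; have i2 := Rint_weighted hg; have i3 := (sqintB hg hf).2.
rewrite /mass -(RIZ 2 i2) -(RIZ 2 i3) -(RID (RintZ 2 i2) (RintZ 2 i3)).
apply: (RI_le i1 (RintD (RintZ 2 i2) (RintZ 2 i3))) => x.
have := nsq_parallelogram (g x) (g x - f x).
have -> : g x - (g x - f x) = f x by ring.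
have := nsq_ge0 (g x - f x); have := om0 x; have := om1 x; nra.
Qed.

(** The factor 4 comes from the parallelogram inequality, used on both sides. *)
Lemma weighted_limit (gn hn : nat -> R -> C) (g h : R -> C) (B : R) : 0 <= B ->
  (forall n, sqint (gn n)) -> (forall n, sqint (hn n)) -> sqint g -> sqint h ->
  mass (fun x => gn n x - g x) @[n --> \oo] --> 0 ->
  mass (fun x => hn n x - h x) @[n --> \oo] --> 0 ->
  (\forall n \near \oo, RI (fun x => nsq (gn n x) * om x) <= B * RI (fun x => nsq (hn n x) * om x)) ->
  RI (fun x => nsq (g x) * om x) <= 4 * B * RI (fun x => nsq (h x) * om x).
Proof.
move=> B0 sgn shn sg sh cg ch hB.
pose r n := 2 * (B * (2 * RI (fun x => nsq (h x) * om x) + 2 * mass (fun x => hn n x - h x))) +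
  2 * mass (fun x => gn n x - g x).
have lim : r n @[n --> \oo] --> 2 * (B * (2 * RI (fun x => nsq (h x) * om x) + 2 * 0)) + 2 * 0.
  apply: cvgD; last exact: cvgMr.
  apply: cvgMr; apply: cvgMr; apply: cvgD; [exact: cvg_cst|exact: cvgMr].
have E : 2 * (B * (2 * RI (fun x => nsq (h x) * om x) + 2 * 0)) + 2 * 0 = 4 * B * RI (fun x => nsq (h x) * om x).
  by ring.
rewrite E in lim; rewrite -(cvg_lim _ lim)//.
apply: limr_ge; first exact: (cvgP _ lim).
apply: filterS hB => n hn'.
apply: le_trans (weighted_le sg (sgn n)) _; rewrite /r lerD2r ler_pM2l//.
apply: le_trans hn' _; apply: ler_wpM2l => //.
have := weighted_le (shn n) sh.
by rewrite (_ : mass (fun x => h x - hn n x) = mass (fun x => hn n x - h x))//;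
  congr RI; apply/funext => x; rewrite nsqBC.
Qed.
End Weighted.
End L2.

(** * Schwartz solutions and the Fourier transform of square integrable functions *)

Section Schwartz.
Context {R : realType}.
Local Notation C := R[i].
Local Notation Re := (@complex.Re R).
Local Notation Im := (@complex.Im R).
Local Notation mu := (@lebesgue_measure R).

Lemma cD_cderive1 (f : R -> C) x : cderivable f x -> cD f x (cderive1 f x).
Proof. by move=> [h1 h2]; split; rewrite /cderive1 /= derive1E; exact: derivableP. Qed.

Lemma norm_Re_normc (z : C) : `|Re z| <= Normc.normc z /\ `|Im z| <= Normc.normc z.
Proof.
by rewrite normcE'; split; rewrite -sqrtr_sqr ler_sqrt ?nsq_ge0// /nsq ?lerDl ?lerDr sqr_ge0.
Qed.

Lemma schwartz_decaying (f : R -> C) : schwartz f -> decaying f.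
Proof.
move=> [d b]; split.
  by apply: (@cD_ccont R f (cderive1 f)) => x; apply: cD_cderive1; exact: (d 0%N x).
have [M0 h0] := b 0%N 0%N; have [M2 h2] := b 2%N 0%N.
have K x : Normc.normc (f x) <= (M0 + M2) * wt x.
  rewrite /wt ler_pdivlMr ?wt_den// mulrC mulrDl mul1r.
  by apply: lerD; [have := h0 x; rewrite expr0 mul1r|have := h2 x; rewrite real_normK ?num_real].
have K0 : 0 <= M0 + M2.
  have := K 0; rewrite /wt expr0n addr0 invr1 mulr1; apply: le_trans.
  by rewrite normcE' sqrtr_ge0.
exists (M0 + M2) => // x; have [a1 a2] := norm_Re_normc (f x).
by split; [exact: le_trans a1 (K x)|exact: le_trans a2 (K x)].
Qed.

Lemma decayingB (f g : R -> C) : decaying f -> decaying g -> decaying (fun x => f x - g x).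
Proof.
move=> [[c1 c2] [K K0 hK]] [[d1 d2] [L L0 hL]]; split.
  split.
    by under eq_fun do rewrite ReD ReN; move=> x; apply: cvgB; [exact: c1|exact: d1].
  by under eq_fun do rewrite ImD ImN; move=> x; apply: cvgB; [exact: c2|exact: d2].
exists (K + L); first exact: addr_ge0.
move=> x; rewrite mulrDl ReD ReN ImD ImN; have [a1 a2] := hK x; have [b1 b2] := hL x.
by split; apply: le_trans (ler_normB _ _) _; exact: lerD.
Qed.

Lemma decaying_sqint (f : R -> C) : decaying f -> sqint f.
Proof.
by move=> nf; split; [case: nf => -[c1 c2] _; split; exact: cont_meas|exact: Rint_nsq].
Qed.

Lemma fourierB (f g : R -> C) eta : decaying f -> decaying g ->
  fourier_integral (fun x => f x - g x) eta = fourier_integral f eta - fourier_integral g eta.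
Proof.
move=> [[c1 c2] [K K0 hK]] [[d1 d2] [L L0 hL]].
have cN (h : R -> R) : continuous h -> continuous (fun x => - h x).
  by move=> ch x; apply: cvgN; exact: ch.
have bN (h : R -> R) (B : R) : (forall x, `|h x| <= B * wt x) -> forall x, `|- h x| <= B * wt x.
  by move=> bh x; rewrite normrN.
have i1 := Rint_ft c1 c2 (fun x => (hK x).1) (fun x => (hK x).2) eta.
have i2 := Rint_ft d1 d2 (fun x => (hL x).1) (fun x => (hL x).2) eta.
have i3 := Rint_ft c2 (cN _ c1) (fun x => (hK x).2) (bN _ _ (fun x => (hK x).1)) eta.
have i4 := Rint_ft d2 (cN _ d1) (fun x => (hL x).2) (bN _ _ (fun x => (hL x).1)) eta.
apply: eq_ReIm.
  rewrite ReD ReN !Re_fourier -mulrBr; congr (_ * _).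
  rewrite /ft -(RIB i1 i2); congr RI; apply/funext => x.
  by rewrite !cE; ring.
rewrite ImD ImN !Im_fourier -mulrBr; congr (_ * _).
rewrite /ft -(RIB i3 i4); congr RI; apply/funext => x.
by rewrite !cE; ring.
Qed.

Lemma sqint_fourier (f : R -> C) : decaying f -> sqint (fourier_integral f).
Proof.
move=> nf; split; last by case: (plancherel nf).
have [[c1 c2] [K K0 hK]] := nf; split.
  under eq_fun do rewrite Re_fourier; apply: measurable_funM => //.
  exact: (ft_meas c1 c2 K0 (fun x => (hK x).1) (fun x => (hK x).2)).
under eq_fun do rewrite Im_fourier; apply: measurable_funM => //.
apply: (ft_meas c2 _ K0 (fun x => (hK x).2)); first by move=> x; apply: cvgN; exact: c1.
by move=> x; rewrite normrN; case: (hK x).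
Qed.

Lemma fourier_isometry (f g : R -> C) : decaying f -> decaying g ->
  mass (fun eta => fourier_integral f eta - fourier_integral g eta) = mass (fun x => f x - g x).
Proof.
move=> nf ng; rewrite -(plancherel (decayingB nf ng)).2 /mass; congr RI; apply/funext => eta.
by rewrite fourierB.
Qed.

Lemma cvg_mass_cauchy (fn : nat -> R -> C) (f : R -> C) (e : R) : (forall n, sqint (fn n)) -> sqint f ->
  mass (fun x => fn n x - f x) @[n --> \oo] --> 0 -> 0 < e ->
  exists N, forall n m, (N <= n)%N -> (N <= m)%N -> mass (fun x => fn n x - fn m x) <= e.
Proof.
move=> sfn sf lim e0; have e4 : 0 < e / 4 by rewrite divr_gt0.
have /(@cvgrPdist_le _ R^o) /(_ _ e4) [N _ hN] := lim.
have small n : (N <= n)%N -> mass (fun x => fn n x - f x) <= e / 4.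
  by move=> /hN; rewrite /= sub0r normrN ger0_norm// mass_ge0.
exists N => n m /small h1 /small h2.
have := mass_triangle (sfn n) sf (sfn m).
rewrite (_ : mass (fun x => f x - fn m x) = mass (fun x => fn m x - f x)); last first.
  by congr RI; apply/funext => x; rewrite nsqBC.
lra.
Qed.

(** By isometry, two sequences with the same limit have transforms at vanishing distance; so
    the representative chosen by [fourier] is the limit along every approximating sequence. *)
Lemma fourier_limit (fn : nat -> R -> C) (f : R -> C) : sqint f ->
  (forall n, schwartz (fn n)) -> mass (fun x => fn n x - f x) @[n --> \oo] --> 0 ->
  sqint (fourier f) /\
  mass (fun eta => fourier_integral (fn n) eta - fourier f eta) @[n --> \oo] --> 0.
Proof.
move=> sf sfn lim.
have nfn n := schwartz_decaying (sfn n).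
have qfn n := decaying_sqint (nfn n); have qF n := sqint_fourier (nfn n).
have ex : exists g, is_fourier f g.
  have [|g sg hg] := L2_complete qF.
    move=> e e0; have [N hN] := cvg_mass_cauchy qfn sf lim e0.
    by exists N => n m h1 h2; rewrite fourier_isometry//; exact: hN.
  exists g; split; first exact/in_L2P.
  exists fn; split => //; first by apply/(cvg_L2P qfn sf).
  exact/(cvg_L2P qF sg).
have [g0 hg0] := ex.
have := xgetPex (fun=> 0) ex; rewrite -/(fourier f) /= => -[/in_L2P sg [hn [shn /cvg_L2P limh limF]]].
have nhn n := schwartz_decaying (shn n); have qhn n := decaying_sqint (nhn n).
have qG n := sqint_fourier (nhn n).
have {}limh := limh qhn sf.
have {}limF := (cvg_L2P qG sg).1 limF.
split; first exact: sg.
apply: (@squeeze_cvgr _ _ _ _ (fun=> 0) (fun n => 2 * (2 * mass (fun x => fn n x - f x) + 2 * mass (fun x => hn n x - f x))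
   + 2 * mass (fun eta => fourier_integral (hn n) eta - fourier f eta))).
- apply: nearW => n; rewrite mass_ge0 /=.
  apply: le_trans (mass_triangle (qF n) (qG n) sg) _; rewrite lerD2r ler_pM2l//.
  rewrite fourier_isometry//; apply: le_trans (mass_triangle (qfn n) sf (qhn n)) _.
  rewrite lerD2l ler_pM2l// (_ : mass (fun x => f x - hn n x) = mass (fun x => hn n x - f x))//.
  by congr RI; apply/funext => x; rewrite nsqBC.
- exact: cvg_cst.
- have -> : 0 = 2 * (2 * 0 + 2 * 0) + 2 * 0 :> R by ring.
  apply: cvgD; last exact: cvgMr.
  by apply: cvgMr; apply: cvgD; exact: cvgMr.
Qed.

Lemma nls_classical_flow (u : R -> R -> C) (u0 : R -> C) : nls_classical_solution u u0 ->
  nls_flow u (dt u) (dxi u) (dxi (dxi u)).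
Proof.
move=> [der [c1 c2 c3 _] eqn _]; apply: NlsFlow; [| | | |exact: c1|exact: c2|exact: c3].
- by move=> x t; apply: cD_cderive1; case: (der x t).
- by move=> x t; apply: cD_cderive1; case: (der x t).
- by move=> x t; apply: cD_cderive1; case: (der x t).
move=> x t; have := eqn x t; rewrite normC_nsq conjM => E.
have ii : 'i * 'i = -1 :> C by apply: eq_ReIm; rewrite !cE; ring.
have -> : dt u x t = - ('i * ('i * dt u x t)) by rewrite mulrA ii mulN1r opprK.
by rewrite E; ring.
Qed.

(** With [th = 2 m / kap <= 1 / 4] the quotient [(1 + 3 th) (1 + th) / (1 - 2 th)] is at most
    [35 / 8]. *)
Lemma factor_five (m kap a b : R) : 0 < m -> 0 < kap -> 8 * m <= kap -> 0 <= a -> 0 <= b ->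
  (1 - 2 * (2 * m / kap)) * a <= (1 + 3 * (2 * m / kap)) * ((1 + 2 * m / kap) * b) -> a <= 5 * b.
Proof.
move=> m0 k0 mk a0 b0.
have th0 : 0 <= 2 * m / kap by rewrite divr_ge0 ?mulr_ge0 ?ltW.
have th1 : 2 * m / kap <= 1 / 4 by rewrite ler_pdivrMr//; move: mk; lra.
move: (2 * m / kap) th0 th1 => th th0 th1 h.
have h1 : 1 / 2 * a <= (1 - 2 * th) * a by apply: ler_wpM2r => //; lra.
have h2 : (1 + 3 * th) * ((1 + th) * b) <= 7 / 4 * (5 / 4 * b).
  apply: ler_pM; [lra|by rewrite mulr_ge0//; lra|lra|by apply: ler_wpM2r => //; lra].
lra.
Qed.

(** Mass conservation supplies the bound [m] at all times. *)
Theorem schwartz_comparison (u : R -> R -> C) (u0 : R -> C) (m k s t1 t2 : R) :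
  nls_schwartz_solution u u0 -> 0 < m -> mass u0 <= m -> 2 <= k -> 8 * m <= k -> -1 <= s <= 0 ->
  RI (fun eta => nsq (fourier_integral (u^~ t1) eta) * (k ^+ 2 + eta ^+ 2) `^ s) <=
  5 * RI (fun eta => nsq (fourier_integral (u^~ t2) eta) * (k ^+ 2 + eta ^+ 2) `^ s).
Proof.
move=> [cl sch] m0 mu0 k2 mk s01.
have fl := nls_classical_flow cl; have nu t := schwartz_decaying (sch t).
have mc t := mass_conserved fl nu t.
have u00 : u^~ 0 = u0 by apply/funext => x; case: cl.
have mb t : mass (u^~ t) <= m by rewrite mc u00.
apply: energy_interpolation => //.
- by apply: le_trans k2; rewrite ler1n.
- by rewrite mc (mc t2) ler_peMl ?mass_ge0// ler1n.
move=> kap kkap.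
have kap2 : 2 <= kap by apply: le_trans kkap.
have mkap : 8 * m <= kap by apply: le_trans kkap.
have kap0 : 0 < kap by apply: lt_le_trans kap2.
have e0 (f : R -> C) : 0 <= energy kap f.
  by apply: RI_ge0 => eta; rewrite divr_ge0 ?nsq_ge0// addr_ge0 ?sqr_ge0.
apply: (factor_five m0 kap0 mkap (e0 _) (e0 _)).
have [h|/ltW h] := leP t1 t2.
  by apply: (energy_compare fl nu kap2 m0 mkap h (fun t _ => mb t)); left.
by apply: (energy_compare fl nu kap2 m0 mkap h (fun t _ => mb t)); right.
Qed.
End Schwartz.

(** * Sobolev norms of square integrable solutions *)

Section Assembly.
Context {R : realType}.
Local Notation C := R[i].
Local Notation mu := (@lebesgue_measure R).

(** For [g = fourier f] this is the square of the Sobolev norm of [f]. *)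
Definition bessel (s : R) (g : R -> C) : R := RI (fun eta => nsq (g eta) * (1 + eta ^+ 2) `^ s).

Section Weight.
Variables (k s : R).
Hypotheses (k1 : 1 <= k) (s01 : -1 <= s <= 0).

Lemma weight_meas : measurable_fun [set: R] (fun eta : R => (k ^+ 2 + eta ^+ 2) `^ s).
Proof.
have D0 (eta : R) : 0 < k ^+ 2 + eta ^+ 2.
  by apply: (lt_le_trans ltr01); rewrite -[1]addr0 lerD ?sqr_ge0// exprn_ege1.
rewrite (_ : (fun eta => _) = (fun eta : R => expR (s * ln (k ^+ 2 + eta ^+ 2)))); last first.
  by apply/funext => eta; rewrite /powR gt_eqF.
have mx : measurable_fun [set: R] (fun eta : R => k ^+ 2 + eta ^+ 2).
  have d (eta : R) : is_derive eta (1:R) (fun eta : R => k ^+ 2 + eta ^+ 2) (2 * eta).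
    by eapply rD_eq; [rD|ring].
  by apply: cont_meas => eta; exact: rD_continuous (d eta).
apply: (measurableT_comp (f := expR)); first by apply: cont_meas; exact: continuous_expR.
apply: measurable_funM => //; apply: (measurableT_comp _ mx); exact: measurable_ln.
Qed.

Lemma weight_le1 (eta : R) : (k ^+ 2 + eta ^+ 2) `^ s <= 1.
Proof.
have k2 : 1 <= k ^+ 2 + eta ^+ 2 by rewrite -[1]addr0 lerD ?sqr_ge0// exprn_ege1.
rewrite -(powRr0 (k ^+ 2 + eta ^+ 2)); apply: ler_powR => //.
by case/andP: s01.
Qed.

Lemma powR_npos_le (x y : R) : 0 < x -> x <= y -> y `^ s <= x `^ s.
Proof.
move=> x0 xy; have y0 := lt_le_trans x0 xy; have /andP[_ s0] := s01.
by rewrite /powR !gt_eqF// ler_expR; apply: ler_wnM2l => //; rewrite ler_ln ?posrE.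
Qed.

Lemma weight_le_bessel (eta : R) : (k ^+ 2 + eta ^+ 2) `^ s <= (1 + eta ^+ 2) `^ s.
Proof.
by apply: powR_npos_le; [exact: wt_den|rewrite lerD2r exprn_ege1].
Qed.

Lemma bessel_le_weight (eta : R) :
  (k ^+ 2) `^ s * (1 + eta ^+ 2) `^ s <= (k ^+ 2 + eta ^+ 2) `^ s.
Proof.
have k20 : 1 <= k ^+ 2 by rewrite exprn_ege1.
have e0 := sqr_ge0 eta.
rewrite -powRM; [|exact: sqr_ge0|exact: ltW (wt_den eta)].
apply: powR_npos_le; first by apply: (lt_le_trans ltr01); lra.
by rewrite mulrDr mulr1 lerD2l ler_peMl.
Qed.
End Weight.

Lemma sobolev_norm_bessel (s : R) (f : R -> C) : -1 <= s <= 0 -> sqint (fourier f) ->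
  sobolev_norm s f = (Num.sqrt (bessel s (fourier f)))%:E.
Proof.
move=> s01 sf; have i := @Rint_weighted R (fun eta => (1 + eta ^+ 2) `^ s) _ _ _ (fourier f) sf.
have {}i : Rint (fun eta => nsq (fourier f eta) * (1 + eta ^+ 2) `^ s).
  apply: i; first by have := weight_meas s (lexx 1); rewrite expr1n.
    by move=> x; exact: powR_ge0.
  by move=> x; have := weight_le1 (lexx 1) s01 x; rewrite expr1n.
rewrite /sobolev_norm (_ : (\int[mu]_eta _)%E = (bessel s (fourier f))%:E); last first.
  rewrite -(RI_EFin i); apply: eq_integral => eta _.
  by rewrite real_normK ?num_real// normc_nsq mulrC.
rewrite poweR_EFin powR12_sqrt//.
by apply: RI_ge0 => eta; rewrite mulr_ge0 ?nsq_ge0// powR_ge0.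
Qed.

(** With [P = (1 + N)^(-2 s)], the factor in front of [a] is at least [P^-2 / 256], and
    [20 * 256 <= 80 ^ 2]. *)
Lemma sqrt_bound (N s a b : R) : 0 <= N -> -1 <= s <= 0 -> 0 <= a -> 0 <= b ->
  ((16 * (1 + N) ^+ 2) ^+ 2) `^ s * a <= 20 * b ->
  Num.sqrt a <= 80 * ((1 + N) `^ (-2 * s) * Num.sqrt b).
Proof.
move=> N0 /andP[s1 s0] a0 b0 h.
have n0 : 0 < 1 + N by lra.
pose P := (1 + N) `^ (-2 * s).
have P0 : 0 < P by exact: powR_gt0.
pose W := ((16 * (1 + N) ^+ 2) ^+ 2) `^ s.
have E : W = (16 ^+ 2) `^ s * (P ^+ 2)^-1.
  rewrite /W exprMn powRM ?sqr_ge0//; congr (_ * _).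
  rewrite /P /powR !gt_eqF ?exprn_gt0//.
  by rewrite -exprM lnXn// -expRM_natl -expRN -mulr_natl; congr expR; ring.
have c1 : 1 <= 16 ^+ 2 :> R by rewrite exprn_ege1// ler1n.
have c0 : 0 < 16 ^+ 2 :> R := lt_le_trans ltr01 c1.
have c16 : (16 ^+ 2)^-1 <= (16 ^+ 2) `^ s :> R.
  by rewrite -powR_inv1 ?(ltW c0)//; apply: ler_powR.
have P2 : 0 < P ^+ 2 by rewrite exprn_gt0.
have Wb : (16 ^+ 2)^-1 * (P ^+ 2)^-1 * a <= 20 * b.
  apply: le_trans h; rewrite -/W E.
  by apply: ler_wpM2r => //; apply: ler_wpM2r => //; rewrite invr_ge0 ltW.
have aW : a <= 20 * b * (16 ^+ 2 * P ^+ 2).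
  by rewrite -ler_pdivrMr ?mulr_gt0// invfM mulrC.
have Pb : 0 <= P ^+ 2 * b by rewrite mulr_ge0// ltW.
have sq : a <= (80 * (P * Num.sqrt b)) ^+ 2.
  rewrite 2!exprMn sqr_sqrtr//; apply: le_trans aW _.
  have -> : 20 * b * (16 ^+ 2 * P ^+ 2) = (20 * 16 ^+ 2) * (P ^+ 2 * b) by ring.
  by apply: ler_wpM2r => //; lra.
have pos : 0 <= 80 * (P * Num.sqrt b).
  by apply: mulr_ge0 => //; apply: mulr_ge0; [exact: ltW|exact: sqrtr_ge0].
by rewrite -(ger0_norm pos) -sqrtr_sqr ler_sqrt// sqr_ge0.
Qed.

Lemma two_sided_bound (N s x y : R) : 0 <= N ->
  y <= 80 * ((1 + N) `^ (-2 * s) * x) -> x <= 80 * ((1 + N) `^ (-2 * s) * y) ->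
  ((80^-1)%:E * (1 + N%:E) `^ (2 * s) * x%:E <= y%:E)%E /\
  (y%:E <= 80%:E * (1 + N%:E) `^ (-2 * s) * x%:E)%E.
Proof.
move=> N0 U L.
rewrite -EFinD !poweR_EFin -!EFinM !lee_fin; split; last by rewrite -mulrA.
have n0 : 0 < 1 + N by apply: ltr_wpDr.
have E : (1 + N) `^ (2 * s) * (1 + N) `^ (-2 * s) = 1.
  by rewrite mulNr powRN divff// gt_eqF// powR_gt0.
have P0 : 0 <= 80^-1 * (1 + N) `^ (2 * s) by rewrite mulr_ge0 ?invr_ge0 ?powR_ge0.
apply: le_trans (ler_wpM2l P0 L) _.
rewrite [leLHS](_ : _ = ((1 + N) `^ (2 * s) * (1 + N) `^ (-2 * s)) * y); last by field.
by rewrite E mul1r.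
Qed.

Lemma bessel_transfer (k s : R) (g h : R -> C) : 1 <= k -> -1 <= s <= 0 -> sqint g -> sqint h ->
  RI (fun eta => nsq (g eta) * (k ^+ 2 + eta ^+ 2) `^ s) <=
    20 * RI (fun eta => nsq (h eta) * (k ^+ 2 + eta ^+ 2) `^ s) ->
  (k ^+ 2) `^ s * bessel s g <= 20 * bessel s h.
Proof.
move=> k1 s01 sg sh.
have m1 : measurable_fun [set: R] (fun eta : R => (1 + eta ^+ 2) `^ s).
  by have := weight_meas s (lexx 1); rewrite expr1n.
have l1 eta : (1 + eta ^+ 2) `^ s <= 1.
  by have := weight_le1 (lexx 1) s01 eta; rewrite expr1n.
have p1 (x : R) : 0 <= x `^ s by exact: powR_ge0.
have ig := Rint_weighted m1 (fun eta => p1 _) l1 sg.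
have ih := Rint_weighted m1 (fun eta => p1 _) l1 sh.
have jg := Rint_weighted (weight_meas s k1) (fun eta => p1 _) (weight_le1 k1 s01) sg.
have jh := Rint_weighted (weight_meas s k1) (fun eta => p1 _) (weight_le1 k1 s01) sh.
move=> H; apply: (@le_trans _ _ (RI (fun eta => nsq (g eta) * (k ^+ 2 + eta ^+ 2) `^ s))).
  rewrite /bessel -(RIZ _ ig); apply: (RI_le (RintZ _ ig) jg) => eta.
  by rewrite mulrCA ler_wpM2l ?nsq_ge0// bessel_le_weight.
apply: le_trans H _; apply: (ler_wpM2l (ler0n R 20)); apply: (RI_le jh ih) => eta.
by rewrite ler_wpM2l ?nsq_ge0// weight_le_bessel.
Qed.

Section Solution.
Variables (q0 : R -> C) (q : R -> R -> C) (t s : R).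
Hypotheses (q0_L2 : in_L2 q0) (sol : nls_L2_solution q q0) (s01 : -1 <= s <= 0).
Let N := Num.sqrt (mass q0).
Let k := 16 * (1 + N) ^+ 2.

Lemma bessel_comparison : [/\ sqint (fourier q0), sqint (fourier (q^~ t)),
  (k ^+ 2) `^ s * bessel s (fourier (q^~ t)) <= 20 * bessel s (fourier q0) &
  (k ^+ 2) `^ s * bessel s (fourier q0) <= 20 * bessel s (fourier (q^~ t))].
Proof.
have /in_L2P sq0 := q0_L2.
have [qL2 [q0n [qn [S0 C0 Sn Cn]]]] := sol.
have /in_L2P sqt := qL2 t.
have nq0 n := decaying_sqint (schwartz_decaying (S0 n)).
have nqt n := decaying_sqint (schwartz_decaying ((Sn n).2 t)).
have lim0 := (cvg_L2P nq0 sq0).1 C0.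
have limt := (cvg_L2P nqt sqt).1 (Cn t).
have [h1 F1] := fourier_limit sq0 S0 lim0.
have [h2 F2] := fourier_limit sqt (fun n => (Sn n).2 t) limt.
have N0 : 0 <= N by exact: sqrtr_ge0.
have NM : N ^+ 2 = mass q0 by rewrite sqr_sqrtr// mass_ge0.
(* The data [q0n n] have mass at most [m] eventually, and [8 m = 16 N^2 + 8 <= k]. *)
pose m := 2 * mass q0 + 1.
have m0 : 0 < m by rewrite /m; have := mass_ge0 q0; lra.
have k16 : 16 <= k.
  by rewrite /k; have : 1 <= (1 + N) ^+ 2 by [rewrite exprn_ege1// lerDl]; lra.
have k2 : 2 <= k by lra.
have k1 : 1 <= k by lra.
have mk : 8 * m <= k.
  by rewrite /k /m -NM; have := N0; nra.
have ev : \forall n \near \oo, mass (q0n n) <= m.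
  have e12 : 0 < 1 / 2 :> R by lra.
  have /(@cvgrPdist_le _ R^o) /(_ _ e12) := lim0.
  apply: filterS => n; rewrite sub0r normrN ger0_norm ?mass_ge0// => small.
  have := mass_parallelogram sq0 (sqintB sq0 (nq0 n)).
  rewrite (_ : (fun x => q0 x - (q0 x - q0n n x)) = q0n n); last by apply/funext => x; ring.
  rewrite (_ : mass (fun x => q0 x - q0n n x) = mass (fun x => q0n n x - q0 x)); last first.
    by congr RI; apply/funext => x; rewrite nsqBC.
  by rewrite /m; lra.
have init n : (qn n)^~ 0 = q0n n by apply/funext => x; case: (Sn n) => -[].
have qF0 n := sqint_fourier (schwartz_decaying (S0 n)).
have qFt n := sqint_fourier (schwartz_decaying ((Sn n).2 t)).
have W1 := weight_meas s k1.
have W2 (eta : R) : 0 <= (k ^+ 2 + eta ^+ 2) `^ s by exact: powR_ge0.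
have W3 := weight_le1 k1 s01.
have b5 : 0 <= 5 :> R by [].
have four5 : 4 * 5 = 20 :> R by rewrite -natrM.
have G1 := weighted_limit W1 W2 W3 b5 qFt qF0 h2 h1 F2 F1.
have G2 := weighted_limit W1 W2 W3 b5 qF0 qFt h1 h2 F1 F2.
split; [exact: h1|exact: h2| |].
  apply: bessel_transfer => //; rewrite -four5; apply: G1.
  apply: filterS ev => n hn; rewrite -(init n).
  exact: (schwartz_comparison t 0 (Sn n) m0 hn k2 mk s01).
apply: bessel_transfer => //; rewrite -four5; apply: G2.
apply: filterS ev => n hn; rewrite -(init n).
exact: (schwartz_comparison 0 t (Sn n) m0 hn k2 mk s01).
Qed.
End Solution.
End Assembly.

Theorem theorem1p2 (R : realType) :
  exists C1 C2 : R, [/\ 0 < C1, 0 < C2 &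
    forall (q0 : R -> R[i]) (q : R -> R -> R[i]),
      in_L2 q0 -> nls_L2_solution q q0 ->
      forall t s : R, -1 <= s <= 0 ->
        (C1%:E * (1 + L2norm q0) `^ (2 * s) * sobolev_norm s q0
           <= sobolev_norm s (q^~ t))%E /\
        (sobolev_norm s (q^~ t)
           <= C2%:E * (1 + L2norm q0) `^ (- 2 * s) * sobolev_norm s q0)%E].
Proof.
exists 80^-1, 80; split => //.
move=> q0 q q0L2 sol t s s01.
have [h1 h2 B1 B2] := bessel_comparison t q0L2 sol s01.
have b0 (g : R -> R[i]) : 0 <= bessel s g.
  by apply: RI_ge0 => eta; rewrite mulr_ge0 ?nsq_ge0// powR_ge0.
have N0 : 0 <= Num.sqrt (mass q0) by exact: sqrtr_ge0.
have U := sqrt_bound N0 s01 (b0 _) (b0 _) B1.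
have L := sqrt_bound N0 s01 (b0 _) (b0 _) B2.
rewrite (sobolev_norm_bessel s01 h1) (sobolev_norm_bessel s01 h2).
rewrite (L2norm_sqint ((in_L2P q0).1 q0L2)).
exact: (two_sided_bound N0 U L).
Qed.
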